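(* Let $F=\sqrt{r\,\phi(t,s)}$ be a unitary invariant complex Randers metric defined on a domain $D\subset\mathbb{C}^n$, where $r:=|v|^2$, $t:=|z|^2$, $s:=\frac{|\langle z,v\rangle|^2}{r}$. Assume that $F$ is not a Hermitian metric. Then $F$ is a weakly Kähler Finsler metric and has constant holomorphic curvature $k$ if and only if one of the following holds: 1. $k=4$, $\phi=\Big(\sqrt{\frac{t}{c^2+t^2}-\frac{t^2}{(c^2+t^2)^2}s}+\sqrt{\frac{c^2}{(c^2+t^2)^2}s}\Big)^2$, defined on $D=\mathbb{C}^n\setminus\{0\}$; 2. $k=0$, $\phi=c(\sqrt{t}+\sqrt{s})^2$, defined on $D=\mathbb{C}^n$; 3. $k=-4$, $\phi=\Big(\sqrt{\frac{t}{c^2-t^2}+\frac{t^2}{(c^2-t^2)^2}s}+\sqrt{\frac{c^2}{(c^2-t^2)^2}s}\Big)^2$, defined on $D=\{z:|z|<\sqrt{c}\}$; where $c$ is a positive constant.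
   Context: Points of the holomorphic tangent bundle $T^{1,0}D$ of $D\subset\mathbb{C}^n$ are written $(z,v)$ with $v=v^\alpha\frac{\partial}{\partial z^\alpha}$, and $\langle z,v\rangle=\sum_\alpha z^\alpha\overline{v^\alpha}$. A complex Finsler metric on a complex manifold $M$ is a continuous function $F:T^{1,0}M\to[0,+\infty)$ such that, with $G=F^2$, $G(z,v)\ge 0$ with $G(z,v)=0$ if and only if $v=0$, and $G(z,\lambda v)=|\lambda|^2G(z,v)$ for all $\lambda\in\mathbb{C}$. It is unitary invariant on a domain $D\subset\mathbb{C}^n$ if $F(Az,Av)=F(z,v)$ for all $(z,v)\in T^{1,0}D$ and all unitary matrices $A\in U(n)$. $F$ is a Hermitian metric if $G=a_{i\bar j}(z)v^i\bar v^j$ is a Hermitian form in $v$ at each $z$. A complex Finsler metric is a complex Randers metric if $F=\alpha+|\beta|$, where $\alpha=\sqrt{a_{i\bar j}(z)v^i\bar v^j}$ is a Hermitian metric and $\beta=b_i(z)v^i$ is a $(1,0)$-form. Such a metric is not smooth along the directions $v$ with $b_iv^i=0$. Subscripts $\alpha,\bar\beta$ on $G$ denote $\partial/\partial v^\alpha,\ \partial/\partial\bar v^\beta$, and subscripts after a semicolon denote derivatives in $z$ (or $\bar z$); e.g. $G_\alpha=\partial G/\partial v^\alpha$, $G_{\alpha\bar\beta}=\partial^2G/\partial v^\alpha\partial\bar v^\beta$, $G_{\bar\gamma;\beta}=\partial^2G/\partial\bar v^\gamma\partial z^\beta$; $(G^{\alpha\bar\beta})$ is the inverse of $(G_{\alpha\bar\beta})$.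 Put $N^\alpha_\beta=G^{\alpha\bar\gamma}G_{\bar\gamma;\beta}$, $\frac{\delta}{\delta z^\alpha}=\frac{\partial}{\partial z^\alpha}-N^\beta_\alpha\frac{\partial}{\partial v^\beta}$, $\delta_{\bar\gamma}=\overline{\frac{\delta}{\delta z^\gamma}}=\frac{\partial}{\partial\bar z^\gamma}-\overline{N^\mu_\gamma}\frac{\partial}{\partial\bar v^\mu}$, and $\Gamma^\alpha_{\beta;\gamma}=G^{\alpha\bar\eta}\frac{\delta G_{\beta\bar\eta}}{\delta z^\gamma}$. $F$ is weakly Kähler if $G_\alpha\Gamma^\alpha_{\beta;\gamma}v^\gamma=G_\alpha\Gamma^\alpha_{\gamma;\beta}v^\gamma$ for all $\beta$. The holomorphic curvature of $F$ is $$K_F(v)=-\frac{2}{G^2}\,G_\alpha\,\delta_{\bar\gamma}(N^\alpha_\beta)\,v^\beta\bar v^\gamma ,$$ and constant holomorphic curvature $k$ means $K_F\equiv k$.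
   Formalization: For general k the list is false (rescaling F changes k), so φ is the listed formula times a constant l>0 with lk=4, 0, −4 (l=1 if k=±4; absorbed in c if k=0); and D is only contained in the listed set, since F restricts to smaller domains and 0 is not allowed in cases 2, 3. *)

(* Defs.v *)
From HB Require Import structures.
From mathcomp Require Import all_boot all_order all_algebra.
From mathcomp Require Import all_classical all_reals all_analysis.
From mathcomp Require Export complex.

Set Implicit Arguments.
Unset Strict Implicit.
Unset Printing Implicit Defensive.

Import Order.TTheory GRing.Theory Num.Theory.
Import numFieldNormedType.Exports.

Local Open Scope classical_set_scope.
Local Open Scope ring_scope.

(* real-closed gives [R[i]] no topology: equip it with the one of its modulus,
   so that ['cV[R[i]]_n] gets the usual topology of C^n. *)
HB.instance Definition _ (R : realType) :=
  GRing.ComAlgebra.copy R[i] (R[i] : numFieldType)^o.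
HB.instance Definition _ (R : realType) :=
  Vector.copy R[i] (R[i] : numFieldType)^o.
HB.instance Definition _ (R : realType) :=
  NormedModule.copy R[i] (R[i] : numFieldType)^o.

Section ComplexSpace.
Variables (R : realType) (n : nat).
Local Notation C := R[i].
Local Notation V := 'cV[C]_n.

Definition is_domain (D : set V) : Prop :=
  [/\ open D, connected D & D !=set0].

Definition herm (z v : V) : C := \sum_(i < n) z i 0 * (v i 0)^*.
Definition sqnorm (z : V) : R := \sum_(i < n) Normc.normc (z i 0) ^+ 2.

(* Derivatives are real derivatives along the real line [p + R e], taken on
   real and imaginary parts: functions on C^n are not assumed holomorphic. *)
Definition dir_derivable (f : V -> C) (e p : V) : Prop :=
  derivable (fun h : R => complex.Re (f (p + (h%:C)%C *: e))) 0 1 /\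
  derivable (fun h : R => complex.Im (f (p + (h%:C)%C *: e))) 0 1.

Definition dir_deriv (f : V -> C) (e p : V) : C :=
  Complex (derive1 (fun h : R => complex.Re (f (p + (h%:C)%C *: e))) 0)
          (derive1 (fun h : R => complex.Im (f (p + (h%:C)%C *: e))) 0).

(* C^oo: directional derivatives of all orders exist and are continuous. *)
Definition smooth_on (D : set V) (f : V -> C) : Prop :=
  forall s : seq V,
    let g := foldr (fun e u => dir_deriv u e) f s in
    {within D, continuous g} /\
    (forall z e, D z -> dir_derivable g e z).

Definition basis_vec (i : 'I_n) : V := delta_mx i 0.

(* Wirtinger operators (d/dx - i d/dy)/2 and (d/dx + i d/dy)/2. *)
Definition wirt (i : 'I_n) (f : V -> C) (p : V) : C :=
  (dir_deriv f (basis_vec i) p - 'i * dir_deriv f ('i *: basis_vec i) p) / 2.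
Definition wirtb (i : 'I_n) (f : V -> C) (p : V) : C :=
  (dir_deriv f (basis_vec i) p + 'i * dir_deriv f ('i *: basis_vec i) p) / 2.

(* A function on T^{1,0}D is a function of (z, v). *)
Definition d_z i (f : V -> V -> C) (z v : V) : C := wirt i (fun w => f w v) z.
Definition d_zb i (f : V -> V -> C) (z v : V) : C := wirtb i (fun w => f w v) z.
Definition d_v i (f : V -> V -> C) (z v : V) : C := wirt i (f z) v.
Definition d_vb i (f : V -> V -> C) (z v : V) : C := wirtb i (f z) v.

Definition sq_metric (F : V -> V -> R) (z v : V) : C := ((F z v ^+ 2)%:C)%C.

Definition complex_finsler (D : set V) (F : V -> V -> R) : Prop :=
  [/\ {within D `*` setT, continuous (fun p : V * V => F p.1 p.2)},
      (forall z v, D z -> 0 <= F z v),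
      (forall z v, D z -> (F z v ^+ 2 = 0 <-> v = 0)) &
      (forall z v (l : C), D z ->
         F z (l *: v) ^+ 2 = Normc.normc l ^+ 2 * F z v ^+ 2)].

(* Invariance of D itself is what makes F(Az, Av) meaningful. *)
Definition unitary_invariant (D : set V) (F : V -> V -> R) : Prop :=
  forall (A : 'M[C]_n) (z v : V), A \is unitarymx -> D z ->
    D (A *m z) /\ F (A *m z) (A *m v) = F z v.

Definition hform (a : 'M[C]_n) (v : V) : C :=
  \sum_(i < n) \sum_(j < n) a i j * v i 0 * (v j 0)^*.

Definition hermitian_matrix (a : 'M[C]_n) : Prop :=
  forall i j, a j i = (a i j)^*.

(* Positivity and smoothness are not asked for: positivity follows from that
   of F, and the notion is pointwise in z. *)
Definition is_hermitian (D : set V) (F : V -> V -> R) : Prop :=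
  exists a : V -> 'M[C]_n, forall z, D z ->
    hermitian_matrix (a z) /\ forall v, sq_metric F z v = hform (a z) v.

Definition hermitian_tensor (D : set V) (a : V -> 'M[C]_n) : Prop :=
  (forall i j, smooth_on D (fun z => a z i j)) /\
  (forall z, D z -> hermitian_matrix (a z) /\
     forall v, v != 0 -> 0 < complex.Re (hform (a z) v)).

Definition one_form (D : set V) (b : V -> 'rV[C]_n) : Prop :=
  forall i, smooth_on D (fun z => b z 0 i).

Definition pairing (b : V -> 'rV[C]_n) (z v : V) : C :=
  \sum_(i < n) b z 0 i * v i 0.

Definition randers (D : set V) (a : V -> 'M[C]_n) (b : V -> 'rV[C]_n)
    (F : V -> V -> R) : Prop :=
  [/\ complex_finsler D F, hermitian_tensor D a, one_form D b &
      forall z v, D z ->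
        F z v = Num.sqrt (complex.Re (hform (a z) v))
                + Normc.normc (pairing b z v)].

(* F = alpha + |beta| is not smooth along beta(v) = 0, so its differential
   invariants are evaluated off that set (v = 0 is excluded as well). *)
Definition randers_slit (D : set V) (b : V -> 'rV[C]_n) (z v : V) : Prop :=
  D z /\ pairing b z v != 0.

Section Invariants.
Variable F : V -> V -> R.
Let G : V -> V -> C := sq_metric F.

Definition G_v a : V -> V -> C := d_v a G.
Definition G_vvb a b : V -> V -> C := d_vb b (d_v a G).
Definition G_vb_z c b : V -> V -> C := d_z b (d_vb c G).

(* [G_inv a c] is G^{a cbar}. Barred indices contract with barred ones,
   sum_c G_{b cbar} G^{a cbar} = delta_b^a, whence the transpose. *)
Definition G_inv (a c : 'I_n) (z v : V) : C :=
  invmx (\matrix_(i < n, j < n) G_vvb i j z v) c a.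

Definition Nconn (a b : 'I_n) (z v : V) : C :=
  \sum_(c < n) G_inv a c z v * G_vb_z c b z v.

Definition delta (a : 'I_n) (f : V -> V -> C) (z v : V) : C :=
  d_z a f z v - \sum_(b < n) Nconn b a z v * d_v b f z v.

Definition deltab (c : 'I_n) (f : V -> V -> C) (z v : V) : C :=
  d_zb c f z v - \sum_(m < n) (Nconn m c z v)^* * d_vb m f z v.

Definition Gamma (a b c : 'I_n) (z v : V) : C :=
  \sum_(e < n) G_inv a e z v * delta c (G_vvb b e) z v.

Definition weakly_kahler_on (U : V -> V -> Prop) : Prop :=
  forall z v, U z v -> forall b : 'I_n,
    \sum_(a < n) \sum_(c < n) G_v a z v * Gamma a b c z v * v c 0 =
    \sum_(a < n) \sum_(c < n) G_v a z v * Gamma a c b z v * v c 0.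

Definition hol_curvature (z v : V) : C :=
  - (2 / G z v ^+ 2) *
    \sum_(a < n) \sum_(b < n) \sum_(c < n)
      G_v a z v * deltab c (Nconn a b) z v * v b 0 * (v c 0)^*.

Definition constant_hol_curvature_on (U : V -> V -> Prop) (k : R) : Prop :=
  forall z v, U z v -> hol_curvature z v = (k%:C)%C.

End Invariants.

(* [s = |<z, v>|^2 / |v|^2], meaningful for [v != 0]. *)
Definition s_var (z v : V) : R := Normc.normc (herm z v) ^+ 2 / sqnorm v.

(* [phi] is only constrained at the pairs (t, s) realised on D. *)
Definition phi_is (D : set V) (phi psi : R -> R -> R) : Prop :=
  forall z v, D z -> v != 0 ->
    phi (sqnorm z) (s_var z v) = psi (sqnorm z) (s_var z v).

End ComplexSpace.

(* Main.v *)
Require Import Defs.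
From HB Require Import structures.
From mathcomp Require Import all_boot all_order all_algebra.
From mathcomp Require Import all_classical all_reals all_analysis.
From mathcomp Require Import complex ring lra.
Import Order.TTheory GRing.Theory Num.Theory.
Import numFieldNormedType.Exports.
Local Open Scope classical_set_scope.
Local Open Scope ring_scope.

(** The function [G = F^2 = r phi(t, s)] depends on [(z, v)] through [r], [t], [s] only. Hence
    its Levi matrix is the scalar [gam = phi - s phi_s] plus rank-one terms along [z] and along
    the differential of [s], and the contraction of the connection with [v], the spray, has the
    form [w' A v + w'^2 B z], where [w'] is the conjugate of [<z, v>] and the functions [A], [B]
    of [(t, s)] solve a 2-by-2 linear system ([sprayE]). Both conditions of the theorem depend on
    the connection through the spray alone: the weakly Kahler condition becomes one scalar
    equation for [phi] ([weakly_kahler_at]), and the curvature an explicit expression in [phi],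
    [A], [B] and their derivatives ([hol_curvatureE]).

    Necessity. By unitary invariance [F] is determined on a ray [z = x e_1]. There
    [sqrt(alpha^2) + |beta|] is unchanged when the first coordinate of [v] is multiplied by a
    phase. This makes [alpha^2] diagonal in the plane of the first two axes and kills one of the
    two coefficients of [beta] ([ray_orthogonal]), so that [phi] is the square of
    [sqrt(f + g s) + sqrt(H s)] (type I) or of [sqrt(f + g s) + sqrt(H (t - s))] (type II), with
    functions [f], [g], [H] of [t]. Let [w] be [sqrt s] or [sqrt(t - s)] respectively. The
    scalar equation then reads [sqrt(f + g s) P(w^2) + w Q(w^2) = 0] with polynomials [P], [Q],
    and its expansion at [w = 0] is decisive: type II is impossible ([typeII_absurd]), and type I
    forces [f' = g + H] and [f + t g = t H] wherever [H] is nonzero ([typeI_ode], [ray_ode]). The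
    limit of the curvature as [s] tends to [0] adds [g = - k f^2 / 4] ([ray_g_eq]). These
    equations make [t^2 H / f^2 = t / f - k t^2 / 4] locally constant. The radii of [D] form an
    interval, and [H] is not identically zero because [F] is not Hermitian; so this quantity is a
    positive constant [C0] on all of [D], and [f], [g], [H] are known ([model_necessary]). The
    origin cannot belong to [D], since [f] would tend to [0] there whereas [alpha] is definite.
    The sign of [k] separates the three cases, with [C0 = c^2 / l] when [k] is nonzero and
    [C0 = 1 / (l c)] when [k = 0] ([psi_model_pos] and the two lemmas after it).

    Sufficiency. The given function has a corner at [s = 0], whereas [alpha + |beta|] is smooth
    where [beta] is nonzero; so [beta(v)] nonzero implies [<z, v>] nonzero ([slit_herm]). On that
    set the formulas of type I hold, the three equations for [f], [g], [H] make the scalar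
    equation an identity, and the curvature reduces to [k] ([model_sufficient]).

    In dimension at most one every complex Finsler metric is Hermitian, by homogeneity, so that
    the argument above takes place in dimension at least two. *)

Set Implicit Arguments.
Unset Strict Implicit.
Unset Printing Implicit Defensive.

(** * Derivatives along a real parameter *)

Notation rc x := (x%:C)%C.
Notation Re := complex.Re.
Notation Im := complex.Im.

Section ComplexBasics.
Variable R : realType.
Local Notation C := R[i].

Lemma ReD (x y : C) : Re (x + y) = Re x + Re y. Proof. by case: x y => [? ?] []. Qed.
Lemma ImD (x y : C) : Im (x + y) = Im x + Im y. Proof. by case: x y => [? ?] []. Qed.
Lemma ReN (x : C) : Re (- x) = - Re x. Proof. by case: x. Qed.
Lemma ImN (x : C) : Im (- x) = - Im x. Proof. by case: x. Qed.
Lemma ReM (x y : C) : Re (x * y) = Re x * Re y - Im x * Im y.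
Proof. by case: x y => [? ?] []. Qed.
Lemma ImM (x y : C) : Im (x * y) = Re x * Im y + Im x * Re y.
Proof. by case: x y => [? ?] []. Qed.
Lemma Re_conj (x : C) : Re x^* = Re x. Proof. by case: x. Qed.
Lemma Im_conj (x : C) : Im x^* = - Im x. Proof. by case: x. Qed.
Lemma ReV (x : C) : Re x^-1 = Re x / (Re x ^+ 2 + Im x ^+ 2).
Proof. by case: x. Qed.
Lemma ImV (x : C) : Im x^-1 = - (Im x / (Re x ^+ 2 + Im x ^+ 2)).
Proof. by case: x. Qed.
Lemma rcK (x : R) : Re (rc x) = x. Proof. by []. Qed.
Lemma Im_rc (x : R) : Im (rc x) = 0. Proof. by []. Qed.
Lemma conj_rc (x : R) : (rc x)^* = rc x. Proof. exact: conjc_real. Qed.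
Lemma imagE : ('i : C) = Complex 0 1. Proof. by rewrite -complexiE. Qed.
Lemma complex_eq (x y : C) : Re x = Re y -> Im x = Im y -> x = y.
Proof. by case: x y => [a b] [c d] /= -> ->. Qed.
Lemma normc2 (x : C) : rc (Normc.normc x ^+ 2) = x * x^*.
Proof.
apply: complex_eq; case: x => a b /=; last by ring.
by rewrite sqr_sqrtr ?addr_ge0 ?sqr_ge0 //; ring.
Qed.
Lemma normc2E (x : C) : Normc.normc x ^+ 2 = Re x ^+ 2 + Im x ^+ 2.
Proof. by case: x => a b /=; rewrite sqr_sqrtr ?addr_ge0 ?sqr_ge0. Qed.
Lemma normc_ge0 (x : C) : 0 <= Normc.normc x.
Proof. by case: x => a b /=; exact: sqrtr_ge0. Qed.
Lemma normc_rc (x : R) : Normc.normc (rc x) = `|x|.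
Proof. by rewrite /= expr0n addr0 sqrtr_sqr. Qed.
Lemma normc_eq0 (x : C) : (Normc.normc x == 0) = (x == 0).
Proof. by apply/eqP/eqP => [/Normc.eq0_normc|->]; rewrite ?Normc.normc0. Qed.
Lemma normc_gt0 (x : C) : (0 < Normc.normc x) = (x != 0).
Proof. by rewrite lt_def normc_ge0 andbT normc_eq0. Qed.
Lemma imag2 : 'i * 'i = -1 :> C. Proof. by rewrite -expr2 sqrCi. Qed.
End ComplexBasics.

Section PointwiseRules.
Variable R : realType.
(** A plain proposition in place of the class [is_derive], so that the rules below are applied
    as lemmas and never found by instance resolution. *)
Definition rd (f : R -> R) (x a : R) : Prop := is_derive x (1 : R) f a.
Implicit Types (f g : R -> R) (x : R).

Lemma rd_eq f x a b : rd f x a -> a = b -> rd f x b.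
Proof. by move=> ? <-. Qed.
Lemma rdD f g x a b : rd f x a -> rd g x b ->
  rd (fun y => f y + g y) x (a + b).
Proof. by move=> h k; exact: is_deriveD. Qed.
Lemma rdN f x a : rd f x a ->
  rd (fun y => - f y) x (- a).
Proof. by move=> h; exact: is_deriveN. Qed.
Lemma rdB f g x a b : rd f x a -> rd g x b ->
  rd (fun y => f y - g y) x (a - b).
Proof. by move=> h k; exact: is_deriveB. Qed.
Lemma rdM f g x a b : rd f x a -> rd g x b ->
  rd (fun y => f y * g y) x (a * g x + f x * b).
Proof.
move=> h k; apply: (rd_eq (is_deriveM h k)).
by rewrite /GRing.scale /=; ring.
Qed.
Lemma rdX2 f x a : rd f x a ->
  rd (fun y => f y ^+ 2) x (2 * f x * a).
Proof.
move=> h; rewrite (_ : (fun _ => _) = (fun y => f y * f y)).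
  by apply: rd_eq (rdM h h) _; ring.
by apply/funext => y; rewrite expr2.
Qed.
Lemma rdV f x a : f x != 0 -> rd f x a ->
  rd (fun y => (f y)^-1) x (- a / f x ^+ 2).
Proof.
move=> nz h; apply: (rd_eq (is_deriveV nz h)).
by rewrite /GRing.scale /=; field.
Qed.
Lemma rd_div f g x a b : g x != 0 -> rd f x a ->
  rd g x b ->
  rd (fun y => f y / g y) x ((a * g x - f x * b) / g x ^+ 2).
Proof.
by move=> nz h k; apply: (rd_eq (rdM h (rdV nz k))); field.
Qed.
Lemma rd_sqrt f x a : 0 < f x -> rd f x a ->
  rd (fun y => Num.sqrt (f y)) x (a / (2 * Num.sqrt (f x))).
Proof.
move=> p h; apply: (rd_eq (is_derive1_comp (is_derive1_sqrt p) h)).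
by rewrite mulrC.
Qed.
Lemma rd_cst c x : rd (fun=> c) x 0.
Proof. exact: is_derive_cst. Qed.
Lemma rd_id x : rd (fun y => y) x 1.
Proof. exact: is_derive_id. Qed.
Lemma rd_comp f g x a b : rd f (g x) a -> rd g x b ->
  rd (fun y => f (g y)) x (a * b).
Proof. by move=> h k; exact: is_derive1_comp. Qed.
Lemma rd_near f g x a : (\forall y \near x, f y = g y) ->
  rd f x a -> rd g x a.
Proof. by move=> h k; exact: near_eq_is_derive h k. Qed.
Lemma rd_uniq f x a b : rd f x a -> rd f x b -> a = b.
Proof. by move=> [_ <-] [_ <-]. Qed.
Lemma rd_cvg f x a : rd f x a -> f y @[y --> x] --> f x.
Proof.
by move=> [h _]; apply/differentiable_continuous/derivable1_diffP.
Qed.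
End PointwiseRules.

Section LineDerivatives.
Variable R : realType.
Local Notation C := R[i].

Definition cd (c : R -> C) (l : C) : Prop :=
  rd (fun h => Re (c h)) 0 (Re l) /\
  rd (fun h => Im (c h)) 0 (Im l).

Lemma cd_cst (a : C) : cd (fun _ => a) 0.
Proof. by split; exact: rd_cst. Qed.

Lemma cd_eq c l l' : cd c l -> l = l' -> cd c l'.
Proof. by move=> ? <-. Qed.

Lemma cd_near c c' l : (\forall h \near (0 : R), c h = c' h) -> cd c l -> cd c' l.
Proof.
move=> E [h1 h2]; split.
  by apply: rd_near h1; near=> h; congr Re; near: h.
by apply: rd_near h2; near=> h; congr Im; near: h.
Unshelve. all: by end_near. Qed.

Lemma cdD c d l m : cd c l -> cd d m -> cd (fun h => c h + d h) (l + m).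
Proof.
move=> [h1 h2] [k1 k2]; split.
  by rewrite ReD; under eq_fun do rewrite ReD; exact: rdD.
by rewrite ImD; under eq_fun do rewrite ImD; exact: rdD.
Qed.

Lemma cd_conj c l : cd c l -> cd (fun h => (c h)^*) l^*.
Proof.
move=> [h1 h2]; split.
  by rewrite Re_conj; under eq_fun do rewrite Re_conj.
rewrite Im_conj; under eq_fun do rewrite Im_conj.
exact: rdN.
Qed.

Lemma cdM c d l m : cd c l -> cd d m -> cd (fun h => c h * d h) (l * d 0 + c 0 * m).
Proof.
move=> [h1 h2] [k1 k2]; split.
  under eq_fun do rewrite ReM.
  apply: (rd_eq (rdB (rdM h1 k1) (rdM h2 k2))).
  by rewrite /= !ReD !ReM; ring.
under eq_fun do rewrite ImM.
apply: (rd_eq (rdD (rdM h1 k2) (rdM h2 k1))).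
by rewrite /= !ImD !ImM; ring.
Qed.

Lemma cd_rc (c : R -> R) l : rd c 0 l -> cd (fun h => rc (c h)) (rc l).
Proof. by move=> h; split=> //=; exact: rd_cst. Qed.

Lemma cd_line (a b : C) : cd (fun h => a + rc h * b) b.
Proof.
apply: (cd_eq (cdD (cd_cst a) (cdM (cd_rc (rd_id 0)) (cd_cst b)))).
by rewrite /= mulr0 addr0 add0r mul1r.
Qed.

Lemma cdN c l : cd c l -> cd (fun h => - c h) (- l).
Proof.
by move=> [h1 h2]; split; [rewrite ReN | rewrite ImN];
  [under eq_fun do rewrite ReN | under eq_fun do rewrite ImN]; exact: rdN.
Qed.

(** The inverse is the conjugate over the squared modulus, which reduces the claim to real
    quotients. *)
Lemma cdV c l : cd c l -> c 0 != 0 -> cd (fun h => (c h)^-1) (- l / c 0 ^+ 2).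
Proof.
move=> hc c0.
have nz : Re (c 0) ^+ 2 + Im (c 0) ^+ 2 != 0.
  by rewrite -normc2E expf_eq0 /= normc_eq0.
have [h1 h2] := hc.
have dn : rd (fun h => (Re (c h) ^+ 2 + Im (c h) ^+ 2)^-1) 0
   (- (2 * Re (c 0) * Re l + 2 * Im (c 0) * Im l) / (Re (c 0) ^+ 2 + Im (c 0) ^+ 2) ^+ 2).
  by apply: (@rdV _ (fun h => Re (c h) ^+ 2 + Im (c h) ^+ 2)) => //; apply: rdD; exact: rdX2.
have : cd (fun h => (c h)^* * rc ((Re (c h) ^+ 2 + Im (c h) ^+ 2)^-1))
  (l^* * rc ((Re (c 0) ^+ 2 + Im (c 0) ^+ 2)^-1) + (c 0)^* * rc
   (- (2 * Re (c 0) * Re l + 2 * Im (c 0) * Im l) / (Re (c 0) ^+ 2 + Im (c 0) ^+ 2) ^+ 2)).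
  by apply: cdM; [exact: cd_conj | exact: cd_rc].
have inv x : (x : C)^-1 = x^* * rc ((Re x ^+ 2 + Im x ^+ 2)^-1).
  by apply: complex_eq; rewrite ?ReM ?ImM ?ReV ?ImV Re_conj Im_conj /=; ring.
move=> H; apply: (@cd_near (fun h => (c h)^* * rc ((Re (c h) ^+ 2 + Im (c h) ^+ 2)^-1))).
  by near=> h; rewrite inv.
apply: cd_eq H _.
have -> : rc (- (2 * Re (c 0) * Re l + 2 * Im (c 0) * Im l) /
    (Re (c 0) ^+ 2 + Im (c 0) ^+ 2) ^+ 2) =
    - (l^* * c 0 + l * (c 0)^*) / (c 0 * (c 0)^*) ^+ 2.
  rewrite -normc2E rmorphM fmorphV rmorphXn /= normc2; congr (_ / _).
  by apply: complex_eq; rewrite ?(ReN, ImN, ReD, ImD, ReM, ImM, Re_conj, Im_conj, rcK, Im_rc); ring.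
have -> : rc ((Re (c 0) ^+ 2 + Im (c 0) ^+ 2)^-1) = (c 0 * (c 0)^*)^-1.
  by rewrite -normc2E fmorphV /= normc2.
have c0' : (c 0)^* != 0 by rewrite fmorph_eq0.
by field; rewrite c0 c0'.
Unshelve. all: by end_near. Qed.

Lemma cd_sum (I : Type) (r : seq I) (P : pred I) (c : I -> R -> C) (l : I -> C) :
  (forall i, cd (c i) (l i)) ->
  cd (fun h => \sum_(i <- r | P i) c i h) (\sum_(i <- r | P i) l i).
Proof.
move=> H; elim: r => [|i r IH].
  by rewrite big_nil; under eq_fun do rewrite big_nil; exact: cd_cst.
rewrite big_cons; under eq_fun do rewrite big_cons.
by case: (P i) => //; exact: cdD.
Qed.

End LineDerivatives.

(** * Wirtinger differentials *)

Section Wirtinger.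
Variables (R : realType) (n : nat).
Local Notation C := R[i].
Local Notation V := 'cV[C]_n.
Implicit Types (f g : V -> C) (p e : V) (L M : 'I_n -> C).

(** [L] and [M] are the coefficients of [dz_i] and of its conjugate. The differential is
    required direction by direction only, which is the differentiability that the operators
    [wirt] and [wirtb] see; all rules below survive in this weak form. *)
Definition Wd f p L M : Prop :=
  forall e, cd (fun h => f (p + rc h *: e)) (\sum_i (L i * e i 0 + M i * (e i 0)^*)).

Lemma line0 p e : p + rc 0 *: e = p.
Proof. by rewrite scale0r addr0. Qed.

Lemma dir_deriv_Wd f p L M e : Wd f p L M ->
  dir_deriv f e p = \sum_i (L i * e i 0 + M i * (e i 0)^*).
Proof.
move=> /(_ e) [h1 h2]; rewrite /dir_deriv !derive1E.
by rewrite (@derive_val _ _ _ _ _ _ _ h1) (@derive_val _ _ _ _ _ _ _ h2); case: (\sum_i _).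
Qed.

Lemma sum_basis (L : 'I_n -> C) (i : 'I_n) (a : C) :
  \sum_j L j * (a *: basis_vec R i) j 0 = L i * a.
Proof.
rewrite (bigD1 i) //= big1 ?addr0 => [|j ji].
  by rewrite !mxE !eqxx mulr1.
by rewrite !mxE (negbTE ji) /= !mulr0.
Qed.

Lemma sum_basis_conj (L : 'I_n -> C) (i : 'I_n) (a : C) :
  \sum_j L j * ((a *: basis_vec R i) j 0)^* = L i * a^*.
Proof.
rewrite (bigD1 i) //= big1 ?addr0 => [|j ji].
  by rewrite !mxE !eqxx mulr1.
by rewrite !mxE (negbTE ji) /= !mulr0 rmorph0 mulr0.
Qed.

Lemma wirt_Wd f p L M i : Wd f p L M -> wirt i f p = L i.
Proof.
move=> h; rewrite /wirt !(dir_deriv_Wd _ h) -[basis_vec R i]scale1r scalerA mulr1.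
rewrite !big_split /= !sum_basis !sum_basis_conj conjCi rmorph1.
rewrite mulr1 mulrDr mulrCA imag2 mulrN.
rewrite mulrCA mulrN imag2.
by field.
Qed.

Lemma wirtb_Wd f p L M i : Wd f p L M -> wirtb i f p = M i.
Proof.
move=> h; rewrite /wirtb !(dir_deriv_Wd _ h) -[basis_vec R i]scale1r scalerA mulr1.
rewrite !big_split /= !sum_basis !sum_basis_conj conjCi rmorph1.
rewrite mulr1 mulrDr mulrCA imag2 mulrN.
rewrite mulrCA mulrN imag2.
by field.
Qed.

Lemma Wd_eq f p L M L' M' : Wd f p L M -> L =1 L' -> M =1 M' -> Wd f p L' M'.
Proof.
by move=> h E1 E2 e; apply: cd_eq (h e) _; apply: eq_bigr => i _; rewrite E1 E2.
Qed.

(** The notion of neighbourhood that matches differentials taken line by line: an identity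
    that holds along lines may be differentiated at the point. *)
Definition along (P : V -> Prop) p : Prop :=
  forall e, \forall h \near (0 : R), P (p + rc h *: e).

Lemma Wd_near f g p L M : along (fun q => f q = g q) p -> Wd f p L M -> Wd g p L M.
Proof. by move=> E h e; exact: cd_near (E e) (h e). Qed.

Lemma Wd_cst (a : C) p : Wd (fun=> a) p (fun=> 0) (fun=> 0).
Proof.
by move=> e; apply: cd_eq (cd_cst a) _; rewrite big1 // => i _; rewrite !mul0r addr0.
Qed.

Lemma Wd_coord j p : Wd (fun q => q j 0) p (fun i => (i == j)%:R) (fun=> 0).
Proof.
move=> e; have := cd_line (p j 0) (e j 0).
rewrite (_ : (fun h : R => _) = (fun h : R => (p + rc h *: e) j 0)); last first.
  by apply/funext => h; rewrite !mxE.
move=> h; apply: cd_eq h _.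
rewrite (bigD1 j) //= big1 ?addr0 => [|i ij]; first by rewrite eqxx mul1r mul0r addr0.
by rewrite (negbTE ij) !mul0r addr0.
Qed.

Lemma WdD f g p L M L' M' : Wd f p L M -> Wd g p L' M' ->
  Wd (fun q => f q + g q) p (fun i => L i + L' i) (fun i => M i + M' i).
Proof.
move=> h k e; apply: cd_eq (cdD (h e) (k e)) _.
by rewrite -big_split; apply: eq_bigr => i _ /=; ring.
Qed.

Lemma WdN f p L M : Wd f p L M -> Wd (fun q => - f q) p (fun i => - L i) (fun i => - M i).
Proof.
move=> h e; apply: cd_eq (cdN (h e)) _.
by rewrite -sumrN; apply: eq_bigr => i _ /=; ring.
Qed.

Lemma WdM f g p L M L' M' : Wd f p L M -> Wd g p L' M' ->
  Wd (fun q => f q * g q) p (fun i => L i * g p + f p * L' i)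
     (fun i => M i * g p + f p * M' i).
Proof.
move=> h k e; apply: cd_eq (cdM (h e) (k e)) _; rewrite line0.
rewrite mulr_suml mulr_sumr -big_split; apply: eq_bigr => i _ /=; ring.
Qed.

Lemma Wd_conj f p L M : Wd f p L M ->
  Wd (fun q => (f q)^*) p (fun i => (M i)^*) (fun i => (L i)^*).
Proof.
move=> h e; apply: cd_eq (cd_conj (h e)) _.
rewrite rmorph_sum; apply: eq_bigr => i _ /=.
by rewrite rmorphD !rmorphM /= conjCK addrC.
Qed.

Lemma WdV f p L M : Wd f p L M -> f p != 0 ->
  Wd (fun q => (f q)^-1) p (fun i => - L i / f p ^+ 2) (fun i => - M i / f p ^+ 2).
Proof.
move=> h nz e; have := cdV (h e); rewrite line0 => /(_ nz) k; apply: cd_eq k _.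
by rewrite mulNr -mulrN mulr_suml; apply: eq_bigr => i _; ring.
Qed.

Lemma Wd_sum (I : Type) (r : seq I) (P : pred I) (f : I -> V -> C) p (L M : I -> 'I_n -> C) :
  (forall i, Wd (f i) p (L i) (M i)) ->
  Wd (fun q => \sum_(i <- r | P i) f i q) p (fun j => \sum_(i <- r | P i) L i j)
     (fun j => \sum_(i <- r | P i) M i j).
Proof.
move=> h e; apply: cd_eq; first by apply: cd_sum => i; exact: h.
rewrite exchange_big; apply: eq_bigr => j _ /=.
by rewrite big_split /= !mulr_suml.
Qed.

Definition WD f p : Prop := exists L M, Wd f p L M.

Lemma WD_cst a p : WD (fun=> a) p. Proof. by do 2!eexists; exact: Wd_cst. Qed.
Lemma WDD f g p : WD f p -> WD g p -> WD (fun q => f q + g q) p.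
Proof. by move=> [? [? h]] [? [? k]]; do 2!eexists; exact: WdD h k. Qed.
Lemma WDM f g p : WD f p -> WD g p -> WD (fun q => f q * g q) p.
Proof. by move=> [? [? h]] [? [? k]]; do 2!eexists; exact: WdM h k. Qed.
Lemma WDV f p : WD f p -> f p != 0 -> WD (fun q => (f q)^-1) p.
Proof. by move=> [? [? h]] k; do 2!eexists; exact: WdV h k. Qed.
Lemma WD_conj f p : WD f p -> WD (fun q => (f q)^*) p.
Proof. by move=> [? [? h]]; do 2!eexists; exact: Wd_conj h. Qed.
Lemma WD_near f g p : along (fun q => f q = g q) p -> WD f p -> WD g p.
Proof. by move=> E [L [M h]]; exists L, M; exact: Wd_near E h. Qed.
Lemma WD_sum (I : Type) (r : seq I) (P : pred I) (f : I -> V -> C) p :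
  (forall i, WD (f i) p) -> WD (fun q => \sum_(i <- r | P i) f i q) p.
Proof.
move=> h; elim: r => [|i r IH].
  by under eq_fun do rewrite big_nil; exact: WD_cst.
by under eq_fun do rewrite big_cons; case: (P i) => //; exact: WDD.
Qed.
Lemma WD_prod (I : Type) (r : seq I) (P : pred I) (f : I -> V -> C) p :
  (forall i, WD (f i) p) -> WD (fun q => \prod_(i <- r | P i) f i q) p.
Proof.
move=> h; elim: r => [|i r IH].
  by under eq_fun do rewrite big_nil; exact: WD_cst.
by under eq_fun do rewrite big_cons; case: (P i) => //; exact: WDM.
Qed.

Lemma WD_det m (A : V -> 'M[C]_m) p :
  (forall i j, WD (fun q => A q i j) p) -> WD (fun q => \det (A q)) p.
Proof.
move=> h; rewrite /determinant; apply: WD_sum => s; apply: WDM; first exact: WD_cst.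
by apply: WD_prod => i; exact: h.
Qed.

(** Cramer's rule: the entries of the inverse are rational in those of the matrix. *)
Lemma WD_invmx m (A : V -> 'M[C]_m) p i j :
  (forall i j, WD (fun q => A q i j) p) ->
  along (fun q => A q \in unitmx) p -> A p \in unitmx ->
  WD (fun q => invmx (A q) i j) p.
Proof.
move=> h al u.
apply: (@WD_near (fun q => (\det (A q))^-1 * cofactor (A q) j i)).
  by move=> e; near=> x; rewrite /invmx ifT ?mxE //; near: x; exact: al.
apply: WDM; first by apply: WDV; [exact: WD_det | rewrite -unitfE -unitmxE].
rewrite /cofactor; apply: WDM; first exact: WD_cst.
by apply: WD_det => k l; under eq_fun do rewrite !mxE; exact: h.
Unshelve. all: by end_near. Qed.

(** [a] and [b] are the partial derivatives of [Phi] at [(t, s)]. The chain rule along curves is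
    taken as the definition: it is what composition with [(sqnorm, s_var)] uses, it is stable
    under arithmetic and square roots, and it spares differentials in two variables. *)
Definition had (Phi : R -> R -> R) (t s a b : R) : Prop :=
  forall (tau sig : R -> R) (dt ds : R), tau 0 = t -> sig 0 = s ->
  rd tau 0 dt -> rd sig 0 ds ->
  rd (fun h => Phi (tau h) (sig h)) 0 (a * dt + b * ds).

Lemma Wr_had (tau sig : V -> R) p L M Phi a b :
  Wd (fun q => rc (tau q)) p L (fun i => (L i)^*) ->
  Wd (fun q => rc (sig q)) p M (fun i => (M i)^*) ->
  had Phi (tau p) (sig p) a b ->
  Wd (fun q => rc (Phi (tau q) (sig q))) p (fun i => rc a * L i + rc b * M i)
    (fun i => (rc a * L i + rc b * M i)^*).
Proof.
move=> h k H e.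
have real (N : 'I_n -> C) : \sum_i (N i * e i 0 + (N i)^* * (e i 0)^*) =
    rc (Re (\sum_i (N i * e i 0 + (N i)^* * (e i 0)^*))).
  apply: complex_eq => //=.
  rewrite (_ : \sum_i _ = (\sum_i N i * e i 0) + (\sum_i N i * e i 0)^*).
    by rewrite ImD Im_conj subrr.
  by rewrite big_split rmorph_sum /=; congr (_ + _); apply: eq_bigr => i _; rewrite rmorphM.
have {h} [h _] := h e; have {k} [k _] := k e.
have := H _ _ _ _ _ _ h k; rewrite /= !line0 => /(_ erefl erefl) /cd_rc HH.
apply: cd_eq HH _; rewrite rmorphD !rmorphM /= -!real !mulr_sumr -big_split /=.
by apply: eq_bigr => i _; rewrite rmorphD !rmorphM /= !conj_rc; ring.
Qed.

End Wirtinger.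

Section TwoVariables.
Variable R : realType.
Implicit Types (Phi Psi : R -> R -> R) (t s a b c d : R).

Lemma had_eq Phi t s a b c d : had Phi t s a b -> a = c -> b = d -> had Phi t s c d.
Proof. by move=> ? <- <-. Qed.
Lemma had_ext Phi Psi t s a b : (forall x y, Phi x y = Psi x y) ->
  had Phi t s a b -> had Psi t s a b.
Proof.
move=> E h tau sig dt ds t0 s0 ht hs.
by rewrite (_ : (fun _ => _) = (fun h => Phi (tau h) (sig h))); [exact: h | apply/funext].
Qed.
Lemma had_fst (f : R -> R) t s a : rd f t a -> had (fun t _ => f t) t s a 0.
Proof.
by move=> h tau sig dt ds t0 s0 ht hs; rewrite mul0r addr0; apply: rd_comp => //; rewrite t0.
Qed.
Lemma had_snd t s : had (fun _ s => s) t s 0 1.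
Proof. by move=> tau sig dt ds t0 s0 ht hs; rewrite mul0r add0r mul1r. Qed.
Lemma hadD Phi Psi t s a b c d : had Phi t s a b -> had Psi t s c d ->
  had (fun t s => Phi t s + Psi t s) t s (a + c) (b + d).
Proof.
move=> h k tau sig dt ds t0 s0 ht hs.
by apply: rd_eq (rdD (h _ _ _ _ t0 s0 ht hs) (k _ _ _ _ t0 s0 ht hs)) _; ring.
Qed.
Lemma hadB Phi Psi t s a b c d : had Phi t s a b -> had Psi t s c d ->
  had (fun t s => Phi t s - Psi t s) t s (a - c) (b - d).
Proof.
move=> h k tau sig dt ds t0 s0 ht hs.
by apply: rd_eq (rdB (h _ _ _ _ t0 s0 ht hs) (k _ _ _ _ t0 s0 ht hs)) _; ring.
Qed.
Lemma hadM Phi Psi t s a b c d : had Phi t s a b -> had Psi t s c d ->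
  had (fun t s => Phi t s * Psi t s) t s (a * Psi t s + Phi t s * c)
    (b * Psi t s + Phi t s * d).
Proof.
move=> h k tau sig dt ds t0 s0 ht hs.
apply: rd_eq (rdM (h _ _ _ _ t0 s0 ht hs) (k _ _ _ _ t0 s0 ht hs)) _.
by rewrite t0 s0; ring.
Qed.
Lemma had_div Phi Psi t s a b c d : Psi t s != 0 ->
  had Phi t s a b -> had Psi t s c d ->
  had (fun t s => Phi t s / Psi t s) t s ((a * Psi t s - Phi t s * c) / Psi t s ^+ 2)
    ((b * Psi t s - Phi t s * d) / Psi t s ^+ 2).
Proof.
move=> nz h k tau sig dt ds t0 s0 ht hs.
apply: rd_eq (rd_div _ (h _ _ _ _ t0 s0 ht hs) (k _ _ _ _ t0 s0 ht hs)) _.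
  by rewrite t0 s0.
by rewrite t0 s0; field.
Qed.
Lemma had_sqrt Phi t s a b : 0 < Phi t s -> had Phi t s a b ->
  had (fun t s => Num.sqrt (Phi t s)) t s (a / (2 * Num.sqrt (Phi t s)))
    (b / (2 * Num.sqrt (Phi t s))).
Proof.
move=> nz h tau sig dt ds t0 s0 ht hs.
apply: rd_eq (rd_sqrt _ (h _ _ _ _ t0 s0 ht hs)) _; first by rewrite t0 s0.
by rewrite t0 s0; field; rewrite gt_eqF // sqrtr_gt0.
Qed.
End TwoVariables.

(** * The invariants t and s *)

Section Invariants.
Variables (R : realType) (n : nat).
Local Notation C := R[i].
Local Notation V := 'cV[C]_n.
Implicit Types (z v : V).

Lemma sum_zzb z : \sum_i z i 0 * (z i 0)^* = rc (sqnorm z).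
Proof. by rewrite /sqnorm rmorph_sum; apply: eq_bigr => i _; rewrite /= normc2. Qed.

Lemma sum_vzb z v : \sum_i v i 0 * (z i 0)^* = (herm z v)^*.
Proof.
by rewrite /herm rmorph_sum; apply: eq_bigr => i _; rewrite rmorphM /= conjCK mulrC.
Qed.

Lemma sqnorm_ge0 z : 0 <= sqnorm z.
Proof. by apply: sumr_ge0 => i _; exact: sqr_ge0. Qed.

Lemma sqnorm_eq0 z : (sqnorm z == 0) = (z == 0).
Proof.
apply/eqP/eqP => [h|->]; last first.
  by rewrite /sqnorm big1 // => i _; rewrite mxE Normc.normc0 expr0n.
apply/matrixP => i j; rewrite ord1 mxE.
have := psumr_eq0P (F := fun i => Normc.normc (z i 0) ^+ 2) (P := xpredT) (fun i _ => sqr_ge0 _) h.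
by move=> /(_ i isT) /eqP; rewrite expf_eq0 /= normc_eq0 => /eqP.
Qed.

Lemma sqnorm_gt0 z : (0 < sqnorm z) = (z != 0).
Proof. by rewrite lt_def sqnorm_ge0 andbT sqnorm_eq0. Qed.

(** The relation [w * conj w = s r] between the invariants; the contractions below
    are computed modulo it. *)
Lemma herm2 z v : v != 0 -> herm z v * (herm z v)^* = rc (s_var z v) * rc (sqnorm v).
Proof.
move=> v0; rewrite -normc2 -rmorphM /=; congr (rc _).
by rewrite /s_var divfK // sqnorm_eq0.
Qed.

Lemma Wd_sqnorm z : Wd (fun z => rc (sqnorm z)) z (fun i => (z i 0)^*) (fun i => ((z i 0)^*)^*).
Proof.
have h i : Wd (fun z : V => z i 0 * (z i 0)^*) z _ _ :=
  WdM (Wd_coord i z) (Wd_conj (Wd_coord i z)).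
apply: (@Wd_near _ _ (fun z => \sum_i z i 0 * (z i 0)^*)).
  by move=> e; near=> x; rewrite sum_zzb.
apply: (Wd_eq (Wd_sum _ _ h)) => i /=.
  rewrite (bigD1 i) //= big1 ?addr0 => [|j ji].
    by rewrite eqxx ?(rmorph0, rmorph1, mul1r, mul0r, mulr0, mulr1, addr0, add0r, conjCK).
  by rewrite eq_sym (negbTE ji) ?(rmorph0, mul0r, mulr0, addr0).
rewrite (bigD1 i) //= big1 ?addr0 => [|j ji].
  by rewrite eqxx ?(rmorph0, rmorph1, mul1r, mul0r, mulr0, mulr1, addr0, add0r, conjCK).
by rewrite eq_sym (negbTE ji) ?(rmorph0, mul0r, mulr0, addr0).
Unshelve. all: by end_near. Qed.

Lemma Wd_herm_z z v : Wd (fun z => herm z v) z (fun i => (v i 0)^*) (fun=> 0).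
Proof.
have h i : Wd (fun z : V => z i 0 * (v i 0)^*) z _ _ :=
  WdM (Wd_coord i z) (Wd_cst _ _).
apply: (Wd_eq (Wd_sum _ _ h)) => i /=.
  rewrite (bigD1 i) //= big1 ?addr0 => [|j ji].
    by rewrite eqxx ?(rmorph0, rmorph1, mul1r, mul0r, mulr0, mulr1, addr0, add0r, conjCK).
  by rewrite eq_sym (negbTE ji) ?(rmorph0, mul0r, mulr0, addr0).
by rewrite big1 // => j _; rewrite ?(rmorph0, mul0r, mulr0, addr0).
Qed.

Lemma Wd_herm_v z v : Wd (fun v => herm z v) v (fun=> 0) (fun i => z i 0).
Proof.
have h i : Wd (fun v : V => z i 0 * (v i 0)^*) v _ _ :=
  WdM (Wd_cst _ _) (Wd_conj (Wd_coord i v)).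
apply: (Wd_eq (Wd_sum _ _ h)) => i /=.
  by rewrite big1 // => j _; rewrite ?(rmorph0, mul0r, mulr0, addr0).
rewrite (bigD1 i) //= big1 ?addr0 => [|j ji].
  by rewrite eqxx ?(rmorph0, rmorph1, mul1r, mul0r, mulr0, mulr1, addr0, add0r, conjCK).
by rewrite eq_sym (negbTE ji) ?(rmorph0, mul0r, mulr0, addr0).
Qed.

Lemma Wd_s_z z v : v != 0 ->
  Wd (fun z => rc (s_var z v)) z (fun i => (herm z v)^* * (v i 0)^* / rc (sqnorm v))
     (fun i => ((herm z v)^* * (v i 0)^* / rc (sqnorm v))^*).
Proof.
move=> v0; have r0 : rc (sqnorm v) != 0 by rewrite fmorph_eq0 sqnorm_eq0.
apply: (@Wd_near _ _ (fun z => herm z v * (herm z v)^* * (rc (sqnorm v))^-1)).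
  by move=> e; near=> x; rewrite herm2 // mulfK.
have k := Wd_herm_z z v.
apply: (Wd_eq (WdM (WdM k (Wd_conj k)) (Wd_cst _ _))) => i /=.
  by rewrite rmorph0; ring.
by rewrite !rmorphM /= fmorphV /= !conjCK !conj_rc; ring.
Unshelve. all: by end_near. Qed.

(** The holomorphic differential of [s] in [v]; it kills [v], since [s] is homogeneous of
    degree zero in [v]. *)
Definition sigma z v (i : 'I_n) : C :=
  ((z i 0)^* * herm z v - rc (s_var z v) * (v i 0)^*) / rc (sqnorm v).

Lemma conj_sigma z v i : (sigma z v i)^* =
  (z i 0 * (herm z v)^* - rc (s_var z v) * v i 0) / rc (sqnorm v).
Proof.
rewrite /sigma; move: (s_var z v) (sqnorm v) => s r.
by rewrite fmorph_div rmorphB /= !rmorphM /= !conjCK !conj_rc.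
Qed.

Lemma along_neq0 z : z != 0 -> along (fun z => z != 0) z.
Proof.
move=> z0 e; have [/rd_cvg h _] := @Wd_sqnorm z e.
have := h; rewrite /= line0 => {}h.
have z0' : 0 < sqnorm z by rewrite sqnorm_gt0.
by near=> x; rewrite -sqnorm_gt0; near: x; exact: (cvgr_gt _ h).
Unshelve. all: by end_near. Qed.

Lemma Wd_s_v z v : v != 0 ->
  Wd (fun v => rc (s_var z v)) v (sigma z v) (fun i => (sigma z v i)^*).
Proof.
move=> v0; have r0 : rc (sqnorm v) != 0 by rewrite fmorph_eq0 sqnorm_eq0.
apply: (@Wd_near _ _ (fun v => herm z v * (herm z v)^* * (rc (sqnorm v))^-1)).
  move=> e; near=> x.
  have x0 : v + rc x *: e != 0 by near: x; exact: along_neq0.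
  by rewrite herm2 // mulfK // fmorph_eq0 sqnorm_eq0.
have k := Wd_herm_v z v.
apply: (Wd_eq (WdM (WdM k (Wd_conj k)) (WdV (Wd_sqnorm v) r0))) => i /=.
  by rewrite /sigma herm2 //; field.
by rewrite herm2 // conj_sigma rmorph0 conjCK; field.
Unshelve. all: by end_near. Qed.

Lemma sum_kron (i : 'I_n) (f : 'I_n -> C) : \sum_j (i == j)%:R * f j = f i.
Proof.
rewrite (bigD1 i) //= big1 ?addr0 ?eqxx ?mul1r // => j ji.
by rewrite eq_sym (negbTE ji) mul0r.
Qed.
Lemma sum_lin2 (f x y : 'I_n -> C) a b : (forall i, f i = a * x i + b * y i) ->
  \sum_i f i = a * (\sum_i x i) + b * (\sum_i y i).
Proof. by move=> h; rewrite !mulr_sumr -big_split; apply: eq_bigr => i _; rewrite h. Qed.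
Lemma sum_lin3 (f x y w : 'I_n -> C) a b c : (forall i, f i = a * x i + b * y i + c * w i) ->
  \sum_i f i = a * (\sum_i x i) + b * (\sum_i y i) + c * (\sum_i w i).
Proof.
by move=> h; rewrite !mulr_sumr -!big_split; apply: eq_bigr => i _; rewrite h.
Qed.

Lemma sigma_v z v : v != 0 -> \sum_i v i 0 * sigma z v i = 0.
Proof.
move=> v0; have r0 : rc (sqnorm v) != 0 by rewrite fmorph_eq0 sqnorm_eq0.
rewrite (@sum_lin2 _ (fun i => v i 0 * (z i 0)^*) (fun i => v i 0 * (v i 0)^*)
  (herm z v / rc (sqnorm v)) (- rc (s_var z v) / rc (sqnorm v))).
  by rewrite sum_vzb sum_zzb mulrAC herm2 //; field.
by move=> i; rewrite /sigma; ring.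
Qed.

Lemma sigma_z z v : v != 0 -> \sum_i z i 0 * sigma z v i =
  herm z v * rc (sqnorm z - s_var z v) / rc (sqnorm v).
Proof.
move=> v0; have r0 : rc (sqnorm v) != 0 by rewrite fmorph_eq0 sqnorm_eq0.
rewrite (@sum_lin2 _ (fun i => z i 0 * (z i 0)^*) (fun i => z i 0 * (v i 0)^*)
  (herm z v / rc (sqnorm v)) (- rc (s_var z v) / rc (sqnorm v))).
  by rewrite sum_zzb -/(herm z v); field.
by move=> i; rewrite /sigma; ring.
Qed.

Lemma sigma_sigma z v : v != 0 -> \sum_i (sigma z v i)^* * sigma z v i =
  rc (s_var z v * (sqnorm z - s_var z v)) / rc (sqnorm v).
Proof.
move=> v0; have r0 : rc (sqnorm v) != 0 by rewrite fmorph_eq0 sqnorm_eq0.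
rewrite (@sum_lin2 _ (fun i => z i 0 * sigma z v i) (fun i => v i 0 * sigma z v i)
  ((herm z v)^* / rc (sqnorm v)) (- rc (s_var z v) / rc (sqnorm v))).
  rewrite sigma_v // sigma_z // mulr0 addr0.
  transitivity (herm z v * (herm z v)^* * rc (sqnorm z - s_var z v) / rc (sqnorm v) ^+ 2).
    by field.
  by rewrite herm2 //; field.
by move=> i; rewrite conj_sigma; ring.
Qed.

End Invariants.

(** * Metrics with an invariant profile *)

Section InvariantFunctions.
Variables (R : realType) (n : nat).
Local Notation C := R[i].
Local Notation V := 'cV[C]_n.
Implicit Types (z v : V) (Phi : R -> R -> R).

(** Functions of [(t, s)] are differentiated through their two partial derivatives; with
    [Wd_profile_z] this turns every invariant of [F] into an expression in the partial
    derivatives of its profile. *)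
Lemma Wd_profile_v Phi z v a b : v != 0 -> had Phi (sqnorm z) (s_var z v) a b ->
  Wd (fun v => rc (Phi (sqnorm z) (s_var z v))) v (fun i => rc b * sigma z v i)
     (fun i => rc b * (sigma z v i)^*).
Proof.
move=> v0 h.
have k : Wd (fun _ : V => rc (sqnorm z)) v (fun=> 0) (fun=> 0^*).
  by apply: (Wd_eq (Wd_cst _ _)) => // i; rewrite rmorph0.
apply: (Wd_eq (@Wr_had _ _ (fun _ => sqnorm z) _ _ _ _ _ _ _ k (Wd_s_v z v0) h)) => i /=.
  by rewrite mulr0 add0r.
by rewrite mulr0 add0r rmorphM /= conj_rc.
Qed.

Lemma Wd_profile_z Phi z v a b : v != 0 -> had Phi (sqnorm z) (s_var z v) a b ->
  Wd (fun z => rc (Phi (sqnorm z) (s_var z v))) z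
     (fun i => rc a * (z i 0)^* + rc b * ((herm z v)^* * (v i 0)^* / rc (sqnorm v)))
     (fun i => rc a * z i 0 + rc b * (herm z v * v i 0 / rc (sqnorm v))).
Proof.
move=> v0 h.
apply: (Wd_eq (@Wr_had _ _ _ _ _ _ _ _ _ _ (Wd_sqnorm z) (Wd_s_z z v0) h)) => i //=.
move: (sqnorm v) => r.
by rewrite rmorphD !rmorphM /= fmorphV /= !conj_rc !conjCK.
Qed.
End InvariantFunctions.

Section Profile.
Variables (R : realType) (n : nat).
Local Notation C := R[i].
Local Notation V := 'cV[C]_n.
Implicit Types (z v : V).
Variables (F : V -> V -> R) (phi phit phis phist phiss : R -> R -> R).
Variable Om : V -> V -> Prop.

(** The Levi matrix of [r phi] is [gam] times the identity off the plane of [z] and [v], and its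
    determinant in dimension [n] is [gam^(n - 2) levi_disc]. *)
Definition gam t s := phi t s - s * phis t s.
Definition levi_disc t s := gam t s * (phi t s + (t - s) * phis t s) +
  s * (t - s) * phi t s * phiss t s.

(** [F^2 = r phi(t, s)] on a domain [Om] stable along lines, with three derivatives of [phi]
    available where they occur. The last two fields make the Levi matrix invertible. *)
Record profile : Prop := Profile {
  prof_z : forall z v, Om z v -> along (fun z => Om z v) z;
  prof_v : forall z v, Om z v -> along (Om z) v;
  prof_v0 : forall z v, Om z v -> v != 0;
  prof_G : forall z v, Om z v ->
    sq_metric F z v = rc (sqnorm v * phi (sqnorm z) (s_var z v));
  prof_had : forall z v, Om z v ->
    had phi (sqnorm z) (s_var z v) (phit (sqnorm z) (s_var z v)) (phis (sqnorm z) (s_var z v));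
  prof_hads : forall z v, Om z v ->
    had phis (sqnorm z) (s_var z v) (phist (sqnorm z) (s_var z v)) (phiss (sqnorm z) (s_var z v));
  prof_hadt : forall z v, Om z v -> exists a b, had phit (sqnorm z) (s_var z v) a b;
  prof_hadst : forall z v, Om z v -> exists a b, had phist (sqnorm z) (s_var z v) a b;
  prof_hadss : forall z v, Om z v -> exists a b, had phiss (sqnorm z) (s_var z v) a b;
  prof_gam : forall z v, Om z v -> gam (sqnorm z) (s_var z v) != 0;
  prof_disc : forall z v, Om z v -> levi_disc (sqnorm z) (s_var z v) != 0 }.

Hypothesis P : profile.

Lemma r_neq0 z v : Om z v -> rc (sqnorm v) != 0 :> C.
Proof. by move=> /(prof_v0 P) h; rewrite fmorph_eq0 sqnorm_eq0. Qed.

Lemma had_gam z v : Om z v -> had gam (sqnorm z) (s_var z v)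
  (phit (sqnorm z) (s_var z v) - s_var z v * phist (sqnorm z) (s_var z v))
  (- s_var z v * phiss (sqnorm z) (s_var z v)).
Proof.
move=> o; have := hadB (prof_had P o) (hadM (@had_snd R (sqnorm z) (s_var z v)) (prof_hads P o)).
by move=> h; apply: had_eq h _ _; ring.
Qed.

(** The candidates for [G_a], for [G_{a conj b}] and for the mixed derivatives are given
    first as explicit functions of [(z, v)], so that each can be differentiated again. *)
Definition Gv a z v := rc (gam (sqnorm z) (s_var z v)) * (v a 0)^* +
            rc (phis (sqnorm z) (s_var z v)) * (herm z v * (z a 0)^*).

Lemma conj_Gv a z v : (Gv a z v)^* = rc (gam (sqnorm z) (s_var z v)) * v a 0 +
            rc (phis (sqnorm z) (s_var z v)) * ((herm z v)^* * z a 0).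
Proof.
rewrite /Gv; move: (gam _ _) (phis _ _) => g p.
by rewrite rmorphD !rmorphM /= !conj_rc !conjCK.
Qed.

Lemma G_d_v z v : Om z v -> Wd (sq_metric F z) v (fun a => Gv a z v)
  (fun a => (Gv a z v)^*).
Proof.
move=> o; have v0 := prof_v0 P o; have r0 := r_neq0 o.
apply: (@Wd_near _ _ (fun v => rc (sqnorm v) * rc (phi (sqnorm z) (s_var z v)))).
  by move=> e; near=> x; rewrite (prof_G P) ?rmorphM //; near: x; exact: prof_v.
have k := Wd_profile_v v0 (prof_had P o).
apply: (Wd_eq (WdM (Wd_sqnorm v) k)) => i.
  by rewrite /Gv /sigma /gam; field.
by rewrite conj_sigma conj_Gv !conjCK /gam; field.
Unshelve. all: by end_near. Qed.

Lemma G_vE a z v : Om z v -> G_v F a z v = Gv a z v.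
Proof. by move=> o; rewrite /G_v /d_v (wirt_Wd _ (G_d_v o)). Qed.

Lemma G_vbE a z v : Om z v -> d_vb a (sq_metric F) z v = (Gv a z v)^*.
Proof. by move=> o; rewrite /d_vb (wirtb_Wd _ (G_d_v o)). Qed.

Definition levi a b z v := rc (gam (sqnorm z) (s_var z v)) * (a == b)%:R +
  rc (sqnorm v * phiss (sqnorm z) (s_var z v)) * (sigma z v a * (sigma z v b)^*) +
  rc (phis (sqnorm z) (s_var z v)) * ((z a 0)^* * z b 0).

Lemma Gv_d_v a z v : Om z v -> Wd (Gv a z) v
  (fun m => rc (sqnorm v * phiss (sqnorm z) (s_var z v)) * (sigma z v m * sigma z v a))
  (fun b => levi a b z v).
Proof.
move=> o; have v0 := prof_v0 P o; have r0 := r_neq0 o.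
have k1 := Wd_profile_v v0 (had_gam o).
have k2 := Wd_profile_v v0 (prof_hads P o).
apply: (Wd_eq (WdD (WdM k1 (Wd_conj (Wd_coord a v)))
  (WdM k2 (WdM (Wd_herm_v z v) (Wd_cst ((z a 0)^*) v))))) => i.
  by rewrite rmorph0 /sigma; field.
rewrite /levi; move: (conj_sigma z v i) => sb.
rewrite [sigma z v a]/sigma rmorph_nat eq_sym; field.
by [].
Qed.

Lemma G_vvbE a b z v : Om z v -> G_vvb F a b z v = levi a b z v.
Proof.
move=> o; rewrite /G_vvb /d_vb.
rewrite (wirtb_Wd _ (@Wd_near _ _ (Gv a z) _ _ _ _ _ (Gv_d_v a o))) //.
by move=> e; near=> x; rewrite -G_vE //; near: x; exact: (prof_v P).
Unshelve. all: by end_near. Qed.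

Lemma Gv_d_z a z v : Om z v -> let t := sqnorm z in let s := s_var z v in
  Wd (Gv a ^~ v) z
  (fun b => (rc (phit t s - s * phist t s) * (z b 0)^* -
             rc (s * phiss t s / sqnorm v) * ((herm z v)^* * (v b 0)^*)) * (v a 0)^* +
    ((rc (phist t s) * (z b 0)^* + rc (phiss t s / sqnorm v) * ((herm z v)^* * (v b 0)^*)) *
      herm z v + rc (phis t s) * (v b 0)^*) * (z a 0)^*)
  (fun b => (rc (phit t s - s * phist t s) * z b 0 -
             rc (s * phiss t s / sqnorm v) * (herm z v * v b 0)) * (v a 0)^* +
    (rc (phist t s) * z b 0 + rc (phiss t s / sqnorm v) * (herm z v * v b 0)) *
      (herm z v * (z a 0)^*) + rc (phis t s) * (herm z v * (a == b)%:R)).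
Proof.
move=> o t s; have v0 := prof_v0 P o; have r0 := r_neq0 o.
have k1 := Wd_profile_z v0 (had_gam o).
have k2 := Wd_profile_z v0 (prof_hads P o).
apply: (Wd_eq (WdD (WdM k1 (Wd_cst ((v a 0)^*) z))
  (WdM k2 (WdM (Wd_herm_z z v) (Wd_conj (Wd_coord a z)))))) => i.
  by rewrite rmorph0 -/t -/s; field.
by rewrite -/t -/s rmorph_nat eq_sym; field.
Qed.

End Profile.

(** * The Levi matrix *)

Section Connection.
Variables (R : realType) (n : nat).
Local Notation C := R[i].
Local Notation V := 'cV[C]_n.
Implicit Types (z v : V).
Variables (F : V -> V -> R) (phi phit phis phist phiss : R -> R -> R).
Variable Om : V -> V -> Prop.
Hypothesis P : profile F phi phit phis phist phiss Om.

Local Notation Gv := (Gv phi phis).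
Local Notation levi := (levi phi phis phiss).
Local Notation gam := (gam phi phis).
Local Notation levi_disc := (levi_disc phi phis phiss).

Lemma levi_vb a z v : Om z v -> \sum_b levi a b z v * (v b 0)^* = Gv a z v.
Proof.
move=> o; have v0 := prof_v0 P o.
have s0 : \sum_b (v b 0)^* * (sigma z v b)^* = 0.
  transitivity ((\sum_b v b 0 * sigma z v b)^*); last by rewrite sigma_v // rmorph0.
  by rewrite rmorph_sum; apply: eq_bigr => i _; rewrite [RHS]rmorphM.
rewrite (@sum_lin3 _ _ _ (fun b => (a == b)%:R * (v b 0)^*) (fun b => (v b 0)^* * (sigma z v b)^*)
  (fun b => z b 0 * (v b 0)^*)
  (rc (gam (sqnorm z) (s_var z v))) (rc (sqnorm v * phiss (sqnorm z) (s_var z v)) * sigma z v a)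
  (rc (phis (sqnorm z) (s_var z v)) * (z a 0)^*)).
  by rewrite s0 sum_kron -/(herm z v) /Gv; ring.
by move=> i; rewrite /levi; ring.
Qed.

Lemma Gv_v z v : Om z v -> \sum_a Gv a z v * v a 0 = sq_metric F z v.
Proof.
move=> o; have v0 := prof_v0 P o.
rewrite (@sum_lin2 _ _ _ (fun a => v a 0 * (v a 0)^*) (fun a => v a 0 * (z a 0)^*)
  (rc (gam (sqnorm z) (s_var z v))) (rc (phis (sqnorm z) (s_var z v)) * herm z v)).
  rewrite sum_zzb sum_vzb -mulrA herm2 // (prof_G P o) /gam; ring.
by move=> i; rewrite /Gv; ring.
Qed.

Lemma Gv_z z v : Om z v -> \sum_a Gv a z v * z a 0 =
  herm z v * rc (phi (sqnorm z) (s_var z v) + (sqnorm z - s_var z v) * phis (sqnorm z) (s_var z v)).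
Proof.
move=> o; have v0 := prof_v0 P o.
rewrite (@sum_lin2 _ _ _ (fun a => z a 0 * (v a 0)^*) (fun a => z a 0 * (z a 0)^*)
  (rc (gam (sqnorm z) (s_var z v))) (rc (phis (sqnorm z) (s_var z v)) * herm z v)).
  by rewrite sum_zzb -/(herm z v) /gam; ring.
by move=> i; rewrite /Gv; ring.
Qed.

Definition levi_mx z v : 'M[C]_n := \matrix_(i < n, j < n) G_vvb F i j z v.

Lemma sum_levi z v (x : 'I_n -> C) b : \sum_a x a * levi a b z v =
  rc (gam (sqnorm z) (s_var z v)) * x b +
  rc (sqnorm v * phiss (sqnorm z) (s_var z v)) * (\sum_a x a * sigma z v a) * (sigma z v b)^* +
  rc (phis (sqnorm z) (s_var z v)) * (\sum_a x a * (z a 0)^*) * z b 0.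
Proof.
rewrite (@sum_lin3 _ _ _ (fun a => (b == a)%:R * x a) (fun a => x a * sigma z v a)
  (fun a => x a * (z a 0)^*)
  (rc (gam (sqnorm z) (s_var z v))) (rc (sqnorm v * phiss (sqnorm z) (s_var z v)) * (sigma z v b)^*)
  (rc (phis (sqnorm z) (s_var z v)) * z b 0)).
  by rewrite sum_kron; ring.
by move=> i; rewrite /levi eq_sym; ring.
Qed.

Lemma conj_sigma_z z v : v != 0 -> \sum_i (z i 0)^* * (sigma z v i)^* =
  (herm z v)^* * rc (sqnorm z - s_var z v) / rc (sqnorm v).
Proof.
move=> v0; transitivity ((\sum_i z i 0 * sigma z v i)^*).
  by rewrite rmorph_sum; apply: eq_bigr => i _; rewrite [RHS]rmorphM.
rewrite sigma_z //; move: (sqnorm z - s_var z v) (sqnorm v) => x y.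
by rewrite fmorph_div rmorphM /= !conj_rc.
Qed.

(** The Levi matrix is scalar plus two rank-one terms, along [sigma] and along [z]. For a row
    in its kernel the pairings [X] and [Y] with these two directions satisfy a homogeneous
    2-by-2 system of determinant [levi_disc]; so [X = Y = 0] and [gam] times the row
    vanishes. *)
Lemma levi_mx_unit z v : Om z v -> levi_mx z v \in unitmx.
Proof.
move=> o; have v0 := prof_v0 P o; have r0 := r_neq0 P o.
rewrite -row_free_unit; apply/inj_row_free => x /rowP xM.
have {}xM b : \sum_a x 0 a * levi a b z v = 0.
  have := xM b; rewrite [RHS]mxE => E0; rewrite -[RHS]E0 mxE; apply: eq_bigr => a _.
  by rewrite mxE (G_vvbE P).
pose X := \sum_a x 0 a * sigma z v a; pose Y := \sum_a x 0 a * (z a 0)^*.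
have E b : rc (gam (sqnorm z) (s_var z v)) * x 0 b +
  rc (sqnorm v * phiss (sqnorm z) (s_var z v)) * X * (sigma z v b)^* +
  rc (phis (sqnorm z) (s_var z v)) * Y * z b 0 = 0 by rewrite -sum_levi xM.
have E1 : rc (gam (sqnorm z) (s_var z v)) * Y +
  rc (sqnorm v * phiss (sqnorm z) (s_var z v)) * X *
    ((herm z v)^* * rc (sqnorm z - s_var z v) / rc (sqnorm v)) +
  rc (phis (sqnorm z) (s_var z v)) * Y * rc (sqnorm z) = 0.
  rewrite -conj_sigma_z // -sum_zzb {1}/Y.
  rewrite -(@sum_lin3 _ _ (fun b => (rc (gam (sqnorm z) (s_var z v)) * x 0 b +
  rc (sqnorm v * phiss (sqnorm z) (s_var z v)) * X * (sigma z v b)^* +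
  rc (phis (sqnorm z) (s_var z v)) * Y * z b 0) * (z b 0)^*)).
    by rewrite big1 // => b _; rewrite E mul0r.
  by move=> b; ring.
have E2 : rc (gam (sqnorm z) (s_var z v)) * X +
  rc (sqnorm v * phiss (sqnorm z) (s_var z v)) * X *
    (rc (s_var z v * (sqnorm z - s_var z v)) / rc (sqnorm v)) +
  rc (phis (sqnorm z) (s_var z v)) * Y *
    (herm z v * rc (sqnorm z - s_var z v) / rc (sqnorm v)) = 0.
  rewrite -sigma_sigma // -sigma_z // {1}/X.
  rewrite -(@sum_lin3 _ _ (fun b => (rc (gam (sqnorm z) (s_var z v)) * x 0 b +
  rc (sqnorm v * phiss (sqnorm z) (s_var z v)) * X * (sigma z v b)^* +
  rc (phis (sqnorm z) (s_var z v)) * Y * z b 0) * sigma z v b)).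
    by rewrite big1 // => b _; rewrite E mul0r.
  by move=> b; ring.
have d0 : rc (levi_disc (sqnorm z) (s_var z v)) != 0 :> C.
  by rewrite fmorph_eq0; exact: (prof_disc P o).
have g0 : rc (gam (sqnorm z) (s_var z v)) != 0 :> C.
  by rewrite fmorph_eq0; exact: (prof_gam P o).
have hh := herm2 z v0.
move: (conj_sigma z v) E E1 E2 hh.
rewrite /levi_disc in d0 *; rewrite /gam in g0 d0 *.
move: (s_var z v) (sqnorm z) (sqnorm v) (herm z v) r0 g0 d0.
move=> s t r w r0 g0 d0 _ E E1 E2 hh.
have hh' : w^* * w = rc s * rc r by rewrite mulrC.
(* Cramer's rule for the system [E1], [E2]. *)
have X0 : X = 0.
  apply/(mulfI d0); rewrite mulr0.
  transitivity ((rc (phi t s - s * phis t s) + rc (phis t s) * rc t) * 0 -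
    rc (phis t s) * (w * rc (t - s) / rc r) * 0); last by rewrite !mulr0 subr0.
  rewrite -{1}E2 -E1; field: hh hh'; exact: r0.
have Y0 : Y = 0.
  apply/(mulfI d0); rewrite mulr0.
  transitivity ((rc (phi t s - s * phis t s) + rc (r * phiss t s) * (rc (s * (t - s)) / rc r)) * 0 -
    rc (r * phiss t s) * (w^* * rc (t - s) / rc r) * 0); last by rewrite !mulr0 subr0.
  rewrite -{1}E1 -E2; field: hh hh'; exact: r0.
apply/rowP => b; rewrite mxE; apply/(mulfI g0).
by have := E b; rewrite X0 Y0 !mulr0 !mul0r !addr0.
Qed.

End Connection.

(** * The spray *)

Section Spray.
Variables (R : realType) (n : nat).
Local Notation C := R[i].
Local Notation V := 'cV[C]_n.
Implicit Types (z v : V).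
Variables (F : V -> V -> R) (phi phit phis phist phiss : R -> R -> R).
Variable Om : V -> V -> Prop.
Hypothesis P : profile F phi phit phis phist phiss Om.

Local Notation Gv := (Gv phi phis).
Local Notation levi := (levi phi phis phiss).
Local Notation gam := (gam phi phis).
Local Notation levi_disc := (levi_disc phi phis phiss).

(** The inverse Levi matrix is never computed: a solution of the linear system is exhibited
    and recognised. *)
Lemma G_inv_solve z v (X Y : 'I_n -> C) a : Om z v ->
  (forall c, \sum_a X a * levi a c z v = Y c) -> \sum_c G_inv F a c z v * Y c = X a.
Proof.
move=> o E; pose x : 'rV[C]_n := \row_a X a.
have : (x *m levi_mx F z v *m invmx (levi_mx F z v)) 0 a = X a.
  by rewrite -mulmxA mulmxV ?mulmx1 ?mxE //; exact: (levi_mx_unit P).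
move=> <-; rewrite mxE; apply: eq_bigr => c _.
rewrite mulrC /G_inv; congr (_ * _); rewrite -E mxE.
by apply: eq_bigr => i _; rewrite !mxE (G_vvbE P).
Qed.

(** Euler's relation for the homogeneity of [G] in [conj v]. *)
Lemma Gv_G_inv z v e : Om z v -> \sum_a G_v F a z v * G_inv F a e z v = (v e 0)^*.
Proof.
move=> o; pose x : 'cV[C]_n := \col_a (v a 0)^*.
have : (invmx (levi_mx F z v) *m (levi_mx F z v *m x)) e 0 = (v e 0)^*.
  by rewrite mulmxA mulVmx ?mul1mx ?mxE //; exact: (levi_mx_unit P).
move=> <-; rewrite mxE; apply: eq_bigr => a _.
rewrite mulrC /G_inv; congr (_ * _); rewrite (G_vE P) // -(levi_vb P) // mxE.
by apply: eq_bigr => i _; rewrite !mxE (G_vvbE P).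
Qed.

Lemma Wd_G_vb c z v : Om z v -> exists L M,
  Wd (d_vb c (sq_metric F) ^~ v) z L M /\
  \sum_b L b * v b 0 = (herm z v)^* * rc (phit (sqnorm z) (s_var z v) -
    s_var z v * phist (sqnorm z) (s_var z v) - s_var z v * phiss (sqnorm z) (s_var z v)
    + phis (sqnorm z) (s_var z v)) * v c 0 +
   (herm z v)^* ^+ 2 * rc (phist (sqnorm z) (s_var z v) + phiss (sqnorm z) (s_var z v)) * z c 0.
Proof.
move=> o; have v0 := prof_v0 P o; have r0 := r_neq0 P o.
have H := Wd_conj (Gv_d_z P c o); do 2!eexists; split.
  apply: Wd_near H => e; near=> x; rewrite (G_vbE P) //; near: x.
  exact: (prof_z P o).
pose M b := (rc (phit (sqnorm z) (s_var z v) - s_var z v * phist (sqnorm z) (s_var z v)) * z b 0 -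
   rc (s_var z v * phiss (sqnorm z) (s_var z v) / sqnorm v) * (herm z v * v b 0)) * (v c 0)^* +
  (rc (phist (sqnorm z) (s_var z v)) * z b 0 +
   rc (phiss (sqnorm z) (s_var z v) / sqnorm v) * (herm z v * v b 0)) *
  (herm z v * (z c 0)^*) + rc (phis (sqnorm z) (s_var z v)) * (herm z v * (c == b)%:R).
transitivity ((\sum_b M b * (v b 0)^*)^*).
  by rewrite rmorph_sum; apply: eq_bigr => b _; rewrite [RHS]rmorphM /= conjCK.
rewrite (@sum_lin3 _ _ _ (fun b => z b 0 * (v b 0)^*) (fun b => v b 0 * (v b 0)^*)
  (fun b => (c == b)%:R * (v b 0)^*)
  (rc (phit (sqnorm z) (s_var z v) - s_var z v * phist (sqnorm z) (s_var z v)) * (v c 0)^* +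
   rc (phist (sqnorm z) (s_var z v)) * (herm z v * (z c 0)^*))
  ((- rc (s_var z v * phiss (sqnorm z) (s_var z v) / sqnorm v) * (v c 0)^* +
    rc (phiss (sqnorm z) (s_var z v) / sqnorm v) * (herm z v * (z c 0)^*)) * herm z v)
  (rc (phis (sqnorm z) (s_var z v)) * herm z v)); last first.
  by move=> b; rewrite /M; ring.
rewrite sum_kron sum_zzb -/(herm z v) {M H}.
move: (s_var z v) (sqnorm z) (sqnorm v) (herm z v) r0 => s t r w r0.
transitivity ((w * rc (phit t s - s * phist t s - s * phiss t s + phis t s) * (v c 0)^* +
   w ^+ 2 * rc (phist t s + phiss t s) * (z c 0)^*)^*).
  by congr Num.conj; field.
move: (phit t s - s * phist t s - s * phiss t s + phis t s) (phist t s + phiss t s) => x y.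
by rewrite rmorphD !rmorphM /= !conjCK !conj_rc expr2.
Unshelve. all: by end_near. Qed.

(** The contraction of the connection with [v]. Unlike the connection itself it stays in the
    plane of [z] and [v], and it is all that the two conditions on [F] depend on. *)
Definition spray a z v : C := \sum_b Nconn F a b z v * v b 0.

(** By unitary invariance the spray is [w' A v + w'^2 B z] for two functions of [(t, s)], where
    [w'] is the conjugate of [herm z v]; [A] and [B] are determined by comparing the
    coefficients of [v] and of [z] after lowering the index. *)
Lemma sprayE a z v (A B : R) : Om z v -> let t := sqnorm z in let s := s_var z v in
  gam t s * A - s ^+ 2 * (t - s) * phiss t s * B =
    phit t s - s * phist t s - s * phiss t s + phis t s ->
  A * phis t s + B * (gam t s + t * phis t s + s * (t - s) * phiss t s) =
    phist t s + phiss t s ->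
  spray a z v = (herm z v)^* * rc A * v a 0 + (herm z v)^* ^+ 2 * rc B * z a 0.
Proof.
move=> o t s e1 e2; have v0 := prof_v0 P o; have r0 := r_neq0 P o.
rewrite -(@G_inv_solve z v (fun a => (herm z v)^* * rc A * v a 0 + (herm z v)^* ^+ 2 * rc B * z a 0)
  (fun c => (herm z v)^* * rc (phit t s - s * phist t s - s * phiss t s + phis t s) * v c 0 +
   (herm z v)^* ^+ 2 * rc (phist t s + phiss t s) * z c 0)) //.
  rewrite /spray /Nconn; under eq_bigr do rewrite mulr_suml.
  rewrite exchange_big; apply: eq_bigr => c _ /=.
  under eq_bigr do rewrite -mulrA.
  rewrite -mulr_sumr; congr (_ * _).
  have [L [M [h <-]]] := Wd_G_vb c o.
  by apply: eq_bigr => b _; rewrite /G_vb_z /d_z (wirt_Wd _ h).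
move=> c; rewrite sum_levi.
rewrite (@sum_lin2 _ _ _ (fun i => v i 0 * sigma z v i) (fun i => z i 0 * sigma z v i)
  ((herm z v)^* * rc A) ((herm z v)^* ^+ 2 * rc B)); last by move=> i; ring.
rewrite sigma_v // sigma_z //.
rewrite (@sum_lin2 _ _ _ (fun i => v i 0 * (z i 0)^*) (fun i => z i 0 * (z i 0)^*)
  ((herm z v)^* * rc A) ((herm z v)^* ^+ 2 * rc B)); last by move=> i; ring.
rewrite sum_vzb sum_zzb conj_sigma -e1 -e2 -/t -/s.
have hh : herm z v * (herm z v)^* = rc s * rc (sqnorm v) by exact: herm2.
move: (gam t s) => g; move: (sqnorm v) hh r0 => r hh r0.
move: t s (herm z v) (herm z v)^* hh {e1 e2} => t s w u hh.
by field: hh.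
Qed.

End Spray.

(** * The weakly Kahler condition *)

Section MoreWirtinger.
Variables (R : realType) (n : nat).
Local Notation C := R[i].
Local Notation V := 'cV[C]_n.

Lemma Wd_wirt (f : V -> C) p : WD f p -> Wd f p (fun i => wirt i f p) (fun i => wirtb i f p).
Proof.
by move=> [L [M h]]; apply: (Wd_eq h) => i; rewrite ?(wirt_Wd _ h) ?(wirtb_Wd _ h).
Qed.

(** Contractions may be moved inside a derivative. These statements apply to coefficients
    whose closed form is unknown, such as those of the connection, as soon as the contraction
    is known. *)
Lemma wirt_lin (c : 'I_n -> C) (f : 'I_n -> V -> C) g p i :
  (forall j, WD (f j) p) -> along (fun q => \sum_j f j q * c j = g q) p ->
  \sum_j wirt i (f j) p * c j = wirt i g p.
Proof.
move=> h al; have k j := WdM (Wd_wirt (h j)) (Wd_cst (c j) p).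
have := Wd_near al (Wd_sum _ xpredT k); move=> H; rewrite (wirt_Wd _ H).
by apply: eq_bigr => j _; rewrite mulr0 addr0.
Qed.

Lemma wirtb_lin (c : 'I_n -> C) (f : 'I_n -> V -> C) g p i :
  (forall j, WD (f j) p) -> along (fun q => \sum_j f j q * c j = g q) p ->
  \sum_j wirtb i (f j) p * c j = wirtb i g p.
Proof.
move=> h al; have k j := WdM (Wd_wirt (h j)) (Wd_cst (c j) p).
have := Wd_near al (Wd_sum _ xpredT k); move=> H; rewrite (wirtb_Wd _ H).
by apply: eq_bigr => j _; rewrite mulr0 addr0.
Qed.

(** The same with coefficients depending on the point through conjugate coordinates
    only: they are constants for the holomorphic operator. *)
Lemma wirt_lin_conj (f : 'I_n -> V -> C) g p i :
  (forall j, WD (f j) p) -> along (fun q => \sum_j f j q * (q j 0)^* = g q) p ->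
  \sum_j wirt i (f j) p * (p j 0)^* = wirt i g p.
Proof.
move=> h al; have k j := WdM (Wd_wirt (h j)) (Wd_conj (Wd_coord j p)).
have := Wd_near al (Wd_sum _ xpredT k); move=> H; rewrite (wirt_Wd _ H).
by apply: eq_bigr => j _; rewrite rmorph0 mulr0 addr0.
Qed.

Lemma wirtb_lin_coord (f : 'I_n -> V -> C) g p i :
  (forall j, WD (f j) p) -> along (fun q => \sum_j f j q * q j 0 = g q) p ->
  \sum_j wirtb i (f j) p * p j 0 = wirtb i g p.
Proof.
move=> h al; have k j := WdM (Wd_wirt (h j)) (Wd_coord j p).
have := Wd_near al (Wd_sum _ xpredT k); move=> H; rewrite (wirtb_Wd _ H).
by apply: eq_bigr => j _; rewrite mulr0 addr0.
Qed.

Lemma WD_coord j (p : V) : WD (fun q => q j 0) p.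
Proof. by do 2!eexists; exact: Wd_coord. Qed.
Lemma WDB (f g : V -> C) p : WD f p -> WD g p -> WD (fun q => f q - g q) p.
Proof. by move=> [? [? h]] [? [? k]]; do 2!eexists; exact: WdD h (WdN k). Qed.
Lemma WD_herm_z (z v : V) : WD (fun z => herm z v) z.
Proof. by do 2!eexists; exact: Wd_herm_z. Qed.
Lemma WD_herm_v (z v : V) : WD (herm z) v.
Proof. by do 2!eexists; exact: Wd_herm_v. Qed.
Lemma WD_sqnorm (z : V) : WD (fun z => rc (sqnorm z)) z.
Proof. by do 2!eexists; exact: Wd_sqnorm. Qed.
Lemma WD_s_z (z v : V) : v != 0 -> WD (fun z => rc (s_var z v)) z.
Proof. by move=> v0; do 2!eexists; exact: Wd_s_z. Qed.
Lemma WD_s_v (z v : V) : v != 0 -> WD (fun v => rc (s_var z v)) v.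
Proof. by move=> v0; do 2!eexists; exact: Wd_s_v. Qed.
Lemma WD_profile_v Phi (z v : V) a b : v != 0 -> had Phi (sqnorm z) (s_var z v) a b ->
  WD (fun v => rc (Phi (sqnorm z) (s_var z v))) v.
Proof. by move=> v0 h; do 2!eexists; exact: (Wd_profile_v v0 h). Qed.
Lemma WD_profile_z Phi (z v : V) a b : v != 0 -> had Phi (sqnorm z) (s_var z v) a b ->
  WD (fun z => rc (Phi (sqnorm z) (s_var z v))) z.
Proof. by move=> v0 h; do 2!eexists; exact: (Wd_profile_z v0 h). Qed.
Lemma WD_sigma_z (z v : V) a : v != 0 -> WD (fun z => sigma z v a) z.
Proof.
move=> v0; apply: WDM; last exact: WD_cst.
apply: WDB; apply: WDM; rewrite -/(herm _ _).
- exact: WD_conj (WD_coord a z).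
- exact: WD_herm_z.
- exact: WD_s_z.
- exact: WD_cst.
Qed.
Lemma WD_sigma_v (z v : V) a : v != 0 -> WD (fun v => sigma z v a) v.
Proof.
move=> v0; have r0 : rc (sqnorm v) != 0 by rewrite fmorph_eq0 sqnorm_eq0.
apply: WDM; last exact: WDV (WD_sqnorm v) r0.
apply: WDB; apply: WDM.
- exact: WD_cst.
- exact: WD_herm_v.
- exact: WD_s_v.
- exact: WD_conj (WD_coord a v).
Qed.
End MoreWirtinger.

Section WeaklyKahler.
Variables (R : realType) (n : nat).
Local Notation C := R[i].
Local Notation V := 'cV[C]_n.
Implicit Types (z v : V).
Variables (F : V -> V -> R) (phi phit phis phist phiss : R -> R -> R).
Variable Om : V -> V -> Prop.
Hypothesis P : profile F phi phit phis phist phiss Om.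

Local Notation Gv := (Gv phi phis).
Local Notation levi := (levi phi phis phiss).
Local Notation gam := (gam phi phis).

Lemma WD_G_vvb_z a b z v : Om z v -> WD (G_vvb F a b ^~ v) z.
Proof.
move=> o; have v0 := prof_v0 P o; have [x [y hss]] := prof_hadss P o.
apply: (@WD_near _ _ (levi a b ^~ v)).
  by move=> e; near=> h; rewrite (G_vvbE P) //; near: h; exact: (prof_z P).
apply: WDD; first apply: WDD.
- by apply: WDM; [exact: WD_profile_z (had_gam P o) | exact: WD_cst].
- apply: WDM; last by apply: WDM; [exact: WD_sigma_z | apply: WD_conj; exact: WD_sigma_z].
  apply: (@WD_near _ _ (fun z => rc (sqnorm v) * rc (phiss (sqnorm z) (s_var z v)))).
    by move=> e; near=> h; rewrite rmorphM.
  by apply: WDM; [exact: WD_cst | exact: WD_profile_z hss].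
- apply: WDM; first exact: WD_profile_z (prof_hads P o).
  by apply: WDM; [apply: WD_conj; exact: WD_coord | exact: WD_coord].
Unshelve. all: by end_near. Qed.

Lemma WD_G_vvb_v a b z v : Om z v -> WD (G_vvb F a b z) v.
Proof.
move=> o; have v0 := prof_v0 P o; have [x [y hss]] := prof_hadss P o.
apply: (@WD_near _ _ (levi a b z)).
  by move=> e; near=> h; rewrite (G_vvbE P) //; near: h; exact: (prof_v P).
apply: WDD; first apply: WDD.
- by apply: WDM; [exact: WD_profile_v (had_gam P o) | exact: WD_cst].
- apply: WDM; last by apply: WDM; [exact: WD_sigma_v | apply: WD_conj; exact: WD_sigma_v].
  apply: (@WD_near _ _ (fun v => rc (sqnorm v) * rc (phiss (sqnorm z) (s_var z v)))).
    by move=> e; near=> h; rewrite rmorphM.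
  by apply: WDM; [exact: WD_sqnorm | exact: WD_profile_v hss].
- apply: WDM; first exact: WD_profile_v (prof_hads P o).
  by apply: WDM; exact: WD_cst.
Unshelve. all: by end_near. Qed.

Lemma G_vvb_z_vb b c z v : Om z v ->
  \sum_e d_z c (G_vvb F b e) z v * (v e 0)^* = d_z c (Gv b) z v.
Proof.
move=> o; apply: (@wirt_lin _ _ _ (fun e z => G_vvb F b e z v)) => [e|e].
  exact: WD_G_vvb_z.
near=> h; rewrite -(levi_vb P); last by near: h; exact: (prof_z P).
apply: eq_bigr => i _; rewrite (G_vvbE P) //; near: h; exact: (prof_z P).
Unshelve. all: by end_near. Qed.

Lemma G_vvb_v_vb b m z v : Om z v ->
  \sum_e d_v m (G_vvb F b e) z v * (v e 0)^* = d_v m (Gv b) z v.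
Proof.
move=> o; apply: (@wirt_lin_conj _ _ (fun e v => G_vvb F b e z v)) => [e|e].
  exact: WD_G_vvb_v.
near=> h; rewrite -(levi_vb P); last by near: h; exact: (prof_v P).
apply: eq_bigr => i _; rewrite (G_vvbE P) //; near: h; exact: (prof_v P).
Unshelve. all: by end_near. Qed.

(** Contracting the first index of the Chern-Finsler coefficients with [G_a]
    leaves derivatives of [G_b] only. *)
Lemma Gv_Gamma b c z v : Om z v ->
  \sum_a G_v F a z v * Gamma F a b c z v =
  d_z c (Gv b) z v - \sum_m Nconn F m c z v * d_v m (Gv b) z v.
Proof.
move=> o; rewrite /Gamma; under eq_bigr do rewrite mulr_sumr.
rewrite exchange_big /=.
transitivity (\sum_e delta F c (G_vvb F b e) z v * (v e 0)^*).
  apply: eq_bigr => e _; rewrite -(Gv_G_inv P e o) mulr_sumr.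
  by apply: eq_bigr => a _; ring.
rewrite /delta; under [LHS]eq_bigr do rewrite mulrBl.
rewrite big_split /= G_vvb_z_vb // sumrN; congr (_ - _).
under [LHS]eq_bigr do rewrite mulr_suml.
rewrite exchange_big; apply: eq_bigr => m _ /=.
by rewrite -G_vvb_v_vb // mulr_sumr; apply: eq_bigr => e _; ring.
Qed.

Lemma d_v_Gv b m z v : Om z v -> d_v m (Gv b) z v =
  rc (sqnorm v * phiss (sqnorm z) (s_var z v)) * (sigma z v m * sigma z v b).
Proof. by move=> o; rewrite /d_v (wirt_Wd _ (Gv_d_v P b o)). Qed.

Variables (z v : V) (A B : R).
Hypothesis o : Om z v.
Local Notation t := (sqnorm z).
Local Notation s := (s_var z v).
Local Notation r := (sqnorm v).
Local Notation w := (herm z v).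
Hypothesis e1 : gam t s * A - s ^+ 2 * (t - s) * phiss t s * B =
    phit t s - s * phist t s - s * phiss t s + phis t s.
Hypothesis e2 : A * phis t s + B * (gam t s + t * phis t s + s * (t - s) * phiss t s) =
    phist t s + phiss t s.

Lemma spray_sigma : \sum_m spray F m z v * sigma z v m = w^* * rc (s * B * (t - s)).
Proof.
have v0 := prof_v0 P o; have r0 := r_neq0 P o.
rewrite (@sum_lin2 _ _ _ (fun i => v i 0 * sigma z v i) (fun i => z i 0 * sigma z v i)
  (w^* * rc A) (w^* ^+ 2 * rc B)).
  rewrite sigma_v // sigma_z //; have hh := herm2 z v0.
  by move: s t r w w^* hh r0 => s t r w u hh r0; field: hh.
by move=> i; rewrite (sprayE P i o e1 e2); ring.
Qed.

(** The one scalar on which the weakly Kahler condition depends. *)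
Definition kahler_defect : R :=
  phit t s - phis t s - s * (phist t s + (1 - s * B * (t - s)) * phiss t s).

Lemma Gv_Gamma_v b : \sum_(a < n) \sum_(c < n) G_v F a z v * Gamma F a b c z v * v c 0 =
  \sum_c d_z c (Gv b) z v * v c 0 - \sum_c \sum_m Nconn F m c z v * d_v m (Gv b) z v * v c 0.
Proof.
rewrite exchange_big -sumrB; apply: eq_bigr => c _ /=.
by rewrite -!mulr_suml Gv_Gamma // mulrBl.
Qed.

Lemma Gv_Gamma_v' b : \sum_(a < n) \sum_(c < n) G_v F a z v * Gamma F a c b z v * v c 0 =
  \sum_c d_z b (Gv c) z v * v c 0 - \sum_c \sum_m Nconn F m b z v * d_v m (Gv c) z v * v c 0.
Proof.
rewrite exchange_big -sumrB; apply: eq_bigr => c _ /=.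
by rewrite -!mulr_suml Gv_Gamma // mulrBl.
Qed.

(** The difference of the two sides of the condition is a covector of the plane of [z] and
    [v] which kills [v], hence a multiple of [conj w conj v - r conj z]. *)
Lemma weakly_kahler_at b :
  \sum_(a < n) \sum_(c < n) G_v F a z v * Gamma F a b c z v * v c 0 -
  \sum_(a < n) \sum_(c < n) G_v F a z v * Gamma F a c b z v * v c 0 =
  rc kahler_defect * (w^* * (v b 0)^* - rc r * (z b 0)^*).
Proof.
have v0 := prof_v0 P o; have r0 := r_neq0 P o.
have hh := herm2 z v0.
(* The contraction kills this term because [sigma] kills [v]. *)
have E1 : \sum_c \sum_m Nconn F m b z v * d_v m (Gv c) z v * v c 0 = 0.
  rewrite exchange_big big1 // => m _ /=.
  transitivity (Nconn F m b z v * rc (r * phiss t s) * sigma z v m * \sum_c v c 0 * sigma z v c).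
    by rewrite mulr_sumr; apply: eq_bigr => c _; rewrite d_v_Gv //; ring.
  by rewrite sigma_v // mulr0.
(* Here only the spray is seen. *)
have E2 : \sum_c \sum_m Nconn F m c z v * d_v m (Gv b) z v * v c 0 =
   w^* * rc (s * B * (t - s)) * rc (r * phiss t s) * sigma z v b.
  rewrite -spray_sigma exchange_big 2!mulr_suml /=; apply: eq_bigr => m _.
  transitivity (spray F m z v * d_v m (Gv b) z v).
    by rewrite /spray mulr_suml; apply: eq_bigr => c _; ring.
  by rewrite d_v_Gv //; ring.
have E3 : \sum_c d_z c (Gv b) z v * v c 0 =
  w^* * rc (phit t s - s * phist t s - s * phiss t s) * (v b 0)^* +
  (w^* * w * rc (phist t s + phiss t s) + rc (r * phis t s)) * (z b 0)^*.
  under eq_bigr do rewrite /d_z (wirt_Wd _ (Gv_d_z P b o)) /=.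
  rewrite (@sum_lin2 _ _ _ (fun c => v c 0 * (z c 0)^*) (fun c => v c 0 * (v c 0)^*)
   (rc (phit t s - s * phist t s) * (v b 0)^* + rc (phist t s) * w * (z b 0)^*)
   (- rc (s * phiss t s / r) * w^* * (v b 0)^* +
     (rc (phiss t s / r) * w^* * w + rc (phis t s)) * (z b 0)^*)).
    by rewrite sum_vzb sum_zzb; move: s t r w w^* r0 {hh} => s t r w u r0; field.
  by move=> i; ring.
have E4 : \sum_c d_z b (Gv c) z v * v c 0 =
  rc (r * phit t s) * (z b 0)^* + rc (phis t s) * w^* * (v b 0)^*.
  under eq_bigr do rewrite /d_z (wirt_Wd _ (Gv_d_z P _ o)) /=.
  rewrite (@sum_lin2 _ _ _ (fun c => v c 0 * (v c 0)^*) (fun c => v c 0 * (z c 0)^*)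
   (rc (phit t s - s * phist t s) * (z b 0)^* - rc (s * phiss t s / r) * w^* * (v b 0)^*)
   ((rc (phist t s) * (z b 0)^* + rc (phiss t s / r) * (w^* * (v b 0)^*)) * w
     + rc (phis t s) * (v b 0)^*)).
    rewrite sum_zzb sum_vzb; move: s t r w w^* r0 hh => s t r w u r0 hh.
    by field: hh.
  by move=> i; ring.
apply: (etrans (f_equal2 (fun x y => x - y) (Gv_Gamma_v b) (Gv_Gamma_v' b))).
apply: (etrans (f_equal2 (fun x y => x - y) (f_equal2 (fun x y => x - y) E3 E2)
  (f_equal2 (fun x y => x - y) E4 E1))).
rewrite /kahler_defect /sigma {E1 E2 E3 E4}; move: s t r w w^* r0 hh => s t r w u r0 hh.
by field: hh.
Qed.

End WeaklyKahler.

(** * The holomorphic curvature *)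

Section Curvature.
Variables (R : realType) (n : nat).
Local Notation C := R[i].
Local Notation V := 'cV[C]_n.
Implicit Types (z v : V).
Variables (F : V -> V -> R) (phi phit phis phist phiss : R -> R -> R).
Variable Om : V -> V -> Prop.
Hypothesis P : profile F phi phit phis phist phiss Om.

Local Notation Gv := (Gv phi phis).
Local Notation gam := (gam phi phis).

(** The derivative of [G_c] in [conj z_b], conjugate to the coefficient [G_{conj c; b}] of the
    connection. *)
Definition mixed c b z v : C :=
  (rc (phit (sqnorm z) (s_var z v) - s_var z v * phist (sqnorm z) (s_var z v)) * z b 0 -
   rc (s_var z v * phiss (sqnorm z) (s_var z v)) * (rc (sqnorm v))^-1 * (herm z v * v b 0)) * (v c 0)^* +
  (rc (phist (sqnorm z) (s_var z v)) * z b 0 +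
   rc (phiss (sqnorm z) (s_var z v)) * (rc (sqnorm v))^-1 * (herm z v * v b 0)) *
  (herm z v * (z c 0)^*) + rc (phis (sqnorm z) (s_var z v)) * (herm z v * (c == b)%:R).

Lemma G_vb_zE c b z v : Om z v -> G_vb_z F c b z v = (mixed c b z v)^*.
Proof.
move=> o; have r0 := r_neq0 P o; rewrite /G_vb_z /d_z.
have H := Wd_conj (Gv_d_z P c o).
rewrite (wirt_Wd _ (Wd_near _ H)); last first.
  by move=> e; near=> x; rewrite (G_vbE P) //; near: x; exact: (prof_z P).
congr Num.conj; rewrite /mixed; field.
by [].
Unshelve. all: by end_near. Qed.

Lemma WD_mixed_z c b z v : Om z v -> WD (mixed c b ^~ v) z.
Proof.
move=> o; have v0 := prof_v0 P o.
have [x1 [y1 h1]] := prof_hadt P o; have [x2 [y2 h2]] := prof_hadst P o.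
have [x3 [y3 h3]] := prof_hadss P o.
have S := @had_snd R (sqnorm z) (s_var z v).
have h4 := hadB h1 (hadM S h2).
have h5 := hadM S h3.
have W := WD_herm_z z v; have Z i := WD_coord i z.
have K (a : C) := WD_cst a z.
apply: WDD; first apply: WDD.
- apply: WDM; last exact: K.
  apply: WDB; first by apply: WDM; [exact: WD_profile_z h4 | exact: Z].
  apply: WDM; first by apply: WDM; [exact: WD_profile_z h5 | exact: K].
  by apply: WDM; [exact: W | exact: K].
- apply: WDM; last by apply: WDM; [exact: W | apply: WD_conj; exact: Z].
  apply: WDD; first by apply: WDM; [exact: WD_profile_z h2 | exact: Z].
  apply: WDM; first by apply: WDM; [exact: WD_profile_z h3 | exact: K].
  by apply: WDM; [exact: W | exact: K].
- apply: WDM; first exact: WD_profile_z (prof_hads P o).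
  by apply: WDM; [exact: W | exact: K].
Qed.

Lemma WD_mixed_v c b z v : Om z v -> WD (mixed c b z) v.
Proof.
move=> o; have v0 := prof_v0 P o; have r0 := r_neq0 P o.
have [x1 [y1 h1]] := prof_hadt P o; have [x2 [y2 h2]] := prof_hadst P o.
have [x3 [y3 h3]] := prof_hadss P o.
have S := @had_snd R (sqnorm z) (s_var z v).
have h4 := hadB h1 (hadM S h2).
have h5 := hadM S h3.
have W := WD_herm_v z v; have Z i := WD_coord i v.
have K (a : C) := WD_cst a v.
have N := WDV (WD_sqnorm v) r0.
apply: WDD; first apply: WDD.
- apply: WDM; last by apply: WD_conj; exact: Z.
  apply: WDB; first by apply: WDM; [exact: WD_profile_v h4 | exact: K].
  apply: WDM; first by apply: WDM; [exact: WD_profile_v h5 | exact: N].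
  by apply: WDM; [exact: W | exact: Z].
- apply: WDM; last by apply: WDM; [exact: W | exact: K].
  apply: WDD; first by apply: WDM; [exact: WD_profile_v h2 | exact: K].
  apply: WDM; first by apply: WDM; [exact: WD_profile_v h3 | exact: N].
  by apply: WDM; [exact: W | exact: Z].
- apply: WDM; first exact: WD_profile_v (prof_hads P o).
  by apply: WDM; [exact: W | exact: K].
Qed.

(** Differentiability of the connection, which is needed before the contraction with [v] can
    be moved inside the derivatives in [hol_curvature_spray]. *)
Lemma WD_Nconn_z a b z v : Om z v -> WD (Nconn F a b ^~ v) z.
Proof.
move=> o; apply: WD_sum => c; apply: WDM.
  apply: (@WD_invmx _ _ _ (levi_mx F ^~ v)).
  - move=> i j; apply: (@WD_near _ _ (G_vvb F i j ^~ v)); last exact: (WD_G_vvb_z P).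
    by move=> e; near=> h; rewrite mxE.
  - by move=> e; near=> h; apply: (levi_mx_unit P); near: h; exact: (prof_z P).
  - exact: (levi_mx_unit P).
apply: (@WD_near _ _ (fun z => (mixed c b z v)^*)).
  by move=> e; near=> h; rewrite G_vb_zE //; near: h; exact: (prof_z P).
by apply: WD_conj; exact: WD_mixed_z.
Unshelve. all: by end_near. Qed.

Lemma WD_Nconn_v a b z v : Om z v -> WD (Nconn F a b z) v.
Proof.
move=> o; apply: WD_sum => c; apply: WDM.
  apply: (@WD_invmx _ _ _ (levi_mx F z)).
  - move=> i j; apply: (@WD_near _ _ (G_vvb F i j z)); last exact: (WD_G_vvb_v P).
    by move=> e; near=> h; rewrite mxE.
  - by move=> e; near=> h; apply: (levi_mx_unit P); near: h; exact: (prof_v P).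
  - exact: (levi_mx_unit P).
apply: (@WD_near _ _ (fun v => (mixed c b z v)^*)).
  by move=> e; near=> h; rewrite G_vb_zE //; near: h; exact: (prof_v P).
by apply: WD_conj; exact: WD_mixed_v.
Unshelve. all: by end_near. Qed.

(** Only the spray enters the curvature: the tangent direction may be moved
    inside the antiholomorphic operators. *)
Lemma hol_curvature_spray z v : Om z v -> hol_curvature F z v =
  - (2 / sq_metric F z v ^+ 2) * \sum_a Gv a z v *
    (\sum_c d_zb c (spray F a) z v * (v c 0)^* -
     \sum_m (spray F m z v)^* * d_vb m (spray F a) z v).
Proof.
move=> o; rewrite /hol_curvature; congr (_ * _); apply: eq_bigr => a _.
rewrite exchange_big /=.
transitivity (\sum_c Gv a z v * ((\sum_b deltab F c (Nconn F a b) z v * v b 0) * (v c 0)^*)).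
  apply: eq_bigr => c _; rewrite mulr_suml mulr_sumr; apply: eq_bigr => b _.
  by rewrite (G_vE P) //; ring.
rewrite -mulr_sumr; congr (_ * _).
have E1 c : \sum_b d_zb c (Nconn F a b) z v * v b 0 = d_zb c (spray F a) z v.
  apply: (@wirtb_lin _ _ (fun b => v b 0) (fun b z => Nconn F a b z v)) => [b|e].
    exact: WD_Nconn_z.
  by near=> h.
have E2 m : \sum_b d_vb m (Nconn F a b) z v * v b 0 = d_vb m (spray F a) z v.
  apply: (@wirtb_lin_coord _ _ (fun b v => Nconn F a b z v)) => [b|e].
    exact: WD_Nconn_v.
  by near=> h.
have E c : \sum_b deltab F c (Nconn F a b) z v * v b 0 =
    d_zb c (spray F a) z v - \sum_m (Nconn F m c z v)^* * d_vb m (spray F a) z v.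
  rewrite -E1; under [X in _ - X]eq_bigr do rewrite -E2 mulr_sumr.
  rewrite exchange_big -sumrB; apply: eq_bigr => b _.
  rewrite /deltab mulrBl mulr_suml; congr (_ - _).
  by apply: eq_bigr => m _; ring.
under [LHS]eq_bigr do rewrite E mulrBl mulr_suml.
rewrite sumrB; congr (_ - _); rewrite exchange_big; apply: eq_bigr => m _ /=.
rewrite /spray rmorph_sum mulr_suml; apply: eq_bigr => c _ /=.
by rewrite rmorphM /=; ring.
Unshelve. all: by end_near. Qed.

Variables (A B : R -> R -> R).
Hypothesis eA : forall z v, Om z v -> let t := sqnorm z in let s := s_var z v in
  gam t s * A t s - s ^+ 2 * (t - s) * phiss t s * B t s =
    phit t s - s * phist t s - s * phiss t s + phis t s.
Hypothesis eB : forall z v, Om z v -> let t := sqnorm z in let s := s_var z v in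
  A t s * phis t s + B t s * (gam t s + t * phis t s + s * (t - s) * phiss t s) =
    phist t s + phiss t s.

Definition spray_fun a z v : C :=
  (herm z v)^* * rc (A (sqnorm z) (s_var z v)) * v a 0 +
  (herm z v)^* ^+ 2 * rc (B (sqnorm z) (s_var z v)) * z a 0.

Lemma spray_funE a z v : Om z v -> spray F a z v = spray_fun a z v.
Proof. by move=> o; rewrite (sprayE P a o (eA o) (eB o)). Qed.

(** The curvature in terms of [A] and [B]. The derivation [conj v^c delta_{conj c}] that
    occurs in it maps [t] to [w] and [s] to [lam w], where [w = herm z v]. *)
Lemma hol_curvatureE z v (At As Bt Bs : R) : Om z v -> 
  let t := sqnorm z in let s := s_var z v in let lam := 1 - s * B t s * (t - s) in
  phi t s != 0 ->
  had A t s At As -> had B t s Bt Bs ->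
  hol_curvature F z v = rc (- (2 / phi t s ^+ 2) *
   (phi t s * (A t s + s * (At + lam * As)) +
    s * (phi t s + (t - s) * phis t s) * (2 * B t s + s * (Bt + lam * Bs)))).
Proof.
move=> o t s lam phi0 hA hB; have v0 := prof_v0 P o; have r0 := r_neq0 P o.
have hh := herm2 z v0.
rewrite hol_curvature_spray //.
pose w := herm z v; pose r := sqnorm v.
have Ez a c : d_zb c (spray F a) z v =
   v c 0 * rc (A t s) * v a 0 + w^* * (rc At * z c 0 + rc As * (w * v c 0 / rc r)) * v a 0 +
   2 * w^* * v c 0 * rc (B t s) * z a 0 +
   w^* ^+ 2 * (rc Bt * z c 0 + rc Bs * (w * v c 0 / rc r)) * z a 0.
  have kw := Wd_conj (Wd_herm_z z v).
  have H := WdD (WdM (WdM kw (Wd_profile_z v0 hA)) (Wd_cst (v a 0) z))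
     (WdM (WdM (WdM kw kw) (Wd_profile_z v0 hB)) (Wd_coord a z)).
  rewrite /d_zb (wirtb_Wd _ (Wd_near _ H)) /=; last first.
    move=> e; near=> h; rewrite spray_funE /spray_fun ?expr2 //; near: h; exact: (prof_z P).
  by rewrite !conjCK -/w -/t -/s -/r; ring.
have Ev a m : d_vb m (spray F a) z v =
   w^* * (rc As * (sigma z v m)^*) * v a 0 + w^* ^+ 2 * (rc Bs * (sigma z v m)^*) * z a 0.
  have kw := Wd_conj (Wd_herm_v z v).
  have H := WdD (WdM (WdM kw (Wd_profile_v v0 hA)) (Wd_coord a v))
     (WdM (WdM (WdM kw kw) (Wd_profile_v v0 hB)) (Wd_cst (z a 0) v)).
  rewrite /d_vb (wirtb_Wd _ (Wd_near _ H)) /=; last first.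
    move=> e; near=> h; rewrite spray_funE /spray_fun ?expr2 //; near: h; exact: (prof_v P).
  by rewrite rmorph0 -/w -/t -/s -/r; ring.
have Sz a : \sum_c d_zb c (spray F a) z v * (v c 0)^* =
   (rc (r * A t s) + w^* * w * rc (At + As)) * v a 0 +
   w^* * (rc (2 * r * B t s) + w^* * w * rc (Bt + Bs)) * z a 0.
  rewrite (@sum_lin2 _ _ _ (fun c => v c 0 * (v c 0)^*) (fun c => z c 0 * (v c 0)^*)
    ((rc (A t s) + w^* * rc As * w / rc r) * v a 0 + (2 * w^* * rc (B t s) + 
       w^* ^+ 2 * rc Bs * w / rc r) * z a 0)
    (w^* * rc At * v a 0 + w^* ^+ 2 * rc Bt * z a 0)).
    by rewrite sum_zzb -/(herm z v) -/w -/r; field.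
  by move=> c; rewrite Ez; ring.
have Sv a : \sum_m (spray F m z v)^* * d_vb m (spray F a) z v =
   w * rc (s * B t s * (t - s)) * (w^* * rc As * v a 0 + w^* ^+ 2 * rc Bs * z a 0).
  have <- : \sum_m (spray F m z v)^* * (sigma z v m)^* = w * rc (s * B t s * (t - s)).
    transitivity ((\sum_m spray F m z v * sigma z v m)^*).
      by rewrite rmorph_sum; apply: eq_bigr => i _; rewrite [RHS]rmorphM.
    rewrite (spray_sigma P o (eA o) (eB o)) -/t -/s -/w.
    move: (s * B t s * (t - s)) => x.
    by rewrite rmorphM /= conjCK conj_rc.
  by rewrite mulr_suml; apply: eq_bigr => m _; rewrite Ev; ring.
pose u := w^*.
rewrite (@sum_lin2 _ _ _ (fun a => Gv a z v * v a 0) (fun a => Gv a z v * z a 0)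
  (rc (r * A t s) + u * w * rc (At + lam * As))
  (u * (rc (2 * r * B t s) + u * w * rc (Bt + lam * Bs)))); last first.
  by move=> a; rewrite Sz Sv -/u /lam; ring.
rewrite (Gv_v P) // (Gv_z P) // (prof_G P o) -/t -/s -/w -/r.
have {}hh : w * u = rc s * rc r := hh.
have p0 : rc (phi t s) != 0 :> C by rewrite fmorph_eq0.
rewrite -/r in r0.
clear Ez Ev Sz Sv; clearbody u; clearbody w r lam.
move: (phi t s) (phis t s) (A t s) (B t s) p0 => p ps a b p0.
field: hh.
by rewrite p0 r0.
Unshelve. all: by end_near. Qed.

End Curvature.

(** * Profiles with one square root *)

Section RootProfile.
Variables (R : realType) (f f1 g g1 a a1 b b1 : R -> R).
Implicit Types t s : R.

(** The profile [(sqrt P1 + sqrt P2)^2] of [alpha + |beta|] with [P1] and [P2] affine in [s],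
    in the expanded form [P1 + P2 + 2 rho] whose derivatives are rational in [rho]. The
    functions [f1], [g1], [a1], [b1] stand for the derivatives of the coefficients. *)
Definition P1 t s := f t + g t * s.
Definition P2 t s := a t + b t * s.
Definition P1t t s := f1 t + g1 t * s.
Definition P2t t s := a1 t + b1 t * s.
Definition rho t s := Num.sqrt (P1 t s * P2 t s).
Definition rphi t s := P1 t s + P2 t s + 2 * rho t s.
Definition rphit t s := P1t t s + P2t t s + (P1t t s * P2 t s + P1 t s * P2t t s) / rho t s.
Definition rphis t s := g t + b t + (g t * P2 t s + P1 t s * b t) / rho t s.
Definition rphist t s := g1 t + b1 t +
  (g1 t * P2 t s + g t * P2t t s + P1t t s * b t + P1 t s * b1 t) / rho t s -
  (g t * P2 t s + P1 t s * b t) * (P1t t s * P2 t s + P1 t s * P2t t s) / (2 * rho t s ^+ 3).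
Definition rphiss t s := 2 * g t * b t / rho t s -
  (g t * P2 t s + P1 t s * b t) ^+ 2 / (2 * rho t s ^+ 3).

Lemma had_lin (u u' v v' : R -> R) t s : rd u t (u' t) -> rd v t (v' t) ->
  had (fun t s => u t + v t * s) t s (u' t + v' t * s) (v t).
Proof.
move=> hu hv.
have := hadD (@had_fst _ _ _ s _ hu) (hadM (@had_fst _ _ _ s _ hv) (@had_snd R t s)).
by move=> h; apply: had_eq h _ _; ring.
Qed.

Section At.
Variables (t s : R).
Hypothesis pos : 0 < P1 t s * P2 t s.
Hypotheses (hf : rd f t (f1 t)) (hg : rd g t (g1 t)) (ha : rd a t (a1 t)) (hb : rd b t (b1 t)).

Let rho_gt0 : 0 < rho t s. Proof. by rewrite sqrtr_gt0. Qed.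
Let h1 : had P1 t s (P1t t s) (g t). Proof. exact: had_lin. Qed.
Let h2 : had P2 t s (P2t t s) (b t). Proof. exact: had_lin. Qed.

Lemma had_rho : had rho t s ((P1t t s * P2 t s + P1 t s * P2t t s) / (2 * rho t s))
  ((g t * P2 t s + P1 t s * b t) / (2 * rho t s)).
Proof. exact: (@had_sqrt _ (fun t s => P1 t s * P2 t s) _ _ _ _ pos (hadM h1 h2)). Qed.

Lemma had_cst (c : R) : had (fun _ _ => c) t s 0 0.
Proof. by apply: had_fst; exact: rd_cst. Qed.

Lemma had_rphi : had rphi t s (rphit t s) (rphis t s).
Proof.
have r0 : rho t s != 0 by rewrite gt_eqF.
have h := hadD (hadD h1 h2) (hadM (had_cst 2) had_rho).
by apply: had_eq h _ _; rewrite /rphit /rphis; field.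
Qed.

Lemma had_rphis : had rphis t s (rphist t s) (rphiss t s).
Proof.
have r0 : rho t s != 0 by rewrite gt_eqF.
have kg := @had_fst _ _ _ s _ hg; have kb := @had_fst _ _ _ s _ hb.
have h := hadD (hadD kg kb) (had_div (Psi := rho) r0 (hadD (hadM kg h2) (hadM h1 kb)) had_rho).
by apply: had_eq h _ _; rewrite /rphist /rphiss; field.
Qed.

Hypotheses (h1f : exists c, rd f1 t c) (h1g : exists c, rd g1 t c)
  (h1a : exists c, rd a1 t c) (h1b : exists c, rd b1 t c).

Lemma had_lin' (u v : R -> R) : (exists c, rd u t c) -> (exists c, rd v t c) ->
  exists x y, had (fun t s => u t + v t * s) t s x y.
Proof.
move=> [c hu] [d hv]; do 2!eexists.
exact: hadD (@had_fst _ _ _ s _ hu) (hadM (@had_fst _ _ _ s _ hv) (@had_snd R t s)).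
Qed.

Lemma had_rphit : exists x y, had rphit t s x y.
Proof.
have r0 : rho t s != 0 by rewrite gt_eqF.
have [x1 [y1 k1]] := had_lin' h1f h1g; have [x2 [y2 k2]] := had_lin' h1a h1b.
do 2!eexists; exact: hadD (hadD k1 k2) (had_div (Psi := rho) r0 (hadD (hadM k1 h2) (hadM h1 k2)) had_rho).
Qed.

Lemma had_rphiss : exists x y, had rphiss t s x y.
Proof.
have r0 : rho t s != 0 by rewrite gt_eqF.
have r3 : 2 * (rho t s * (rho t s * rho t s)) != 0 by rewrite !mulf_neq0.
have kg := @had_fst _ _ _ s _ hg; have kb := @had_fst _ _ _ s _ hb.
have c2 := had_cst 2.
have q := hadD (hadM kg h2) (hadM h1 kb).
have h := hadB (had_div (Psi := rho) r0 (hadM (hadM c2 kg) kb) had_rho)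
  (had_div (Psi := fun t s => 2 * (rho t s * (rho t s * rho t s))) r3 (hadM q q) (hadM c2 (hadM had_rho (hadM had_rho had_rho)))).
do 2!eexists; exact: h.
Qed.

Lemma had_rphist : exists x y, had rphist t s x y.
Proof.
have r0 : rho t s != 0 by rewrite gt_eqF.
have r3 : 2 * (rho t s * (rho t s * rho t s)) != 0 by rewrite !mulf_neq0.
have [x1 [y1 k1]] := had_lin' h1f h1g; have [x2 [y2 k2]] := had_lin' h1a h1b.
have kg := @had_fst _ _ _ s _ hg; have kb := @had_fst _ _ _ s _ hb.
have [c1 /(@had_fst _ _ _ s) kg1] := h1g; have [c3 /(@had_fst _ _ _ s) kb1] := h1b.
have c2 := had_cst 2.
have q := hadD (hadM kg h2) (hadM h1 kb).
have q' := hadD (hadM k1 h2) (hadM h1 k2).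
have q'' := hadD (hadD (hadD (hadM kg1 h2) (hadM kg k2)) (hadM k1 kb)) (hadM h1 kb1).
have h := hadB (hadD (hadD kg1 kb1) (had_div (Psi := rho) r0 q'' had_rho))
  (had_div (Psi := fun t s => 2 * (rho t s * (rho t s * rho t s))) r3 (hadM q q') (hadM c2 (hadM had_rho (hadM had_rho had_rho)))).
do 2!eexists; exact: h.
Qed.

End At.
End RootProfile.

(** Weak Kahler condition with the spray coefficient eliminated. *)
Definition kahler_scalar (R : realType) (phi phit phis phist phiss : R -> R -> R) t s : R :=
  s * (t - s) * phiss t s *
    ((phit t s + phis t s) * gam phi phis t s - 2 * phi t s * phis t s) +
  gam phi phis t s * (phi t s + (t - s) * phis t s) *
    (phit t s - phis t s - s * (phist t s + phiss t s)).

Section TypeI.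
Variables (R : realType).

(** With [P2 = h^2 s], [p = sqrt P1] and [w = sqrt s] the scalar equation is
    [p A(s) + w B(s) = 0] up to a nonzero factor, with [A] and [B] polynomial in [s]:
    it splits into parts that are even and odd in [w]. *)
Definition typeI_A (t f f1 g g1 h h1 s : R) : R :=
  - (t - s) * h * f * (f * (2 * h1 * s + h) - 2 * h * (f + 2 * g * s)) +
  t * h * (- 2 * h * (f + g * s) * (f + 2 * g * s) + h * f ^+ 2 +
     s * (2 * h1 * (f + g * s) * f + h * (f * f1 + 2 * g * s * f1 - s * f * g1))) +
  (f + t * g) * s * 2 * (f + g * s) * (f1 - g - h ^+ 2).

Definition typeI_B (t f f1 g g1 h h1 s : R) : R :=
  - (t - s) * h * f * (f * (f1 + g1 * s + g) - 2 * (g + h ^+ 2) * (f + g * s)) +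
  (f + t * g) * (- 2 * h * (f + g * s) * (f + 2 * g * s) + h * f ^+ 2 +
     s * (2 * h1 * (f + g * s) * f + h * (f * f1 + 2 * g * s * f1 - s * f * g1))) +
  t * h * (f + g * s) * 2 * (f + g * s) * (f1 - g - h ^+ 2).

Lemma typeI_field (t g f1 g1 h h1 p w : R) : p != 0 -> w != 0 -> h != 0 ->
  let f := p ^+ 2 - g * w ^+ 2 in let s := w ^+ 2 in
  let rh := h * p * w in let b := h ^+ 2 in let b1 := 2 * h * h1 in
  let P1 := p ^+ 2 in let P2 := h ^+ 2 * w ^+ 2 in
  let P1t := f1 + g1 * s in let P2t := b1 * s in
  let phi := P1 + P2 + 2 * rh in
  let phit := P1t + P2t + (P1t * P2 + P1 * P2t) / rh in
  let phis := g + b + (g * P2 + P1 * b) / rh in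
  let phist := g1 + b1 + (g1 * P2 + g * P2t + P1t * b + P1 * b1) / rh -
     (g * P2 + P1 * b) * (P1t * P2 + P1 * P2t) / (2 * rh ^+ 3) in
  let phiss := 2 * g * b / rh - (g * P2 + P1 * b) ^+ 2 / (2 * rh ^+ 3) in
  let gam := phi - s * phis in
  (s * (t - s) * phiss * ((phit + phis) * gam - 2 * phi * phis) +
   gam * (phi + (t - s) * phis) * (phit - phis - s * (phist + phiss))) * (2 * p ^+ 5 * w ^+ 2) =
  f * (p + h * w) ^+ 2 * (p * typeI_A t f f1 g g1 h h1 s + w * typeI_B t f f1 g g1 h h1 s).
Proof. by move=> p0 w0 h0 /=; rewrite /typeI_A /typeI_B; field; rewrite p0 w0 h0. Qed.
End TypeI.

(** * Expansion in the square root *)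

Section Parity.
Variable R : realType.

Lemma lim_right_eq0 (X : R -> R) (l d : R) : 0 < d -> X w @[w --> 0^'+] --> l ->
  (forall w, 0 < w < d -> X w = 0) -> l = 0.
Proof.
move=> d0 hX h0; have h : X w @[w --> 0^'+] --> (0 : R).
  have hc : (fun=> 0 : R) w @[w --> (0:R)^'+] --> (0 : R) by exact: cvg_cst.
  apply: cvg_trans hc; apply: near_eq_cvg; near=> w; rewrite h0 //.
  by apply/andP; split.
exact: (cvg_unique _ hX h).
Unshelve. all: by end_near. Qed.

Lemma cvg_right_eq (X Y : R -> R) (l l' : R) : X w @[w --> 0^'+] --> l ->
  (forall w, Y w = X w) -> l = l' -> Y w @[w --> 0^'+] --> l'.
Proof. by move=> h E <-; rewrite (_ : Y = X) //; apply/funext. Qed.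

(** Expansion of [p A(w^2) + w B(w^2) = 0] at [w = 0]: the orders [0], [1] and [2] in [w] give
    the three conclusions in turn. *)
Lemma parity_vanish (A B p : R -> R) (a1 b1 p0 d : R) :
  rd A 0 a1 -> rd B 0 b1 -> p w @[w --> 0^'+] --> p0 -> p0 != 0 -> 0 < d ->
  (forall w, 0 < w < d -> p w * A (w ^+ 2) + w * B (w ^+ 2) = 0) ->
  [/\ A 0 = 0, B 0 = 0 & a1 = 0].
Proof.
move=> /is_derive1_caratheodory [gA [EA cA <-]] /is_derive1_caratheodory [gB [EB cB _]].
move=> hp p00 d0 H.
have w0 : w @[w --> (0:R)^'+] --> (0 : R) by apply: cvg_within.
have w2 : (w ^+ 2) @[w --> (0:R)^'+] --> (0 : R).
  by apply: (cvg_right_eq (cvgM w0 w0)) => [w|]; rewrite ?expr2 ?mulr0.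
have lA : gA (w ^+ 2) @[w --> 0^'+] --> gA 0 := cvg_comp _ _ w2 cA.
have lB : gB (w ^+ 2) @[w --> 0^'+] --> gB 0 := cvg_comp _ _ w2 cB.
have {}EA x : A x = A 0 + x * gA x.
  by have := EA x; rewrite subr0 mulrC => <-; ring.
have {}EB x : B x = B 0 + x * gB x.
  by have := EB x; rewrite subr0 mulrC => <-; ring.
have LA : A (w ^+ 2) @[w --> 0^'+] --> A 0.
  by apply: (cvg_right_eq (cvgD (cvg_cst (A 0)) (cvgM w2 lA))) => [w|]; rewrite ?mul0r ?addr0 //.
have LB : B (w ^+ 2) @[w --> 0^'+] --> B 0.
  by apply: (cvg_right_eq (cvgD (cvg_cst (B 0)) (cvgM w2 lB))) => [w|]; rewrite ?mul0r ?addr0 //.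
have A0 : A 0 = 0.
  apply/(mulfI p00); rewrite mulr0.
  apply: (lim_right_eq0 d0 (X := fun w => p w * A (w ^+ 2) + w * B (w ^+ 2))) => //.
  by apply: (cvg_right_eq (cvgD (cvgM hp LA) (cvgM w0 LB))) => //; rewrite mul0r addr0.
have B0 : B 0 = 0.
  apply: (lim_right_eq0 d0 (X := fun w => p w * (w * gA (w ^+ 2)) + B (w ^+ 2))).
    by apply: (cvg_right_eq (cvgD (cvgM hp (cvgM w0 lA)) LB)) => //; rewrite mul0r mulr0 add0r.
  move=> w hw; have /andP[w_gt0 _] := hw.
  apply/(mulfI (lt0r_neq0 w_gt0)); rewrite mulr0 -(H w hw) (EA (w ^+ 2)) A0; ring.
split=> //; apply/(mulfI p00); rewrite mulr0.
apply: (lim_right_eq0 d0 (X := fun w => p w * gA (w ^+ 2) + w * gB (w ^+ 2))).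
  by apply: (cvg_right_eq (cvgD (cvgM hp lA) (cvgM w0 lB))) => //; rewrite mul0r addr0.
move=> w hw; have /andP[w_gt0 _] := hw.
have w2n : w ^+ 2 != 0 by rewrite expf_eq0 /= lt0r_neq0.
by apply/(mulfI w2n); rewrite mulr0 -(H w hw) (EA (w ^+ 2)) (EB (w ^+ 2)) A0 B0; ring.
Unshelve. all: by end_near. Qed.

End Parity.

(** Derivatives of atoms are taken from the context; the nonvanishing of denominators is left
    to the caller. *)
Ltac rd_tac := lazymatch goal with
  | |- rd (fun _ => ?c) _ _ => apply: rd_cst
  | |- rd (fun y => y) _ _ => apply: rd_id
  | |- rd (fun y => @?f y + @?g y) _ _ => apply: (@rdD _ f g); rd_tac
  | |- rd (fun y => - @?f y) _ _ => apply: (@rdN _ f); rd_tac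
  | |- rd (fun y => @?f y * @?g y) _ _ => apply: (@rdM _ f g); rd_tac
  | |- rd (fun y => (@?f y) ^+ 2) _ _ => apply: (@rdX2 _ f); rd_tac
  | |- rd (fun y => (@?f y)^-1) _ _ => apply: (@rdV _ f); [ | rd_tac]
  | |- _ => eassumption
  end.

Section TypeII.
Variables (R : realType).

(** The same splitting for [P2 = h^2 (t - s)], now with [w = sqrt (t - s)];
    [typeII_Y] is the part that occurs in both halves. *)
Definition typeII_Y (t f f1 g g1 h h1 s : R) : R :=
  let P := f + g * s in let DP := f1 + g + g1 * s in
  - 4 * P * (h * g * (t - s) - h * P) + 2 * h1 * P * (t * P + f * (t - s)) +
  h * (DP * (P * (2 * (t - s) + s) + s * (t - s) * g) - 2 * s * (t - s) * P * g1).
Definition typeII_A (t f f1 g g1 h h1 s : R) : R :=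
  let P := f + g * s in let DP := f1 + g + g1 * s in
  - s * h * (f + t * g) * (DP * h * t + 2 * h1 * f * (t - s) - 2 * h * g * (t - s) + 2 * h * P) +
  f * (t - s) * 2 * P * (f1 + g + 2 * h * h1 * t - 2 * (g - h ^+ 2)) +
  h * t * typeII_Y t f f1 g g1 h h1 s.
Definition typeII_B (t f f1 g g1 h h1 s : R) : R :=
  let P := f + g * s in let DP := f1 + g + g1 * s in
  - s * h * (f + t * g) * (DP * f + 2 * h1 * h * t * P - 2 * P * (g - h ^+ 2)) +
  h * t * P * 2 * P * (f1 + g + 2 * h * h1 * t - 2 * (g - h ^+ 2)) +
  f * typeII_Y t f f1 g g1 h h1 s.

Lemma typeII_field (t g f1 g1 h h1 p w : R) : p != 0 -> w != 0 -> h != 0 ->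
  let s := t - w ^+ 2 in let f := p ^+ 2 - g * s in 
  let rh := h * p * w in let b := - h ^+ 2 in let b1 := - (2 * h * h1) in
  let P1 := p ^+ 2 in let P2 := h ^+ 2 * w ^+ 2 in
  let P1t := f1 + g1 * s in let P2t := h ^+ 2 + t * (2 * h * h1) + b1 * s in
  let phi := P1 + P2 + 2 * rh in
  let phit := P1t + P2t + (P1t * P2 + P1 * P2t) / rh in
  let phis := g + b + (g * P2 + P1 * b) / rh in
  let phist := g1 + b1 + (g1 * P2 + g * P2t + P1t * b + P1 * b1) / rh -
     (g * P2 + P1 * b) * (P1t * P2 + P1 * P2t) / (2 * rh ^+ 3) in
  let phiss := 2 * g * b / rh - (g * P2 + P1 * b) ^+ 2 / (2 * rh ^+ 3) in
  let gam := phi - s * phis in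
  (s * (t - s) * phiss * ((phit + phis) * gam - 2 * phi * phis) +
   gam * (phi + (t - s) * phis) * (phit - phis - s * (phist + phiss))) * (2 * p ^+ 5 * w ^+ 2) =
  (f + t * g) * (p + h * w) ^+ 2 * (p * typeII_A t f f1 g g1 h h1 s + w * typeII_B t f f1 g g1 h h1 s).
Proof.
by move=> p0 w0 h0 /=; rewrite /typeII_A /typeII_B /typeII_Y; field; rewrite p0 w0 h0.
Qed.

(** The expansion at [s = t] determines [h'] and [f'] at the radius considered; the remaining
    condition [A' = 0] then reads [f (f + t g)^2 = 0]. *)
Lemma typeII_absurd (t f f1 g g1 h h1 : R) : 0 < t -> 0 < f -> 0 < f + t * g -> 0 < h ->
  (forall w, 0 < w < Num.sqrt t -> let s := t - w ^+ 2 in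
     Num.sqrt (f + g * s) * typeII_A t f f1 g g1 h h1 s + w * typeII_B t f f1 g g1 h h1 s = 0) ->
  False.
Proof.
move=> t0 f0 M0 h0 H.
pose A x := typeII_A t f f1 g g1 h h1 (t - x); pose B x := typeII_B t f f1 g g1 h h1 (t - x).
have [A1 hA] : exists c, rd A 0 c by rewrite /A /typeII_A /typeII_Y; eexists; rd_tac.
have [B1 hB] : exists c, rd B 0 c by rewrite /B /typeII_B /typeII_Y; eexists; rd_tac.
have hp : Num.sqrt (f + g * (t - w ^+ 2)) @[w --> (0 : R)^'+] --> Num.sqrt (f + t * g).
  apply: cvg_at_right_filter.
  have [c hc] : exists c, rd (fun w => f + g * (t - w ^+ 2)) 0 c by eexists; rd_tac.
  have E0 : f + g * (t - 0 ^+ 2) = f + t * g by ring.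
  rewrite -E0; rewrite -E0 in M0.
  exact: (rd_cvg (@rd_sqrt _ (fun w => f + g * (t - w ^+ 2)) _ _ M0 hc)).
have st0 : 0 < Num.sqrt t by rewrite sqrtr_gt0.
have p00 : Num.sqrt (f + t * g) != 0 by rewrite gt_eqF // sqrtr_gt0.
have [A0 B0 A10] := parity_vanish hA hB hp p00 st0 H.
have h1E : h + t * h1 = 0.
  have c0 : 2 * h * t * (f + t * g) ^+ 2 != 0 by rewrite gt_eqF // !mulr_gt0 // exprn_gt0.
  by apply/(mulfI c0); rewrite mulr0 -A0 /A /typeII_A /typeII_Y; ring.
have h1E' : h1 = - h / t.
  apply/(mulfI (lt0r_neq0 t0)); rewrite [RHS]mulrC divfK ?lt0r_neq0 //.
  by apply/eqP; rewrite -subr_eq0 opprK addrC h1E.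
have f1E : f + t * f1 = 0.
  have c0 : 2 * h * (f + t * g) ^+ 2 != 0 by rewrite gt_eqF // !mulr_gt0 // exprn_gt0.
  apply/(mulfI c0); rewrite mulr0 -B0 /B /typeII_B /typeII_Y h1E'; field.
  exact: lt0r_neq0.
have f1E' : f1 = - f / t.
  apply/(mulfI (lt0r_neq0 t0)); rewrite [RHS]mulrC divfK ?lt0r_neq0 //.
  by apply/eqP; rewrite -subr_eq0 opprK addrC f1E.
have : rd A 0 (- 2 * f * (f + t * g) ^+ 2 / t).
  rewrite /A /typeII_A /typeII_Y; apply: rd_eq; first by rd_tac.
  rewrite h1E' f1E'; field; exact: lt0r_neq0.
move=> /(rd_uniq hA); rewrite A10 => E.
have : 0 < 2 * f * (f + t * g) ^+ 2 / t by rewrite !mulr_gt0 ?invr_gt0 ?exprn_gt0.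
have -> : 2 * f * (f + t * g) ^+ 2 / t = - (- 2 * f * (f + t * g) ^+ 2 / t) by ring.
by rewrite -E oppr0 ltxx.
Qed.

(** The expansion at [s = 0] gives both equations; the order [0] is void there. *)
Lemma typeI_ode (t f f1 g g1 h h1 : R) : 0 < t -> 0 < f -> 0 < f + t * g -> 0 < h ->
  (forall w, 0 < w < Num.sqrt t -> let s := w ^+ 2 in
     Num.sqrt (f + g * s) * typeI_A t f f1 g g1 h h1 s + w * typeI_B t f f1 g g1 h h1 s = 0) ->
  t * f1 = f + 2 * t * g /\ f1 = g + h ^+ 2.
Proof.
move=> t0 f0 M0 h0 H.
pose A x := typeI_A t f f1 g g1 h h1 x; pose B x := typeI_B t f f1 g g1 h h1 x.
have [A1 hA] : exists c, rd A 0 c by rewrite /A /typeI_A; eexists; rd_tac.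
have [B1 hB] : exists c, rd B 0 c by rewrite /B /typeI_B; eexists; rd_tac.
have hp : Num.sqrt (f + g * w ^+ 2) @[w --> (0 : R)^'+] --> Num.sqrt f.
  apply: cvg_at_right_filter.
  have [c hc] : exists c, rd (fun w => f + g * w ^+ 2) 0 c by eexists; rd_tac.
  have E0 : f + g * 0 ^+ 2 = f by ring.
  rewrite -[X in _ --> Num.sqrt X]E0; rewrite -E0 in f0.
  exact: (rd_cvg (@rd_sqrt _ (fun w => f + g * w ^+ 2) _ _ f0 hc)).
have st0 : 0 < Num.sqrt t by rewrite sqrtr_gt0.
have p00 : Num.sqrt f != 0 by rewrite gt_eqF // sqrtr_gt0.
have [_ B0 A10] := parity_vanish hA hB hp p00 st0 H.
have E1 : t * f1 - f - 2 * t * g = 0.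
  have c0 : h * f ^+ 2 != 0 by rewrite gt_eqF // !mulr_gt0 // exprn_gt0.
  by apply/(mulfI c0); rewrite mulr0 -B0 /B /typeI_B; ring.
split; first by apply/eqP; rewrite -subr_eq0 -E1; apply/eqP; ring.
have : rd A 0 (f * (h ^+ 2 * (t * f1 - f - 2 * t * g) + 2 * (f + t * g) * (f1 - g - h ^+ 2))).
  rewrite /A /typeI_A; apply: rd_eq; first by rd_tac.
  by rewrite /=; ring.
move=> /(rd_uniq hA); rewrite A10 E1 mulr0 add0r => E.
have nz : f * (2 * (f + t * g)) != 0 by rewrite gt_eqF // !mulr_gt0.
have k0 : f1 - g - h ^+ 2 = 0 by apply/(mulfI nz); rewrite mulr0 E; ring.
by apply/eqP; rewrite -subr_eq0 opprD addrA k0.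
Qed.
End TypeII.

(** * Scalar equations for the profile *)

Section Elimination.
Variables (R : realType) (phi phit phis phist phiss : R -> R -> R) (t s : R).

(** Cramer's rule: the determinant of the system for the spray is [levi_disc]. *)
Lemma spray_system : levi_disc phi phis phiss t s != 0 -> exists A B : R,
  gam phi phis t s * A - s ^+ 2 * (t - s) * phiss t s * B =
    phit t s - s * phist t s - s * phiss t s + phis t s /\
  A * phis t s + B * (gam phi phis t s + t * phis t s + s * (t - s) * phiss t s) =
    phist t s + phiss t s.
Proof.
rewrite /levi_disc /gam; move: (phi t s) (phit t s) (phis t s) (phist t s) (phiss t s).
move=> p pt ps pst pss d0.
pose d := (p - s * ps) * (p + (t - s) * ps) + s * (t - s) * p * pss.
pose x := pt - s * pst - s * pss + ps; pose y := pst + pss.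
exists ((x * (p - s * ps + t * ps + s * (t - s) * pss) + s ^+ 2 * (t - s) * pss * y) / d).
exists (((p - s * ps) * y - ps * x) / d).
by split; rewrite /d /x /y; field.
Qed.

(** The combination of the two equations of the spray that computes [s_t + s_s] of [phi] gives
    [A phi + B s (phi + (t - s) phi_s) = phi_t + phi_s]; with the vanishing defect it yields
    [gam A = 2 phi_s], and then [B] is eliminated. *)
Lemma kahler_scalar_eq0 (A B : R) :
  gam phi phis t s * A - s ^+ 2 * (t - s) * phiss t s * B =
    phit t s - s * phist t s - s * phiss t s + phis t s ->
  A * phis t s + B * (gam phi phis t s + t * phis t s + s * (t - s) * phiss t s) =
    phist t s + phiss t s ->
  phit t s - phis t s - s * (phist t s + (1 - s * B * (t - s)) * phiss t s) = 0 ->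
  kahler_scalar phi phit phis phist phiss t s = 0.
Proof.
rewrite /kahler_scalar /gam; move: (phi t s) (phit t s) (phis t s) (phist t s) (phiss t s).
move=> p pt ps pst pss e1 e2 e3.
have E1 : A * p + B * s * (p + (t - s) * ps) = pt + ps.
  transitivity ((p - s * ps) * A - s ^+ 2 * (t - s) * pss * B +
    s * (A * ps + B * (p - s * ps + t * ps + s * (t - s) * pss))); first by ring.
  by rewrite e1 e2; ring.
have E2 : (p - s * ps) * A = 2 * ps.
  transitivity ((p - s * ps) * A - s ^+ 2 * (t - s) * pss * B + s ^+ 2 * (t - s) * pss * B).
    by ring.
  rewrite e1; transitivity (2 * ps + (pt - ps - s * (pst + (1 - s * B * (t - s)) * pss))).
    by ring.
  by rewrite e3 addr0.
have E3 : pt - ps - s * (pst + pss) = - (s ^+ 2 * B * (t - s) * pss).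
  by apply/eqP; rewrite -subr_eq0 -e3; apply/eqP; ring.
have E4 : (pt + ps) * (p - s * ps) - 2 * p * ps = B * s * (p + (t - s) * ps) * (p - s * ps).
  rewrite -E1; transitivity ((p - s * ps) * A * p + B * s * (p + (t - s) * ps) * (p - s * ps)
     - 2 * p * ps); first by ring.
  by rewrite E2; ring.
by rewrite E3 E4; ring.
Qed.

(** Along solutions of the weakly Kahler equation the derivation [d_t + lam d_s] maps
    [gam] to [phi_s], so the second derivatives of [phi] leave the curvature. *)
Lemma kahler_curvature (lam At As : R) : s != 0 -> gam phi phis t s != 0 ->
  phit t s - phis t s - s * (phist t s + lam * phiss t s) = 0 ->
  let ga := gam phi phis t s in
  At = (2 * phist t s * ga - 2 * phis t s * (phit t s - s * phist t s)) / ga ^+ 2 ->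
  As = (2 * phiss t s * ga - 2 * phis t s * (- s * phiss t s)) / ga ^+ 2 ->
  2 * phis t s / ga + s * (At + lam * As) = 2 * (phit t s / ga - s * phis t s ^+ 2 / ga ^+ 2).
Proof.
move=> s0 g0 e3 ga -> ->; rewrite /ga in g0 *; clear ga.
have E : phist t s = (phit t s - phis t s) / s - lam * phiss t s.
  apply/(mulfI s0); apply/eqP; rewrite -subr_eq0 -oppr_eq0 -{}e3; apply/eqP; field.
  exact: s0.
by rewrite E; field; rewrite s0 g0.
Qed.
End Elimination.

Ltac pos_tac := repeat first [done | assumption | apply: exprn_gt0 | apply: divr_gt0 |
  apply: mulr_gt0 | apply: addr_gt0].

Section TypeI.
Variables (R : realType).
Variables (f f1 g g1 b b1 : R -> R) (t s p w h : R).
Local Notation z0 := (fun=> 0 : R).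
Hypotheses (p2 : p ^+ 2 = f t + g t * s) (w2 : w ^+ 2 = s) (h2 : h ^+ 2 = b t).
Hypotheses (pp : 0 < p) (ww : 0 < w) (hh : 0 < h).

Let p0 := lt0r_neq0 pp.
Let w0 := lt0r_neq0 ww.
Let h0 := lt0r_neq0 hh.
Let ft : f t = p ^+ 2 - g t * w ^+ 2. Proof. by rewrite p2 w2; ring. Qed.

Lemma typeI_P1 : P1 f g t s = p ^+ 2. Proof. by rewrite p2. Qed.

Lemma typeI_P2 : P2 z0 b t s = h ^+ 2 * w ^+ 2.
Proof. by rewrite /P2 add0r h2 w2. Qed.

Lemma typeI_rho : rho f g z0 b t s = h * p * w.
Proof.
rewrite /rho typeI_P1 typeI_P2 -!exprMn sqrtr_sqr gtr0_norm ?mulr_gt0 //; ring.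
Qed.

(** The formula [typeI_field] is a rational identity in free variables; here it is
    instantiated at the values of the profile. *)
Lemma kahler_typeI h1 : b1 t = 2 * h * h1 ->
  kahler_scalar (rphi f g z0 b) (rphit f f1 g g1 z0 z0 b b1) (rphis f g z0 b)
   (rphist f f1 g g1 z0 z0 b b1) (rphiss f g z0 b) t s * (2 * p ^+ 5 * s) =
  f t * (p + h * w) ^+ 2 * (p * typeI_A t (f t) (f1 t) (g t) (g1 t) h h1 s +
    w * typeI_B t (f t) (f1 t) (g t) (g1 t) h h1 s).
Proof.
move=> hb1; have := typeI_field t (g t) (f1 t) (g1 t) h1 p0 w0 h0; rewrite /= -ft => E.
rewrite -[X in _ * (_ * X)]w2 -[in RHS]w2 -{}E.
rewrite /kahler_scalar /gam /rphi /rphit /rphis /rphist /rphiss.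
by rewrite typeI_rho typeI_P2 typeI_P1 /P1t /P2t hb1 -h2 -w2 !add0r.
Qed.

Lemma typeI_phi : rphi f g z0 b t s = (p + h * w) ^+ 2.
Proof. by rewrite /rphi typeI_rho typeI_P2 typeI_P1; ring. Qed.

Lemma typeI_phis : rphis f g z0 b t s = (p + h * w) * (g t * w + h * p) / (p * w).
Proof.
by rewrite /rphis typeI_rho typeI_P2 typeI_P1 -h2; field; rewrite p0 w0 h0.
Qed.

Lemma typeI_phit : rphit f f1 g g1 z0 z0 b b1 t s =
  (p + h * w) * ((f1 t + g1 t * s) / p + b1 t * w / h).
Proof.
rewrite /rphit typeI_rho typeI_P2 typeI_P1 /P1t /P2t -w2; field.
by rewrite p0 w0 h0.
Qed.

Lemma typeI_phiss : rphiss f g z0 b t s = - h * f t ^+ 2 / (2 * p ^+ 3 * w ^+ 3).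
Proof.
rewrite /rphiss typeI_rho typeI_P2 typeI_P1 -h2 ft; field.
by rewrite p0 w0 h0.
Qed.

Lemma typeI_gam : gam (rphi f g z0 b) (rphis f g z0 b) t s = (p + h * w) * f t / p.
Proof.
by rewrite /gam typeI_phi typeI_phis -w2 ft; field; rewrite p0 w0.
Qed.

Lemma typeI_disc : levi_disc (rphi f g z0 b) (rphis f g z0 b) (rphiss f g z0 b) t s =
  (p + h * w) ^+ 2 * f t * (2 * p * (f t + t * g t) * w +
   h * (t * p ^+ 2 + s * (f t + t * g t))) / (2 * p ^+ 3 * w).
Proof.
rewrite /levi_disc typeI_gam typeI_phi typeI_phis typeI_phiss -w2 ft; field.
by rewrite p0 w0.
Qed.

Lemma typeI_gam_gt0 : 0 < f t -> 0 < gam (rphi f g z0 b) (rphis f g z0 b) t s.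
Proof. by move=> f0; rewrite typeI_gam; pos_tac. Qed.

Lemma typeI_disc_gt0 : 0 < t -> 0 < f t -> 0 < f t + t * g t ->
  0 < levi_disc (rphi f g z0 b) (rphis f g z0 b) (rphiss f g z0 b) t s.
Proof.
move=> t0 f0 M0; have s0 : 0 < s by rewrite -w2 exprn_gt0.
by rewrite typeI_disc; pos_tac.
Qed.

(** Under the weakly Kahler equations the spray coefficient [B] is
    [-1/(t s) + y(t)]. *)
Section Ode.
Variable y : R.
Hypotheses (t0 : 0 < t) (f0 : 0 < f t).
Hypotheses (ode1 : f1 t = g t + b t) (ode2 : f t + t * g t = t * b t)
  (ode3 : 2 * g t + t * g1 t = t * b1 t).
Hypothesis hy : y = b1 t / (t * b t) - 4 * g t / (t * f t).

Local Notation phi := (rphi f g z0 b t s).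
Local Notation phit := (rphit f f1 g g1 z0 z0 b b1 t s).
Local Notation phis := (rphis f g z0 b t s).
Local Notation phist := (rphist f f1 g g1 z0 z0 b b1 t s).
Local Notation phiss := (rphiss f g z0 b t s).
Local Notation ga := (gam (rphi f g z0 b) (rphis f g z0 b) t s).

Let k0 : h ^+ 2 - g t != 0.
Proof.
apply: lt0r_neq0; rewrite -(pmulr_rgt0 _ t0) mulrBr h2 -ode2 addrK; exact: f0.
Qed.
(* From here on [t] is eliminated through [ode2], so that the remaining identities are
   rational in [p], [w], [h], [g t] and the first derivatives. *)
Let tE : t = (p ^+ 2 - g t * w ^+ 2) / (h ^+ 2 - g t).
Proof. by apply/(mulIf k0); rewrite divfK // -ft mulrBr h2 -ode2 addrK. Qed.
Let b1E : b1 t = (2 * g t + t * g1 t) / t.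
Proof. by apply/(mulIf (lt0r_neq0 t0)); rewrite divfK ?lt0r_neq0 // mulrC ode3. Qed.
Let phistE : phist = g1 t + b1 t +
  (g1 t * (h ^+ 2 * w ^+ 2) + g t * (b1 t * w ^+ 2) + (f1 t + g1 t * w ^+ 2) * h ^+ 2 +
   p ^+ 2 * b1 t) / (h * p * w) -
  (g t * (h ^+ 2 * w ^+ 2) + p ^+ 2 * h ^+ 2) *
  ((f1 t + g1 t * w ^+ 2) * (h ^+ 2 * w ^+ 2) + p ^+ 2 * (b1 t * w ^+ 2)) /
  (2 * (h * p * w) ^+ 3).
Proof.
by rewrite /rphist typeI_rho typeI_P2 typeI_P1 /P1t /P2t -h2 -w2 !add0r.
Qed.

Lemma typeI_ode_defect : let B := - (t * s)^-1 + y in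
  phit - phis - s * (phist + (1 - s * B * (t - s)) * phiss) = 0.
Proof.
move=> B; rewrite /B hy phistE typeI_phit typeI_phis typeI_phiss.
have fn : p ^+ 2 - g t * w ^+ 2 != 0 by rewrite -ft lt0r_neq0.
rewrite b1E ode1 -w2 -h2 ft.
move: tE k0 fn; move: (g t) => G; move: (g1 t) => G1; move: (t) => T -> k fn.
by field; rewrite p0 w0 h0 k fn.
Qed.
Lemma typeI_ode_eqA : let B := - (t * s)^-1 + y in
  ga * (2 * phis / ga) - s ^+ 2 * (t - s) * phiss * B =
    phit - s * phist - s * phiss + phis.
Proof.
move=> B; have D := typeI_ode_defect; rewrite /= -/B in D.
rewrite mulrC divfK ?lt0r_neq0 ?typeI_gam_gt0 //.
apply/eqP; rewrite -subr_eq0; apply/eqP.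
transitivity (- (phit - phis - s * (phist + (1 - s * B * (t - s)) * phiss))); first by ring.
by rewrite D oppr0.
Qed.

Lemma typeI_ode_eqB : let B := - (t * s)^-1 + y in
  2 * phis / ga * phis + B * (ga + t * phis + s * (t - s) * phiss) = phist + phiss.
Proof.
move=> B; rewrite /B hy phistE typeI_gam typeI_phis typeI_phiss.
have fn : p ^+ 2 - g t * w ^+ 2 != 0 by rewrite -ft lt0r_neq0.
have q0 : p + h * w != 0 by rewrite lt0r_neq0 // addr_gt0 // mulr_gt0.
rewrite b1E ode1 -w2 -h2 ft.
move: tE k0 fn; move: (g t) => G; move: (g1 t) => G1; move: (t) => T -> k fn.
by field; rewrite p0 w0 h0 k fn q0.
Qed.

Lemma typeI_ode_curvature y1 : let B := - (t * s)^-1 + y in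
  let lam := 1 - s * B * (t - s) in
  let Bt := (t ^+ 2 * s)^-1 + y1 in let Bs := (t * s ^+ 2)^-1 in
  - (2 / phi ^+ 2) * (phi * (2 * (phit / ga - s * phis ^+ 2 / ga ^+ 2)) +
     s * (phi + (t - s) * phis) * (2 * B + s * (Bt + lam * Bs))) =
  - (2 / phi) * (2 * (((f1 t + g1 t * s) / f t + b1 t * w * p / (h * f t)) -
        (g t * w + h * p) ^+ 2 / f t ^+ 2) +
     t * h * w / p * (y + s * (y1 + y / t))).
Proof.
move=> B lam Bt Bs.
rewrite /Bt /Bs /lam /B typeI_gam typeI_phi typeI_phis typeI_phit.
have fn : p ^+ 2 - g t * w ^+ 2 != 0 by rewrite -ft lt0r_neq0.
have q0 : p + h * w != 0 by rewrite lt0r_neq0 // addr_gt0 // mulr_gt0.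
rewrite -w2 ft.
move: tE k0 fn; move: (g t) (b1 t) (f1 t) => G BB F1; move: (g1 t) => G1; move: (t) => T -> k fn.
by field; rewrite p0 w0 h0 k fn q0.
Qed.
End Ode.
End TypeI.

Section TypeII.
Variables (R : realType).
Variables (f f1 g g1 a a1 b b1 : R -> R) (t s p w h : R).
Hypotheses (p2 : p ^+ 2 = f t + g t * s) (w2 : w ^+ 2 = t - s).
Hypotheses (ah : a t = t * h ^+ 2) (bh : b t = - h ^+ 2).
Hypotheses (pp : 0 < p) (ww : 0 < w) (hh : 0 < h).

Let p0 := lt0r_neq0 pp.
Let w0 := lt0r_neq0 ww.
Let h0 := lt0r_neq0 hh.
Let sE : s = t - w ^+ 2. Proof. by rewrite w2; ring. Qed.
Let ft : f t = p ^+ 2 - g t * (t - w ^+ 2). Proof. by rewrite p2 w2; ring. Qed.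

Lemma typeII_P1 : P1 f g t s = p ^+ 2. Proof. by rewrite p2. Qed.

Lemma typeII_P2 : P2 a b t s = h ^+ 2 * w ^+ 2.
Proof. by rewrite /P2 ah bh w2; ring. Qed.

Lemma typeII_rho : rho f g a b t s = h * p * w.
Proof.
rewrite /rho typeII_P1 typeII_P2 -!exprMn sqrtr_sqr gtr0_norm ?mulr_gt0 //; ring.
Qed.

Lemma kahler_typeII h1 : a1 t = h ^+ 2 + t * (2 * h * h1) -> b1 t = - (2 * h * h1) ->
  kahler_scalar (rphi f g a b) (rphit f f1 g g1 a a1 b b1) (rphis f g a b)
   (rphist f f1 g g1 a a1 b b1) (rphiss f g a b) t s * (2 * p ^+ 5 * w ^+ 2) =
  (f t + t * g t) * (p + h * w) ^+ 2 * (p * typeII_A t (f t) (f1 t) (g t) (g1 t) h h1 s +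
    w * typeII_B t (f t) (f1 t) (g t) (g1 t) h h1 s).
Proof.
move=> ha hb1; have := typeII_field t (g t) (f1 t) (g1 t) h1 p0 w0 h0.
rewrite /= -ft -sE => <-.
rewrite /kahler_scalar /gam /rphi /rphit /rphis /rphist /rphiss.
by rewrite typeII_rho typeII_P2 typeII_P1 /P1t /P2t hb1 ha bh.
Qed.

Lemma typeII_gam : gam (rphi f g a b) (rphis f g a b) t s =
  (f t * w + h * t * p) * (p + h * w) / (p * w).
Proof.
rewrite /gam /rphi /rphis typeII_rho typeII_P2 typeII_P1 bh sE ft; field.
by rewrite p0 w0 h0.
Qed.

Lemma typeII_disc : levi_disc (rphi f g a b) (rphis f g a b) (rphiss f g a b) t s =
  (p + h * w) ^+ 2 * (f t + t * g t) * (2 * p * (f t * w + h * t * p) -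
    s * h * (f t + t * g t)) / (2 * p ^+ 3 * w).
Proof.
rewrite /levi_disc typeII_gam /rphi /rphis /rphiss typeII_rho typeII_P2 typeII_P1 bh sE ft.
by field; rewrite p0 w0 h0.
Qed.

Lemma typeII_gam_gt0 : 0 < t -> 0 < f t -> 0 < gam (rphi f g a b) (rphis f g a b) t s.
Proof. by move=> t0 f0; rewrite typeII_gam; pos_tac. Qed.

Lemma typeII_disc_gt0 : 0 < t -> 0 < f t -> 0 < f t + t * g t ->
  0 < levi_disc (rphi f g a b) (rphis f g a b) (rphiss f g a b) t s.
Proof.
move=> t0 f0 M0; rewrite typeII_disc.
(* The negative term cancels against a part of [2 t p^2], since [p^2 = f + g s]. *)
have -> : 2 * p * (f t * w + h * t * p) - s * h * (f t + t * g t) =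
  2 * p * f t * w + h * (t * p ^+ 2 + f t * w ^+ 2) by rewrite sE ft; ring.
by pos_tac.
Qed.
End TypeII.

(** * Metrics with a square-root profile *)

Section Lines.
Variables (R : realType) (n : nat).
Local Notation C := R[i].
Local Notation V := 'cV[C]_n.

Lemma normC_rc (x : R) : `|rc x| = rc `|x| :> C.
Proof. by rewrite normc_def /= expr0n addr0 sqrtr_sqr. Qed.

(** Balls of a complex space have complex radii; the radius is real because it is positive. *)
Lemma along_open (D : set V) z : open D -> D z -> along D z.
Proof.
move=> oD Dz e; have : nbhs z D by rewrite nbhsE; exists D.
move=> /nbhs_ballP [x x0 xD].
have xE : x = rc (Re x).
  by apply: complex_eq => //=; have := x0; rewrite /= ltcE => /andP[/eqP].
have r0 : 0 < Re x by have := x0; rewrite /= xE ltcR.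
have eE : `|e| = rc (Re `|e|).
  by apply: complex_eq => //=; exact: ger0_Im.
have e0 : 0 <= Re `|e| by have := normr_ge0 e; rewrite eE lecR.
have q0 : 0 < Re x / (Re `|e| + 1) by rewrite divr_gt0 // ltr_wpDl.
near=> h; apply: xD; rewrite -ball_normE /ball_ /= opprD addrA subrr sub0r normrN.
rewrite normrZ normC_rc eE xE -rmorphM /= ltcR.
have hh : `|h| < Re x / (Re `|e| + 1).
  near: h; apply/nbhs_ballP; exists (Re x / (Re `|e| + 1)) => //= y.
  by rewrite /ball /= sub0r normrN.
rewrite (le_lt_trans (y := `|h| * (Re `|e| + 1))) ?ler_wpM2l ?lerDl //.
by rewrite -ltr_pdivlMr // ltr_wpDl.
Unshelve. all: by end_near. Qed.

Lemma along_gt0 (rr : V -> R) p L M : Wd (fun q => rc (rr q)) p L M -> 0 < rr p ->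
  along (fun q => 0 < rr q) p.
Proof.
move=> h r0 e; have [/rd_cvg] := h e; rewrite /= line0 => k _.
by near=> x; near: x; exact: (cvgr_gt _ k).
Unshelve. all: by end_near. Qed.

Lemma along_near (O : R -> Prop) (rr : V -> R) p L M : Wd (fun q => rc (rr q)) p L M ->
  (\forall x \near rr p, O x) -> along (fun q => O (rr q)) p.
Proof.
move=> h o e; have [/rd_cvg] := h e; rewrite /= line0 => k _.
exact: k.
Qed.

Lemma along_profile_z Phi (z v : V) x y : v != 0 -> had Phi (sqnorm z) (s_var z v) x y ->
  0 < Phi (sqnorm z) (s_var z v) -> along (fun z => 0 < Phi (sqnorm z) (s_var z v)) z.
Proof. by move=> v0 h; apply: along_gt0; exact: Wd_profile_z h. Qed.

Lemma along_profile_v Phi (z v : V) x y : v != 0 -> had Phi (sqnorm z) (s_var z v) x y ->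
  0 < Phi (sqnorm z) (s_var z v) -> along (fun v => 0 < Phi (sqnorm z) (s_var z v)) v.
Proof. by move=> v0 h; apply: along_gt0; exact: (Wd_profile_v v0 h). Qed.

End Lines.

Lemma eq_diff0 (M : zmodType) (x y k : M) : x - y = k -> x = y -> k = 0.
Proof. by move=> <- ->; rewrite subrr. Qed.

Definition jet2 (R : realType) (f f1 : R -> R) (t : R) : Prop :=
  rd f t (f1 t) /\ exists c, rd f1 t c.

Section RootMetric.
Variables (R : realType) (n : nat).
Local Notation C := R[i].
Local Notation V := 'cV[C]_n.
Variables (D : set V) (F : V -> V -> R) (O : R -> Prop).
Variables (f f1 g g1 a a1 b b1 : R -> R).

Local Notation phi := (rphi f g a b).
Local Notation phit := (rphit f f1 g g1 a a1 b b1).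
Local Notation phis := (rphis f g a b).
Local Notation phist := (rphist f f1 g g1 a a1 b b1).
Local Notation phiss := (rphiss f g a b).

(** The set where the profile is smooth and the Levi matrix is invertible, stated by open
    conditions so that it is stable along lines. *)
Definition root_dom (z v : V) : Prop :=
  [/\ D z /\ v != 0, O (sqnorm z),
      0 < P1 f g (sqnorm z) (s_var z v) /\ 0 < P2 a b (sqnorm z) (s_var z v),
      0 < gam phi phis (sqnorm z) (s_var z v) &
      0 < levi_disc phi phis phiss (sqnorm z) (s_var z v)].

Hypothesis oD : open D.
Hypothesis oO : forall t, O t -> \forall x \near t, O x.
Hypothesis jets : forall t, O t -> [/\ jet2 f f1 t, jet2 g g1 t, jet2 a a1 t & jet2 b b1 t].
Hypothesis FE : forall z v, D z -> v != 0 -> O (sqnorm z) ->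
  0 < P1 f g (sqnorm z) (s_var z v) -> 0 < P2 a b (sqnorm z) (s_var z v) ->
  F z v ^+ 2 = sqnorm v * phi (sqnorm z) (s_var z v).

Lemma root_hads z v : root_dom z v -> let t := sqnorm z in let s := s_var z v in
  [/\ had (P1 f g) t s (P1t f1 g1 t s) (g t) /\ had (P2 a b) t s (P2t a1 b1 t s) (b t),
      had phi t s (phit t s) (phis t s),
      had phis t s (phist t s) (phiss t s) &
      [/\ exists x y, had phit t s x y, exists x y, had phist t s x y &
       exists x y, had phiss t s x y]].
Proof.
move=> [_ o [p1 p2] _ _] t s; have [[hf kf] [hg kg] [ha ka] [hb kb]] := jets o.
have pos : 0 < P1 f g t s * P2 a b t s by rewrite mulr_gt0.
split.
- by split; exact: had_lin.
- exact: had_rphi.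
- exact: had_rphis.
- by split; [exact: had_rphit | exact: had_rphist | exact: (had_rphiss pos hf hg ha hb)].
Qed.

Lemma root_had_gam z v : root_dom z v -> 
  (exists x y, had (gam phi phis) (sqnorm z) (s_var z v) x y) /\
  (exists x y, had (levi_disc phi phis phiss) (sqnorm z) (s_var z v) x y).
Proof.
move=> /root_hads [_ h1 h2 [_ _ [x [y h3]]]].
have hs := @had_snd R (sqnorm z) (s_var z v).
have ht : had (fun t _ => t) (sqnorm z) (s_var z v) 1 0 by apply: had_fst; exact: rd_id.
have hg := hadB h1 (hadM hs h2); have hts := hadB ht hs.
split; do 2!eexists; first exact: hg.
exact: hadD (hadM hg (hadD h1 (hadM hts h2))) (hadM (hadM (hadM hs hts) h1) h3).
Qed.

Lemma root_profile : profile F phi phit phis phist phiss root_dom.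
Proof.
split=> z v rd.
- have [[hP1 hP2] _ _ _] := root_hads rd; have [[x1 [y1 hg]] [x2 [y2 hd]]] := root_had_gam rd.
  have [[Dz v0] o [p1 p2] g0 d0] := rd.
  have A1 := along_open oD Dz; have A2 := along_near (Wd_sqnorm z) (oO o).
  have A3 := along_profile_z v0 hP1 p1; have A4 := along_profile_z v0 hP2 p2.
  have A5 := along_profile_z v0 hg g0; have A6 := along_profile_z v0 hd d0.
  move=> e; near=> h; split; [split=> // | | split | | ]; near: h;
  [exact: A1 | exact: A2 | exact: A3 | exact: A4 | exact: A5 | exact: A6].
- have [[hP1 hP2] _ _ _] := root_hads rd; have [[x1 [y1 hg]] [x2 [y2 hd]]] := root_had_gam rd.
  have [[Dz v0] o [p1 p2] g0 d0] := rd.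
  have A1 := along_neq0 v0.
  have A3 := along_profile_v v0 hP1 p1; have A4 := along_profile_v v0 hP2 p2.
  have A5 := along_profile_v v0 hg g0; have A6 := along_profile_v v0 hd d0.
  move=> e; near=> h; split; [split=> // | exact: o | split | | ]; near: h;
  [exact: A1 | exact: A3 | exact: A4 | exact: A5 | exact: A6].
- by have [[]] := rd.
- by have [[Dz v0] o [p1 p2] _ _] := rd; rewrite /sq_metric FE.
- by have [] := root_hads rd.
- by have [] := root_hads rd.
- by have [_ _ _ []] := root_hads rd.
- by have [_ _ _ []] := root_hads rd.
- by have [_ _ _ []] := root_hads rd.
- by have [_ _ _ g0 _] := rd; exact: lt0r_neq0.
- by have [_ _ _ _ d0] := rd; exact: lt0r_neq0.
Unshelve. all: by end_near. Qed.

(** A single vector [v], not proportional to [z] in the sense of the second hypothesis, turns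
    the weakly Kahler condition into an equation for the profile at [(t, s)]. *)
Lemma weakly_kahler_scalar z v : root_dom z v ->
  (exists i, (herm z v)^* * (v i 0)^* - rc (sqnorm v) * (z i 0)^* != 0) ->
  (forall i : 'I_n,
    \sum_(j < n) \sum_(c < n) G_v F j z v * Gamma F j i c z v * v c 0 =
    \sum_(j < n) \sum_(c < n) G_v F j z v * Gamma F j c i z v * v c 0) ->
  kahler_scalar phi phit phis phist phiss (sqnorm z) (s_var z v) = 0.
Proof.
move=> rd [i iP] wk; have d0 := prof_disc root_profile rd.
have [A [B [e1 e2]]] := spray_system phit phist d0.
apply: (kahler_scalar_eq0 e1 e2).
have /eqP := eq_diff0 (weakly_kahler_at root_profile rd e1 e2 i) (wk i).
by rewrite mulf_eq0 (negbTE iP) orbF fmorph_eq0 => /eqP.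
Qed.

End RootMetric.

(** * Curvature in type I *)

Section CauchySchwarz.
Variables (R : realType) (n : nat).
Local Notation V := 'cV[R[i]]_n.

Lemma herm_neq0 (z v : V) : herm z v != 0 -> v != 0.
Proof.
apply: contra => /eqP ->; rewrite /herm big1 // => i _.
by rewrite mxE rmorph0 mulr0.
Qed.

Lemma s_var_gt0 (z v : V) : herm z v != 0 -> 0 < s_var z v.
Proof.
move=> w0; rewrite /s_var divr_gt0 ?exprn_gt0 ?normc_gt0 //.
by rewrite sqnorm_gt0; exact: herm_neq0 w0.
Qed.

Lemma s_var_ge0 (z v : V) : 0 <= s_var z v.
Proof. by rewrite /s_var divr_ge0 ?exprn_ge0 ?normc_ge0 ?sqnorm_ge0. Qed.

(** The squared length of [sigma] is [s (t - s) / r]. *)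
Lemma s_var_le (z v : V) : v != 0 -> s_var z v <= sqnorm z.
Proof.
move=> v0; have := s_var_ge0 z v; rewrite le_eqVlt => /orP[/eqP <-|s0].
  exact: sqnorm_ge0.
have r0 : 0 < sqnorm v by rewrite sqnorm_gt0.
have := sigma_sigma z v0.
have -> : \sum_i (sigma z v i)^* * sigma z v i = rc (\sum_i Normc.normc (sigma z v i) ^+ 2).
  by rewrite rmorph_sum; apply: eq_bigr => i _; rewrite /= normc2 mulrC.
rewrite -fmorph_div => /complexI E.
have : 0 <= s_var z v * (sqnorm z - s_var z v) / sqnorm v.
  by rewrite -E; apply: sumr_ge0 => i _; exact: sqr_ge0.
by rewrite pmulr_lge0 ?invr_gt0 // pmulr_rge0 // subr_ge0.
Qed.
End CauchySchwarz.

Section TypeIMetric.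
Variables (R : realType) (n : nat).
Local Notation C := R[i].
Local Notation V := 'cV[C]_n.
Variables (D : set V) (F : V -> V -> R) (O : R -> Prop).
Variables (f f1 g g1 b b1 : R -> R).
Local Notation z0 := (fun=> 0 : R).
Local Notation phi := (rphi f g z0 b).
Local Notation phit := (rphit f f1 g g1 z0 z0 b b1).
Local Notation phis := (rphis f g z0 b).
Local Notation phist := (rphist f f1 g g1 z0 z0 b b1).
Local Notation phiss := (rphiss f g z0 b).

Hypothesis oD : open D.
Hypothesis oO : forall t, O t -> \forall x \near t, O x.
Hypothesis jets : forall t, O t -> [/\ jet2 f f1 t, jet2 g g1 t & jet2 b b1 t].
Hypothesis FE : forall z v, D z -> v != 0 -> O (sqnorm z) -> 0 < s_var z v ->
  F z v ^+ 2 = sqnorm v * phi (sqnorm z) (s_var z v).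
Hypothesis pos : forall t, O t -> [/\ 0 < t, 0 < f t, 0 < f t + t * g t & 0 < b t].

Local Notation Om := (root_dom D O f g z0 b).

Lemma root_jets t : O t -> [/\ jet2 f f1 t, jet2 g g1 t, jet2 z0 z0 t & jet2 b b1 t].
Proof.
move=> /jets [hf hg hb]; split=> //.
by split; [exact: rd_cst | exists 0; exact: rd_cst].
Qed.

Lemma typeI_FE z v : D z -> v != 0 -> O (sqnorm z) ->
  0 < P1 f g (sqnorm z) (s_var z v) -> 0 < P2 z0 b (sqnorm z) (s_var z v) ->
  F z v ^+ 2 = sqnorm v * phi (sqnorm z) (s_var z v).
Proof.
move=> Dz v0 o _ p2; apply: FE => //; have [_ _ _ b0] := pos o.
by move: p2; rewrite /P2 add0r pmulr_rgt0.
Qed.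

Let P : profile F phi phit phis phist phiss Om :=
  root_profile oD oO root_jets typeI_FE.

Definition typeI_p (z v : V) := Num.sqrt (f (sqnorm z) + g (sqnorm z) * s_var z v).
Definition typeI_w (z v : V) := Num.sqrt (s_var z v).
Definition typeI_h (z : V) := Num.sqrt (b (sqnorm z)).

(** Since [0 <= s <= t], the affine function [f + g s] lies between [f] and [f + t g]. *)
Lemma typeI_roots z v : O (sqnorm z) -> herm z v != 0 ->
  [/\ 0 < typeI_p z v, 0 < typeI_w z v, 0 < typeI_h z &
   [/\ typeI_p z v ^+ 2 = f (sqnorm z) + g (sqnorm z) * s_var z v,
     typeI_w z v ^+ 2 = s_var z v & typeI_h z ^+ 2 = b (sqnorm z)]].
Proof.
move=> o w0; have [t0 f0 M0 b0] := pos o; have s0 := s_var_gt0 w0.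
have st := s_var_le z (herm_neq0 w0).
have p0 : 0 < f (sqnorm z) + g (sqnorm z) * s_var z v.
  rewrite -(pmulr_rgt0 _ t0).
  have -> : sqnorm z * (f (sqnorm z) + g (sqnorm z) * s_var z v) =
    (sqnorm z - s_var z v) * f (sqnorm z) + s_var z v * (f (sqnorm z) + sqnorm z * g (sqnorm z)).
    by ring.
  by apply: ltr_wpDl; [rewrite mulr_ge0 ?subr_ge0 // ltW | exact: mulr_gt0].
by rewrite !sqrtr_gt0 !sqr_sqrtr ?ltW.
Qed.

Lemma typeI_dom z v : D z -> O (sqnorm z) -> herm z v != 0 -> Om z v.
Proof.
move=> Dz o w0; have [pp ww hh [p2 w2 h2]] := typeI_roots o w0.
have [t0 f0 M0 b0] := pos o; split => //.
- by split=> //; exact: herm_neq0 w0.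
- split; first by rewrite /P1 -p2 exprn_gt0.
  by rewrite (typeI_P2 w2 h2) mulr_gt0 // exprn_gt0.
- exact: (typeI_gam_gt0 p2 w2 h2).
- exact: (typeI_disc_gt0 p2 w2 h2).
Qed.

Section Ode.
Hypothesis ode1 : forall t, O t -> f1 t = g t + b t.
Hypothesis ode2 : forall t, O t -> f t + t * g t = t * b t.
Hypothesis ode3 : forall t, O t -> 2 * g t + t * g1 t = t * b1 t.

(** The nonsingular part of the spray coefficient [B]. It vanishes for the model metrics. *)
Definition typeI_y t := b1 t / (t * b t) - 4 * g t / (t * f t).
(* Forced by the weakly Kahler equation, see the proof of [kahler_scalar_eq0]. *)
Let A t s := 2 * phis t s / gam phi phis t s.
Let B t s := - (t * s)^-1 + typeI_y t.

Lemma Om_herm z v : Om z v -> herm z v != 0.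
Proof.
move=> [[_ v0] o [_ p2] _ _]; have [t0 f0 M0 b0] := pos o.
have : 0 < s_var z v by move: p2; rewrite /P2 add0r pmulr_rgt0.
apply: contraTneq => w0.
by rewrite /s_var w0 Normc.normc0 expr0n mul0r ltxx.
Qed.

Lemma typeI_eqA z v : Om z v -> let t := sqnorm z in let s := s_var z v in
  gam phi phis t s * A t s - s ^+ 2 * (t - s) * phiss t s * B t s =
    phit t s - s * phist t s - s * phiss t s + phis t s.
Proof.
move=> om t s; have o : O t by case: om.
have [pp ww hh [p2 w2 h2]] := typeI_roots o (Om_herm om); have [t0 f0 M0 b0] := pos o.
exact: (typeI_ode_eqA p2 w2 h2 pp ww hh t0 f0 (ode1 o) (ode2 o) (ode3 o)).
Qed.

Lemma typeI_eqB z v : Om z v -> let t := sqnorm z in let s := s_var z v in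
  A t s * phis t s + B t s * (gam phi phis t s + t * phis t s + s * (t - s) * phiss t s) =
    phist t s + phiss t s.
Proof.
move=> om t s; have o : O t by case: om.
have [pp ww hh [p2 w2 h2]] := typeI_roots o (Om_herm om); have [t0 f0 M0 b0] := pos o.
exact: (typeI_ode_eqB p2 w2 h2 pp ww hh t0 f0 (ode1 o) (ode2 o) (ode3 o)).
Qed.

Lemma typeI_defect z v : Om z v -> let t := sqnorm z in let s := s_var z v in
  phit t s - phis t s - s * (phist t s + (1 - s * B t s * (t - s)) * phiss t s) = 0.
Proof.
move=> om t s; have o : O t by case: om.
have [pp ww hh [p2 w2 h2]] := typeI_roots o (Om_herm om); have [t0 f0 M0 b0] := pos o.
exact: (typeI_ode_defect p2 w2 h2 pp ww hh t0 f0 (ode1 o) (ode2 o) (ode3 o)).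
Qed.

(** The three equations of the section make the defect vanish, by a rational identity. *)
Lemma typeI_weakly_kahler z v : D z -> O (sqnorm z) -> herm z v != 0 -> forall i : 'I_n,
    \sum_(j < n) \sum_(c < n) G_v F j z v * Gamma F j i c z v * v c 0 =
    \sum_(j < n) \sum_(c < n) G_v F j z v * Gamma F j c i z v * v c 0.
Proof.
move=> Dz o w0 i; have om := typeI_dom Dz o w0.
apply: subr0_eq.
apply: (etrans (weakly_kahler_at P om (typeI_eqA om) (typeI_eqB om) i)).
by rewrite /kahler_defect (typeI_defect om) rmorph0 mul0r.
Qed.

Lemma rd_typeI_y t : O t -> exists c, rd typeI_y t c.
Proof.
move=> o; have [[hf _] [hg _] [hb [c hb1]]] := jets o; have [t0 f0 M0 b0] := pos o.
rewrite /typeI_y; eexists; rd_tac; by rewrite mulf_neq0 // lt0r_neq0.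
Qed.

Lemma typeI_hol_curvature z v y1 : D z -> O (sqnorm z) -> herm z v != 0 ->
  rd typeI_y (sqnorm z) y1 -> let t := sqnorm z in let s := s_var z v in
  let p := typeI_p z v in let w := typeI_w z v in let h := typeI_h z in
  hol_curvature F z v = rc (- (2 / (p + h * w) ^+ 2) *
    (2 * (((f1 t + g1 t * s) / f t + b1 t * w * p / (h * f t)) -
        (g t * w + h * p) ^+ 2 / f t ^+ 2) +
     t * h * w / p * (typeI_y t + s * (y1 + typeI_y t / t)))).
Proof.
move=> Dz o w0 hy t s p w h; have om := typeI_dom Dz o w0.
have [pp ww hh [p2 w2 h2]] := typeI_roots o w0; have [t0 f0 M0 b0] := pos o.
have s0 : s != 0 by rewrite lt0r_neq0 // s_var_gt0.
have t0' : t != 0 by rewrite lt0r_neq0.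
have g0 := prof_gam P om.
have phi0 : phi t s != 0.
  by rewrite (typeI_phi p2 w2 h2) // lt0r_neq0 // exprn_gt0 // addr_gt0 // mulr_gt0.
have hts := hadM (@had_fst _ _ _ s _ (rd_id t)) (@had_snd R t s).
have one : had (fun _ _ : R => 1 : R) t s 0 0 := @had_fst _ _ _ s _ (rd_cst 1 t).
have two : had (fun _ _ : R => 2 : R) t s 0 0 := @had_fst _ _ _ s _ (rd_cst 2 t).
have hB : had B t s ((t ^+ 2 * s)^-1 + y1) (t * s ^+ 2)^-1.
  have ts0 : (fun t s : R => t * s) t s != 0 by rewrite mulf_neq0.
  have k := hadD (hadB (@had_fst _ _ _ s _ (rd_cst 0 t)) (had_div ts0 one hts))
    (@had_fst _ _ _ s _ hy).
  apply: (@had_ext _ (fun t s => 0 - 1 / (t * s) + typeI_y t)).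
    by move=> x y; rewrite /B sub0r mul1r.
  by apply: had_eq k _ _; field; rewrite t0' s0.
have hA := had_div g0 (hadM two (prof_hads P om)) (had_gam P om).
rewrite (hol_curvatureE P typeI_eqA typeI_eqB om phi0 hA hB) -/t -/s.
congr (rc _).
transitivity (- (2 / phi t s ^+ 2) * (phi t s *
    (2 * (phit t s / gam phi phis t s - s * phis t s ^+ 2 / gam phi phis t s ^+ 2)) +
     s * (phi t s + (t - s) * phis t s) * (2 * B t s + s * ((t ^+ 2 * s)^-1 + y1 +
     (1 - s * B t s * (t - s)) * (t * s ^+ 2)^-1)))).
  congr (_ * (_ * _ + _)).
  have := kahler_curvature s0 g0 (typeI_defect om) erefl erefl.
  rewrite /= -/t -/s => <-; rewrite /A; congr (_ + _ * (_ + _ * _)); congr (_ / _); ring.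
rewrite (typeI_ode_curvature f1 g1 b1 p2 w2 h2 pp ww hh (typeI_y t) t0 f0 (ode2 o) y1).
by rewrite (typeI_phi p2 w2 h2).
Qed.

End Ode.
End TypeIMetric.

(** * The model metrics satisfy both conditions *)

Section AbsNotDerivable.
Variable R : realType.

(** A derivative at [0] would be zero by evenness, and one from the right. *)
Lemma abs_not_rd (l : R) : ~ rd (fun x : R => `|x|) 0 l.
Proof.
move=> h; have l0 : l = 0.
  have h' : rd (fun x : R => - x) 0 (-1) by apply: rdN; exact: rd_id.
  have h0 : rd (fun x : R => `|x|) (- 0) l by rewrite oppr0.
  have := rd_comp h0 h'; rewrite (_ : (fun _ => _) = (fun x : R => `|x|)).
    by move=> /(rd_uniq h) E; lra.
  by apply/funext => x; rewrite normrN.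
have /is_derive1_caratheodory [gg [E cg gl]] := h.
have : gg 0 - 1 = 0.
  apply: (lim_right_eq0 (ltr01) (X := fun w => gg w - 1)).
    apply: cvgB; last exact: cvg_cst.
    exact: cvg_at_right_filter.
  move=> w /andP[w0 _]; have := E w; rewrite normr0 !subr0 gtr0_norm // => /esym e.
  apply/eqP; rewrite subr_eq0; apply/eqP/(mulIf (lt0r_neq0 w0)).
  by rewrite e mul1r.
by rewrite gl l0 sub0r => /eqP; rewrite oppr_eq0 oner_eq0.
Qed.
End AbsNotDerivable.

Section SlitDirection.
Variables (R : realType) (n : nat).
Local Notation C := R[i].
Local Notation V := 'cV[C]_n.

Lemma WD_hform (a : 'M[C]_n) (v : V) : WD (hform a) v.
Proof.
apply: WD_sum => i; apply: WD_sum => j; apply: WDM; first apply: WDM.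
- exact: WD_cst.
- exact: WD_coord.
- by apply: WD_conj; exact: WD_coord.
Qed.

Lemma WD_pairing (b : V -> 'rV[C]_n) (z v : V) : WD (pairing b z) v.
Proof. by apply: WD_sum => i; apply: WDM; [exact: WD_cst | exact: WD_coord]. Qed.

Lemma herm_line (z v : V) (x : R) : herm z v = 0 ->
  herm z (v + rc x *: z) = rc (x * sqnorm z).
Proof.
move=> w0; transitivity (herm z v + rc x * \sum_i z i 0 * (z i 0)^*).
  rewrite mulr_sumr /herm -big_split; apply: eq_bigr => i _ /=.
  by rewrite !mxE rmorphD rmorphM /= conj_rc; ring.
by rewrite w0 add0r sum_zzb rmorphM.
Qed.

Lemma sqnorm_line (z v : V) (x : R) : herm z v = 0 ->
  sqnorm (v + rc x *: z) = sqnorm v + x ^+ 2 * sqnorm z.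
Proof.
move=> w0; apply: (@complexI R); rewrite rmorphD rmorphM rmorphXn /= -!sum_zzb.
have w0' : \sum_i v i 0 * (z i 0)^* = 0 by rewrite sum_vzb w0 rmorph0.
transitivity (\sum_i v i 0 * (v i 0)^* + rc x ^+ 2 * \sum_i z i 0 * (z i 0)^* +
   rc x * (\sum_i v i 0 * (z i 0)^*) + rc x * (\sum_i z i 0 * (v i 0)^*)).
  rewrite !mulr_sumr -!big_split; apply: eq_bigr => i _ /=.
  by rewrite !mxE rmorphD rmorphM /= conj_rc; ring.
by rewrite w0' -/(herm z v) w0 !mulr0 !addr0.
Qed.

(** Across [z^perp] the right-hand side has a corner whereas [alpha + |beta|] is smooth
    off [beta = 0]; hence [beta] vanishes on [z^perp]. *)
Lemma slit_herm (D : set V) a b F (z v : V) (ft gt bt : R) :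
  randers D a b F -> D z -> z != 0 -> 0 < ft -> 0 < bt ->
  (forall v, v != 0 -> F z v ^+ 2 = sqnorm v *
    (Num.sqrt (ft + gt * s_var z v) + Num.sqrt (bt * s_var z v)) ^+ 2) ->
  pairing b z v != 0 -> herm z v != 0.
Proof.
move=> [[_ F0 _ _] [_ ha] _ FE] Dz z0 f0 b0 E bv; apply/eqP => w0.
have v0 : v != 0.
  apply: contra bv => /eqP ->; rewrite /pairing big1 // => i _.
  by rewrite mxE mulr0.
have t0 : 0 < sqnorm z by rewrite sqnorm_gt0.
have r0 : 0 < sqnorm v by rewrite sqnorm_gt0.
pose X x := Num.sqrt (ft * (sqnorm v + x ^+ 2 * sqnorm z) + gt * (x * sqnorm z) ^+ 2).
have FX x : F z (v + rc x *: z) = X x + Num.sqrt bt * sqnorm z * `|x|.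
  have rx : 0 < sqnorm (v + rc x *: z).
    by rewrite sqnorm_line // ltr_wpDr // mulr_ge0 ?sqr_ge0 // ltW.
  have x0 : v + rc x *: z != 0 by rewrite -sqnorm_gt0.
  have q : 0 <= X x + Num.sqrt bt * sqnorm z * `|x|.
    by rewrite addr_ge0 ?sqrtr_ge0 // !mulr_ge0 ?sqrtr_ge0 // ltW.
  apply/eqP; rewrite -(eqrXn2 (n := 2)) ?F0 // E //; apply/eqP.
  rewrite -{1}(sqr_sqrtr (ltW rx)) -exprMn; congr (_ ^+ 2).
  have rs : sqnorm (v + rc x *: z) * s_var z (v + rc x *: z) = (x * sqnorm z) ^+ 2.
    rewrite /s_var mulrC divfK ?lt0r_neq0 // herm_line // normc_rc.
    by rewrite real_normK // num_real.
  rewrite mulrDr; congr (_ + _).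
    rewrite -sqrtrM ?ltW // mulrDr mulrCA rs [_ * ft]mulrC /X.
    by rewrite sqnorm_line.
  rewrite -sqrtrM ?ltW // mulrCA rs sqrtrM ?ltW // sqrtr_sqr normrM.
  by rewrite (gtr0_norm t0); ring.
have [L1 [M1 /(_ z) [hh _]]] := WD_hform (a z) v.
have [L2 [M2 /(_ z) [hp1 hp2]]] := WD_pairing b z v.
have hv : 0 < Re (hform (a z) (v + rc 0 *: z)).
  by rewrite line0; have [_ h] := ha _ Dz; exact: h.
have nv : 0 < Re (pairing b z (v + rc 0 *: z)) ^+ 2 + Im (pairing b z (v + rc 0 *: z)) ^+ 2.
  by rewrite line0 -normc2E exprn_gt0 // normc_gt0.
have d1 := rd_sqrt hv hh.
have d2 := rd_sqrt (f := fun x => Re (pairing b z (v + rc x *: z)) ^+ 2 +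
  Im (pairing b z (v + rc x *: z)) ^+ 2) nv (rdD (rdX2 hp1) (rdX2 hp2)).
have Xv : 0 < ft * (sqnorm v + 0 ^+ 2 * sqnorm z) + gt * (0 * sqnorm z) ^+ 2.
  by rewrite mul0r expr0n /= !(mul0r, mulr0) !addr0 mulr_gt0.
have [c d3] : exists c, rd X 0 c.
  eexists; apply: (@rd_sqrt _ (fun x => ft * (sqnorm v + x ^+ 2 * sqnorm z) +
    gt * (x * sqnorm z) ^+ 2)) => //; rd_tac.
have d4 := rdM (rdB (rdD d1 d2) d3) (rd_cst (Num.sqrt bt * sqnorm z)^-1 0).
apply: (@abs_not_rd R); apply: (rd_near _ d4).
near=> x; rewrite -normc2E sqrtr_sqr ger0_norm ?normc_ge0 //.
rewrite -FE // FX addrC addKr mulrC mulKf // mulf_neq0 ?lt0r_neq0 //.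
by rewrite sqrtr_gt0.
Unshelve. all: by end_near. Qed.
End SlitDirection.

Section Model.
Variables (R : realType) (C0 k : R).

(** The solutions of [f' = g + b], [f + t g = t b] and [g = - k f^2 / 4]: the quantity
    [t^2 b / f^2] is a first integral, of value [C0], and [f = t / model_E]. The functions with
    suffix [1] are the derivatives, written through these equations. *)
Definition model_E t : R := C0 + k / 4 * t ^+ 2.
Definition model_f t : R := t / model_E t.
Definition model_g t : R := - (k / 4) * model_f t ^+ 2.
Definition model_b t : R := C0 / model_E t ^+ 2.
Definition model_f1 t : R := model_g t + model_b t.
Definition model_g1 t : R := - (k / 2) * (model_f t * model_f1 t).
Definition model_b1 t : R := - k * (model_f t * model_b t).

Lemma rd_model_E t : rd model_E t (k / 2 * t).
Proof. by rewrite /model_E; apply: rd_eq; [rd_tac | rewrite /=; field]. Qed.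

Section At.
Variable t : R.
Hypothesis E0 : model_E t != 0.

(* Eliminates [C0], so that [model_E t] is a free variable in the identities below. *)
Let cE : C0 = model_E t - k / 4 * t ^+ 2. Proof. by rewrite /model_E; ring. Qed.

Lemma rd_model_f : rd model_f t (model_f1 t).
Proof.
apply: rd_eq (rd_div E0 (rd_id t) (rd_model_E t)) _.
rewrite /model_f1 /model_g /model_b /model_f.
by move: E0 cE; move: (model_E t) => E e0 ->; field.
Qed.

Lemma rd_model_b : rd model_b t (model_b1 t).
Proof.
have E2 : model_E t ^+ 2 != 0 by rewrite expf_neq0.
apply: rd_eq (rd_div (g := fun t => model_E t ^+ 2) E2 (rd_cst C0 t) (rdX2 (rd_model_E t))) _.
by rewrite /model_b1 /model_f /model_b; field.
Qed.

Lemma rd_model_g : rd model_g t (model_g1 t).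
Proof.
apply: rd_eq (rdM (rd_cst (- (k / 4)) t) (rdX2 rd_model_f)) _.
by rewrite /model_g1; field.
Qed.

Lemma model_jets :
  [/\ jet2 model_f model_f1 t, jet2 model_g model_g1 t & jet2 model_b model_b1 t].
Proof.
have hf := rd_model_f; have hg := rd_model_g; have hb := rd_model_b.
have hf1 := rdD hg hb.
split; split=> //; eexists; first exact: hf1.
  exact: rdM (rd_cst _ _) (rdM hf hf1).
exact: rdM (rd_cst _ _) (rdM hf hb).
Qed.

Lemma model_ode2 : model_f t + t * model_g t = t * model_b t.
Proof.
rewrite /model_g /model_b /model_f.
by move: E0 cE; move: (model_E t) => E e0 ->; field.
Qed.

Lemma model_ode3 : 2 * model_g t + t * model_g1 t = t * model_b1 t.
Proof.
have -> : t * model_b1 t = - k * (model_f t * (t * model_b t)).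
  by rewrite /model_b1; ring.
have -> : t * model_g1 t = - (k / 2) * (model_f t * (t * model_g t + t * model_b t)).
  by rewrite /model_g1 /model_f1; ring.
by rewrite -model_ode2 /model_g; field.
Qed.

Lemma model_y : t != 0 -> C0 != 0 -> typeI_y model_f model_g model_b model_b1 t = 0.
Proof.
by move=> t0 c0; rewrite /typeI_y /model_b1 /model_g /model_b /model_f; field; rewrite E0 c0 t0.
Qed.
End At.
End Model.

Lemma sqr_sum_sqrt (R : rcfType) (x y : R) : 0 <= x -> 0 <= y ->
  (Num.sqrt x + Num.sqrt y) ^+ 2 = x + y + 2 * Num.sqrt (x * y).
Proof.
move=> x0 y0; rewrite sqrtrM // -{2}(sqr_sqrtr x0) -{2}(sqr_sqrtr y0); ring.
Qed.

Section Sufficiency.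
Variables (R : realType) (n : nat).
Local Notation C := R[i].
Local Notation V := 'cV[C]_n.

(** The squared metric of the family, all signs of the curvature [k] together. *)
Definition model_metric (C0 k : R) (D : set V) (F : V -> V -> R) : Prop :=
  forall z, D z -> [/\ z != 0, 0 < model_E C0 k (sqnorm z) &
    forall v, v != 0 -> F z v ^+ 2 = sqnorm v *
      (Num.sqrt (model_f C0 k (sqnorm z) + model_g C0 k (sqnorm z) * s_var z v) +
       Num.sqrt (model_b C0 k (sqnorm z) * s_var z v)) ^+ 2].

(** On the set where [beta(v)] is nonzero [s] is positive by [slit_herm], so the formulas for
    type I apply there; the curvature formula is then a constant by a rational identity. *)
Lemma model_sufficient (D : set V) a b F (C0 k : R) : open D -> randers D a b F ->
  0 < C0 -> model_metric C0 k D F ->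
  weakly_kahler_on F (randers_slit D b) /\
  constant_hol_curvature_on F (randers_slit D b) k.
Proof.
move=> oD rF c0 mF.
pose O t := 0 < t /\ 0 < model_E C0 k t.
have oO t : O t -> \forall x \near t, O x.
  move=> [t0 E0]; have hE := rd_cvg (rd_model_E C0 k t).
  near=> x; split; near: x; first exact: lt_nbhsr.
  exact: (cvgr_gt _ hE).
have On z : D z -> O (sqnorm z) by move=> /mF [z0 E0 _]; split; rewrite ?sqnorm_gt0.
pose f := model_f C0 k; pose g := model_g C0 k; pose bb := model_b C0 k.
pose f1 := model_f1 C0 k; pose g1 := model_g1 C0 k; pose b1 := model_b1 C0 k.
have jets t : O t -> [/\ jet2 f f1 t, jet2 g g1 t & jet2 bb b1 t].
  by move=> [_ E0]; apply: model_jets; rewrite lt0r_neq0.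
have pos t : O t -> [/\ 0 < t, 0 < f t, 0 < f t + t * g t & 0 < bb t].
  move=> [t0 E0]; have E0' := lt0r_neq0 E0.
  have b0 : 0 < bb t by rewrite /bb /model_b divr_gt0 // exprn_gt0.
  split=> //; first by rewrite /f /model_f divr_gt0.
  by rewrite /f /g model_ode2 // mulr_gt0.
have ode2 t : O t -> f t + t * g t = t * bb t.
  by move=> [_ /lt0r_neq0 E0]; exact: model_ode2.
have ode3 t : O t -> 2 * g t + t * g1 t = t * b1 t.
  by move=> [_ /lt0r_neq0 E0]; exact: model_ode3.
have slit z v : randers_slit D b z v -> D z /\ herm z v != 0.
  move=> [Dz bv]; split=> //; have [z0 E0 E] := mF _ Dz.
  have [_ f0 _ b0] := pos _ (On _ Dz).
  exact: (slit_herm rF Dz z0 f0 b0 E bv).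
have FE z v : D z -> v != 0 -> O (sqnorm z) -> 0 < s_var z v ->
    F z v ^+ 2 = sqnorm v * rphi f g (fun=> 0) bb (sqnorm z) (s_var z v).
  move=> Dz v0 o s0; have [_ _ ->] := mF _ Dz; last by [].
  have [t0 f0 M0 b0] := pos _ o; congr (_ * _).
  have st := s_var_le z v0.
  have p0 : 0 <= f (sqnorm z) + g (sqnorm z) * s_var z v.
    rewrite -(pmulr_rge0 _ t0).
    have -> : sqnorm z * (f (sqnorm z) + g (sqnorm z) * s_var z v) =
      (sqnorm z - s_var z v) * f (sqnorm z) + s_var z v * (f (sqnorm z) + sqnorm z * g (sqnorm z)).
      by ring.
    by rewrite addr_ge0 // mulr_ge0 ?subr_ge0 // ltW.
  have q0 : 0 <= bb (sqnorm z) * s_var z v by rewrite ltW // mulr_gt0.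
  by rewrite -/f -/g -/bb sqr_sum_sqrt // /rphi /rho /P1 /P2 add0r.
have ode1 t : O t -> f1 t = g t + bb t by [].
split.
  move=> z v /slit [Dz w0] i.
  exact: (typeI_weakly_kahler oD oO jets FE pos ode1 ode2 ode3 Dz (On _ Dz) w0).
move=> z v /slit [Dz w0]; have o := On _ Dz; have [t0 E0] := o.
have y0 t : O t -> typeI_y f g bb b1 t = 0.
  by move=> [x0 e0]; apply: model_y; rewrite lt0r_neq0.
have hy : rd (typeI_y f g bb b1) (sqnorm z) 0.
  apply: (rd_near _ (rd_cst 0 (sqnorm z))); near=> x; rewrite y0 //; near: x; exact: oO.
rewrite (typeI_hol_curvature oD oO jets FE pos ode1 ode2 ode3 Dz o w0 hy) y0 //.
have [pp ww hh [p2 w2 h2]] := typeI_roots pos o w0.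
have [_ f0 _ b0] := pos _ o; congr (rc _).
set p := typeI_p _ _ _ _ in pp p2 *; set w := typeI_w _ _ in ww w2 *.
set h := typeI_h _ _ in hh h2 *.
have q0 : p + h * w != 0 by rewrite lt0r_neq0 // addr_gt0 // mulr_gt0.
have f0' : f (sqnorm z) != 0 by rewrite lt0r_neq0.
have [kE b1E g1E] : [/\ k = - 4 * g (sqnorm z) / f (sqnorm z) ^+ 2,
    b1 (sqnorm z) = 4 * g (sqnorm z) * h ^+ 2 / f (sqnorm z) &
    g1 (sqnorm z) = 2 * g (sqnorm z) * f1 (sqnorm z) / f (sqnorm z)].
  rewrite h2 /b1 /g1 /f1 /g /bb /f /model_b1 /model_g1 /model_g.
  rewrite /f in f0'; move: (model_f C0 k _) (model_b C0 k _) (model_f1 C0 k _) f0' => x y u x0.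
  by split; field.
have f1E : f1 (sqnorm z) = g (sqnorm z) + h ^+ 2 by rewrite h2.
have fE : f (sqnorm z) = p ^+ 2 - g (sqnorm z) * w ^+ 2 by rewrite p2 w2; ring.
rewrite kE b1E g1E f1E -w2.
rewrite {kE} fE in f0' *; move: (g (sqnorm z)) f0' => G f0'.
by field; rewrite q0 f0' !lt0r_neq0.
Unshelve. all: by end_near. Qed.
End Sufficiency.

(** * Reduction to a ray *)

Section Ray.
Variables (R : realType) (n : nat).
Local Notation C := R[i].
Local Notation V := 'cV[C]_n.+1.

Definition ray (x : R) : V := rc x *: basis_vec R ord0.

Lemma rayE x i : ray x i 0 = rc x * (i == ord0)%:R.
Proof. by rewrite !mxE eqxx andbT. Qed.

Lemma sqnorm_ray x : sqnorm (ray x) = x ^+ 2.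
Proof.
rewrite /sqnorm (bigD1 ord0) //= big1 => [|i i0]; rewrite rayE.
  by rewrite eqxx mulr1 addr0 normc_rc real_normK // num_real.
by rewrite (negbTE i0) mulr0 Normc.normc0 expr0n.
Qed.

(** Gram-Schmidt applied to the row [z^*] produces a unitary matrix sending [z] to the
    first axis. *)
Lemma unitary_to_ray (z : V) : exists2 A : 'M[C]_n.+1, A \is unitarymx &
  A *m z = ray (Num.sqrt (sqnorm z)).
Proof.
pose B : 'M[C]_n.+1 := \matrix_(i, j) (if i == ord0 then (z j 0)^* else 0).
have U : spectral.schmidt B \is unitarymx by exact: schmidt_unitarymx.
exists (spectral.schmidt B) => //; move: U.
have := row_schmidt_sub B ord0; rewrite (big_pred1 ord0); last first.
  by move=> k /=; rewrite leqn0.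
rewrite genmxE => /sub_rVP [c cE].
have := form1_row_schmidt B ord0; rewrite cE linearZl /=.
move=> c0 /row_unitarymxP U.
have {}c0 : 0 <= c by move: c0; rewrite U eqxx mulr1.
set S := spectral.schmidt B in U cE *.
have Sz i : (S *m z) i 0 = c * (i == ord0)%:R.
  have cR : c^* = c by apply: CrealP; exact: ger0_real.
  rewrite -(U i ord0) dotmxE !mxE mulr_sumr; apply: eq_bigr => j _.
  have zj : (z j 0)^* = c * S ord0 j by have /rowP/(_ j) := cE; rewrite !mxE eqxx.
  by rewrite -[z j 0]conjCK zj rmorphM /= cR !mxE; ring.
have xE : sqnorm z = Re c ^+ 2.
  apply: (@complexI R); rewrite rmorphXn /= -sum_zzb.
  have cR : rc (Re c) = c by apply: complex_eq => //=; rewrite ger0_Im.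
  have cJ : c^* = c by apply: CrealP; exact: ger0_real.
  rewrite cR expr2.
  transitivity (c * (c * (ord0 == ord0 :> 'I_n.+1)%:R)); last by rewrite eqxx mulr1.
  rewrite -(U ord0 ord0) dotmxE !mxE !mulr_sumr; apply: eq_bigr => j _.
  have zj : (z j 0)^* = c * S ord0 j by have /rowP/(_ j) := cE; rewrite !mxE eqxx.
  have zj' : z j 0 = c * (S ord0 j)^* by rewrite -[LHS]conjCK zj rmorphM /= cJ.
  by rewrite zj zj' !mxE; ring.
apply/matrixP => i j; rewrite ord1 Sz rayE xE sqrtr_sqr ger0_norm; last first.
  by have := c0; rewrite lecE => /andP[].
by congr (_ * _); apply: complex_eq => //=; rewrite ger0_Im.
Qed.

End Ray.

(** * Invariance under phases in a plane *)

Section PhaseTest.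
Variable R : realType.
Local Notation C := R[i].
Local Notation N := Normc.normc.
Variables (a00 a11 : R) (c x y : C).
Let Q (p q : C) : R := a00 * N p ^+ 2 + a11 * N q ^+ 2 + 2 * Re (c * p * q^*).
Hypothesis Qpos : forall p q, (p != 0) || (q != 0) -> 0 < Q p q.
Hypothesis inv : forall p q z, z \in [:: -1; 'i; - 'i] ->
  Num.sqrt (Q (z * p) q) + N (x * (z * p) + y * q) = Num.sqrt (Q p q) + N (x * p + y * q).

(** Invariance of [sqrt Q + |beta|] under [p -> z p] at the vector [(y, -x)], on which [beta]
    vanishes: the values [A + 2 Re (z w)] equal [(K - m |z - 1|)^2]. Averaging over
    [z = i, - i] and comparing with [z = -1] gives [|i - 1| = 1] unless [x y = 0]. *)
Lemma phase_test_prod : x * y = 0.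
Proof.
apply/eqP; apply/negPn/negP => xy0.
pose A := a00 * N y ^+ 2 + a11 * N x ^+ 2; pose w := - (c * y * x^*).
pose m := N (x * y); pose K := Num.sqrt (A + 2 * Re w).
have QE z : N z ^+ 2 = 1 -> Q (z * y) (- x) = A + 2 * Re (z * w).
  move=> z1; rewrite /Q Normc.normcM exprMn z1 mul1r normcN /A; congr (_ + _ * Re _).
  by rewrite rmorphN /w; ring.
have NE z : N (x * (z * y) + y * - x) = m * N (z - 1).
  by rewrite -Normc.normcM; congr N; ring.
have y0 : y != 0 by apply: contra xy0 => /eqP ->; rewrite mulr0.
have m0 : 0 < m by rewrite normc_gt0.
have Nm1 : N (-1 : C) ^+ 2 = 1 by rewrite normcN Normc.normc1 expr1n.
have Ni : N ('i : C) ^+ 2 = 1 by rewrite imagE normc2E /= expr0n expr1n add0r.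
have Nmi : N (- 'i : C) ^+ 2 = 1 by rewrite normcN.
have Q1 : Q y (- x) = A + 2 * Re w by have := QE 1; rewrite !mul1r Normc.normc1 expr1n; exact.
have pos z : N z ^+ 2 = 1 -> 0 < A + 2 * Re (z * w).
  move=> z1; rewrite -QE //; apply: Qpos; rewrite mulf_neq0 // -normc_eq0.
  by rewrite -sqrf_eq0 z1 oner_neq0.
have pos1 : 0 < A + 2 * Re w by have := pos 1; rewrite mul1r Normc.normc1 expr1n; exact.
have K0 : 0 < K by rewrite sqrtr_gt0.
have E z : z \in [:: -1; 'i; - 'i] -> N z ^+ 2 = 1 ->
    A + 2 * Re (z * w) = (K - m * N (z - 1)) ^+ 2.
  move=> zin z1; have := inv y (- x) zin; rewrite QE // Q1 NE -/K.
  have -> : x * y + y * - x = 0 by ring.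
  by rewrite Normc.normc0 addr0 => <-; rewrite addrK sqr_sqrtr // ltW // pos.
have in1 : (-1 : C) \in [:: -1; 'i; - 'i] by rewrite inE eqxx.
have in2 : ('i : C) \in [:: -1; 'i; - 'i] by rewrite !inE eqxx orbT.
have in3 : (- 'i : C) \in [:: -1; 'i; - 'i] by rewrite !inE eqxx !orbT.
have := E _ in1 Nm1.
have -> : N (-1 - 1 : C) = 2.
  have -> : -1 - 1 = - rc 2 :> C by rewrite rmorph_nat; ring.
  by rewrite normcN normc_rc ger0_norm.
rewrite mulN1r ReN => E1.
have := E _ in3 Nmi; have := E _ in2 Ni.
have d1 : N ('i - 1 : C) ^+ 2 = 2 by rewrite imagE normc2E /=; ring.
have d2 : N (- 'i - 1 : C) ^+ 2 = 2 by rewrite imagE normc2E /=; ring.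
have eqd : N (- 'i - 1 : C) = N ('i - 1 : C).
  by apply/eqP; rewrite -(eqrXn2 (n := 2)) ?normc_ge0 // d1 d2.
rewrite eqd; move: (N ('i - 1)) (normc_ge0 ('i - 1 : C)) d1 => d d0 d1.
rewrite mulNr ReN => E3 E2.
have EK : K ^+ 2 = A + 2 * Re w by rewrite sqr_sqrtr // ltW.
have EA : A = K ^+ 2 - 2 * K * m * d + m ^+ 2 * d ^+ 2.
  move: E2 E3; rewrite !sqrrB; move: (Re ('i * w)) => u E2 E3; nra.
have EB : A = K ^+ 2 - 2 * K * m + 2 * m ^+ 2.
  move: E1 EK; move: (Re w) => u E1 EK; nra.
have dk : K * m * (d - 1) = 0 by rewrite EB d1 in EA; lra.
have : K * m != 0 by rewrite mulf_neq0 ?lt0r_neq0.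
move=> /negbTE km; have := dk => /eqP; rewrite mulf_eq0 km /= subr_eq0 => /eqP de.
by move: d1; rewrite de expr1n => /eqP; rewrite eq_sym -subr_eq0 (_ : 2 - 1 = 1) ?oner_eq0 //; ring.
Qed.

(** Once [x y = 0] the modulus of [beta] is itself invariant, hence so is [Q]. *)
Lemma phase_test_cross : c = 0.
Proof.
have xy := phase_test_prod.
have NE z p q : N z ^+ 2 = 1 -> N (x * (z * p) + y * q) = N (x * p + y * q).
  move=> z1; have z1' : N z = 1.
    by apply/eqP; rewrite -(eqrXn2 (n := 2)) ?normc_ge0 // z1 expr1n.
  move/eqP: xy; rewrite mulf_eq0 => /orP[] /eqP ->; first by rewrite !mul0r !add0r.
  by rewrite mul0r !addr0 mulrCA Normc.normcM z1' mul1r.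
have Nm1 : N (-1 : C) ^+ 2 = 1 by rewrite normcN Normc.normc1 expr1n.
have QE p q : p != 0 -> Q (-1 * p) q = Q p q.
  have in1 : (-1 : C) \in [:: -1; 'i; - 'i] by rewrite inE eqxx.
  move=> p0; have := inv p q in1.
  rewrite NE // => /addIr /(congr1 (fun x => x ^+ 2)).
  by rewrite !sqr_sqrtr // ltW // Qpos // ?mulN1r ?oppr_eq0 p0.
apply: complex_eq.
  have := QE 1 1 (oner_neq0 _); rewrite /Q mulN1r normcN rmorph1 !mulr1 mulrN ReN mulr1.
  by move: (a00 * _ + _) => A; lra.
have i0 : 'i != 0 :> C by rewrite imagE; apply/eqP => /(congr1 (fun x : C => Im x)) /= /eqP; rewrite oner_eq0.
have := QE 'i 1 i0; rewrite /Q mulN1r normcN rmorph1 !mulr1 mulrN ReN.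
have -> : Re (c * 'i) = - Im c by rewrite imagE; case: c => u v /=; ring.
by move: (a00 * _ + _) => A /=; lra.
Qed.
End PhaseTest.

Section TestPlane.
Variables (R : realType) (n : nat).
Local Notation C := R[i].
Local Notation V := 'cV[C]_n.+2.

Definition i1 : 'I_n.+2 := lift ord0 ord0.

Definition vec2 (p q : C) : V := \col_i (if i == ord0 then p else if i == i1 then q else 0).

Lemma sum_vec2 (f : 'I_n.+2 -> C) :
  (forall i, i != ord0 -> i != i1 -> f i = 0) -> \sum_i f i = f ord0 + f i1.
Proof.
move=> h; rewrite (bigD1 ord0) //= (bigD1 i1) //= big1 ?addr0 // => i /andP[].
exact: h.
Qed.

Lemma vec2_0 p q : vec2 p q ord0 0 = p. Proof. by rewrite mxE. Qed.
Lemma vec2_1 p q : vec2 p q i1 0 = q. Proof. by rewrite mxE. Qed.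
Lemma vec2_o p q i : i != ord0 -> i != i1 -> vec2 p q i 0 = 0.
Proof. by move=> h k; rewrite mxE (negbTE h) (negbTE k). Qed.

Lemma sqnorm_vec2 p q : sqnorm (vec2 p q) = Normc.normc p ^+ 2 + Normc.normc q ^+ 2.
Proof.
apply: (@complexI R); rewrite rmorphD /= !normc2 -sum_zzb sum_vec2 ?vec2_0 ?vec2_1 // => i h k.
by rewrite vec2_o // mul0r.
Qed.

Lemma herm_vec2 x p q : herm (ray n.+1 x) (vec2 p q) = rc x * p^*.
Proof.
rewrite /herm sum_vec2 => [|i h k]; last by rewrite vec2_o // rmorph0 mulr0.
by rewrite vec2_0 !rayE eqxx mulr1 mulr0 mul0r addr0.
Qed.

Lemma hform_vec2 (a : 'M[C]_n.+2) p q : Defs.hermitian_matrix a ->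
  Re (hform a (vec2 p q)) = Re (a ord0 ord0) * Normc.normc p ^+ 2 +
    Re (a i1 i1) * Normc.normc q ^+ 2 + 2 * Re (a ord0 i1 * p * q^*).
Proof.
move=> ha; rewrite /hform sum_vec2 => [|i h k]; last first.
  by rewrite big1 // => j _; rewrite vec2_o // mulr0 mul0r.
rewrite !sum_vec2 ?vec2_0 ?vec2_1 => [|i h k|i h k];
  [|by rewrite vec2_o // rmorph0 mulr0..].
have real i : rc (Re (a i i)) = a i i.
  by apply: complex_eq => //=; have /(congr1 (fun x : C => Im x)) := ha i i; rewrite Im_conj; lra.
have E : a i1 ord0 * q * p^* = (a ord0 i1 * p * q^*)^*.
  by rewrite (ha ord0 i1) !rmorphM /= conjCK; ring.
rewrite E -mulrA -normc2 -[a i1 i1 * q * _]mulrA -normc2 !ReD Re_conj.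
rewrite -(real ord0) -(real i1) -!rmorphM /= ; ring.
Qed.

Lemma pairing_vec2 (b : V -> 'rV[C]_n.+2) z p q :
  pairing b z (vec2 p q) = b z 0 ord0 * p + b z 0 i1 * q.
Proof.
rewrite /pairing sum_vec2 ?vec2_0 ?vec2_1 // => i h k.
by rewrite vec2_o // mulr0.
Qed.

Lemma vec2_neq0 p q : (p != 0) || (q != 0) -> vec2 p q != 0.
Proof.
move=> h; apply/eqP => /matrixP E; move: h.
by rewrite -[p](vec2_0 p q) -[in X in _ || X](vec2_1 p q) !E !mxE eqxx.
Qed.
End TestPlane.

(** * The profile read off on a ray *)

Section FinslerPositivity.
Variables (R : realType) (n : nat).
Local Notation C := R[i].
Local Notation V := 'cV[C]_n.
Variables (D : set V) (F : V -> V -> R) (phi : R -> R -> R).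
Variables (a : V -> 'M[C]_n) (b : V -> 'rV[C]_n).
Hypothesis randersF : randers D a b F.

Lemma F_gt0 z v : D z -> v != 0 -> 0 < F z v.
Proof.
have [[_ F0 Fz _] _ _ _] := randersF.
move=> Dz v0; rewrite lt_def F0 // andbT; apply: contra v0 => /eqP E.
by apply/eqP/(Fz z v Dz); rewrite E expr0n.
Qed.

Hypothesis F_phi : forall z v, D z -> v != 0 ->
     F z v = Num.sqrt (sqnorm v * phi (sqnorm z) (s_var z v)).

Lemma F2_phi z v : D z -> v != 0 -> F z v ^+ 2 = sqnorm v * phi (sqnorm z) (s_var z v).
Proof.
move=> Dz v0; have := F_gt0 Dz v0; rewrite F_phi // sqrtr_gt0 => h.
by rewrite sqr_sqrtr // ltW.
Qed.
End FinslerPositivity.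

Section RayMetric.
Variables (R : realType) (n : nat).
Local Notation C := R[i].
Local Notation V := 'cV[C]_n.+2.
Local Notation N := Normc.normc.
Variables (D : set V) (F : V -> V -> R) (phi : R -> R -> R).
Variables (a : V -> 'M[C]_n.+2) (b : V -> 'rV[C]_n.+2).
Hypothesis oD : open D.
Hypothesis randersF : randers D a b F.
Hypothesis unitF : unitary_invariant D F.
Hypothesis F_phi : forall z v, D z -> v != 0 ->
     F z v = Num.sqrt (sqnorm v * phi (sqnorm z) (s_var z v)).

Lemma D_ray z : D z -> D (ray n.+1 (Num.sqrt (sqnorm z))).
Proof.
move=> Dz; have [A uA <-] := unitary_to_ray z.
by have [] := unitF 0 uA Dz.
Qed.

Local Notation a00 x := (Re (a (ray n.+1 x) ord0 ord0)).
Local Notation a11 x := (Re (a (ray n.+1 x) (i1 n) (i1 n))).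
Local Notation b0 x := (b (ray n.+1 x) 0 ord0).
Local Notation b1 x := (b (ray n.+1 x) 0 (i1 n)).

Lemma hform_gt0 z v : D z -> v != 0 -> 0 < Re (hform (a z) v).
Proof. by have [_ [_ ha] _ _] := randersF => Dz; have [_] := ha _ Dz; apply. Qed.

Lemma F_randers z v : D z -> F z v = Num.sqrt (Re (hform (a z) v)) + N (pairing b z v).
Proof. by have [_ _ _] := randersF; apply. Qed.

(** A phase change of the first coordinate of [v] preserves [|v|] and the modulus of
    [<z, v>] at a point [z] of the ray, hence [F]. *)
Lemma ray_orthogonal x : D (ray n.+1 x) ->
  a (ray n.+1 x) ord0 (i1 n) = 0 /\ b0 x * b1 x = 0.
Proof.
move=> Dx; have [_ [_ /(_ _ Dx) [ha _]] _ _] := randersF.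
have Qpos (p q : C) : (p != 0) || (q != 0) -> 0 < a00 x * N p ^+ 2 + a11 x * N q ^+ 2 +
    2 * Re (a (ray n.+1 x) ord0 (i1 n) * p * q^*).
  by move=> pq; rewrite -hform_vec2 //; apply: hform_gt0 => //; exact: vec2_neq0.
have FE (p q : C) : F (ray n.+1 x) (vec2 n p q) =
   Num.sqrt (a00 x * N p ^+ 2 + a11 x * N q ^+ 2 +
    2 * Re (a (ray n.+1 x) ord0 (i1 n) * p * q^*)) + N (b0 x * p + b1 x * q).
  by rewrite F_randers // pairing_vec2 hform_vec2.
have inv (p q z : C) : z \in [:: -1; 'i; - 'i] ->
    F (ray n.+1 x) (vec2 n (z * p) q) = F (ray n.+1 x) (vec2 n p q).
  move=> zin; have z1 : N z = 1.
    apply/eqP; rewrite -(eqrXn2 (n := 2)) ?normc_ge0 // expr1n; apply/eqP; move: zin.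
    by rewrite !inE => /or3P[] /eqP ->; rewrite ?normcN ?Normc.normc1 ?expr1n // imagE normc2E /= expr0n
      expr1n add0r.
  case pq: ((p != 0) || (q != 0)); last first.
    move/negbT: pq; rewrite negb_or !negbK => /andP[/eqP -> /eqP ->].
    by rewrite mulr0.
  have z0 : z != 0 by rewrite -normc_eq0 z1 oner_neq0.
  rewrite !F_phi ?vec2_neq0 ?mulf_eq0 ?(negbTE z0) //.
  by rewrite /s_var !sqnorm_vec2 !herm_vec2 rmorphM !Normc.normcM z1 !mul1r
    (_ : N z^* = 1) ?mul1r // -z1; case: (z) => ? ? /=; rewrite sqrrN.
have inv' p q z : z \in [:: -1; 'i; - 'i] -> _ := fun zin =>
  etrans (esym (FE (z * p) q)) (etrans (inv p q z zin) (FE p q)).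
split; first exact: phase_test_cross Qpos inv'.
exact: phase_test_prod Qpos inv'.
Qed.

Lemma a00_gt0 x : D (ray n.+1 x) -> 0 < a00 x.
Proof.
move=> Dx; have [_ [_ /(_ _ Dx) [ha hp]] _ _] := randersF.
have := hp (vec2 n 1 0) (vec2_neq0 _ _); rewrite oner_neq0 => /(_ isT).
rewrite hform_vec2 // Normc.normc1 Normc.normc0 expr1n expr0n conjC0 !mulr0 /=.
by rewrite ?(mulr0,mulr1,addr0).
Qed.

Lemma a11_gt0 x : D (ray n.+1 x) -> 0 < a11 x.
Proof.
move=> Dx; have [_ [_ /(_ _ Dx) [ha hp]] _ _] := randersF.
have := hp (vec2 n 0 1) (vec2_neq0 _ _); rewrite oner_neq0 orbT => /(_ isT).
rewrite hform_vec2 // Normc.normc1 Normc.normc0 expr1n expr0n !mulr0 mul0r /=.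
by rewrite !mulr0 mulr1 addr0 add0r.
Qed.

(** At radius [sqrt t] the form [alpha^2] has coefficients [ray_M] along [z] and [ray_f] across;
    [ray_H0] and [ray_H1] are those of [|beta|^2], divided by [t] since
    [|<z, v>|^2 = t |v_1|^2] on the ray. *)
Definition ray_f t := a11 (Num.sqrt t).
Definition ray_M t := a00 (Num.sqrt t).
Definition ray_H0 t := N (b0 (Num.sqrt t)) ^+ 2 / t.
Definition ray_H1 t := N (b1 (Num.sqrt t)) ^+ 2 / t.
Definition ray_g t := (ray_M t - ray_f t) / t.
Definition ray_T t := 0 < t /\ D (ray n.+1 (Num.sqrt t)).

Lemma ray_Tz z : D z -> z != 0 -> ray_T (sqnorm z).
Proof. by move=> Dz z0; split; [rewrite sqnorm_gt0 | exact: D_ray]. Qed.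

(** Vectors with real coordinates in the plane of the first two axes realise every [s]; as one
    of the two coefficients of [beta] vanishes, [|beta|^2] has no mixed term on them. *)
Lemma phi_ray t s : ray_T t -> 0 <= s <= t ->
  phi t s = (Num.sqrt (ray_f t + ray_g t * s) +
    Num.sqrt (t * ray_H1 t + (ray_H0 t - ray_H1 t) * s)) ^+ 2.
Proof.
move=> [t0 Dx] /andP[s0 st]; pose x := Num.sqrt t; have t0' := lt0r_neq0 t0.
have x0 : 0 <= x by exact: sqrtr_ge0.
have x2 : x ^+ 2 = t by rewrite sqr_sqrtr // ltW.
pose p := Num.sqrt (s / t); pose q := Num.sqrt (1 - s / t).
have p0 : 0 <= s / t by rewrite divr_ge0 // ltW.
have q0 : 0 <= 1 - s / t by rewrite subr_ge0 ler_pdivrMr // mul1r.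
have p2 : p ^+ 2 = s / t by rewrite sqr_sqrtr.
have q2 : q ^+ 2 = 1 - s / t by rewrite sqr_sqrtr.
have np : N (rc p) ^+ 2 = s / t by rewrite normc_rc real_normK ?num_real.
have nq : N (rc q) ^+ 2 = 1 - s / t by rewrite normc_rc real_normK ?num_real.
have sv : sqnorm (vec2 n (rc p) (rc q)) = 1 by rewrite sqnorm_vec2 np nq; ring.
have v0 : vec2 n (rc p) (rc q) != 0 by rewrite -sqnorm_gt0 sv.
have ss : s_var (ray n.+1 x) (vec2 n (rc p) (rc q)) = s.
  rewrite /s_var sv divr1 herm_vec2 conj_rc Normc.normcM !normc_rc exprMn.
  by rewrite !real_normK ?num_real // x2 p2 mulrC divfK.
have := F2_phi randersF F_phi Dx v0; rewrite sv ss sqnorm_ray -/x x2 mul1r => <-.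
have [_ [_ /(_ _ Dx) [ha hp]] _ _] := randersF; have [c0 xy] := ray_orthogonal Dx.
rewrite F_randers // hform_vec2 // pairing_vec2 c0 !mul0r mulr0 addr0 np nq.
congr ((Num.sqrt _ + _) ^+ 2); first by rewrite /ray_f /ray_g /ray_M -/x; field.
have q1 : 0 <= N (b0 x * rc p + b1 x * rc q) by exact: normc_ge0.
rewrite -/x -[LHS]ger0_norm // -sqrtr_sqr; congr (Num.sqrt _).
transitivity (N (b0 x) ^+ 2 * (s / t) + N (b1 x) ^+ 2 * (1 - s / t)).
  move/eqP: xy; rewrite mulf_eq0 -/x => /orP[] /eqP ->.
    by rewrite mul0r add0r Normc.normcM exprMn nq Normc.normc0 expr0n /= mul0r add0r.
  by rewrite mul0r addr0 Normc.normcM exprMn np Normc.normc0 expr0n /= mul0r addr0.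
by rewrite /ray_H0 /ray_H1 -/x; field.
Qed.

Lemma F2_ray z v : D z -> z != 0 -> v != 0 -> let t := sqnorm z in let s := s_var z v in
  F z v ^+ 2 = sqnorm v * (Num.sqrt (ray_f t + ray_g t * s) +
    Num.sqrt (t * ray_H1 t + (ray_H0 t - ray_H1 t) * s)) ^+ 2.
Proof.
move=> Dz z0 v0 t s; rewrite (F2_phi randersF F_phi) // phi_ray //; first exact: ray_Tz.
by rewrite s_var_ge0 s_var_le.
Qed.

Lemma ray_H0H1 t : ray_T t -> ray_H0 t * ray_H1 t = 0.
Proof.
move=> [t0 Dx]; have [_ xy] := ray_orthogonal Dx; rewrite /ray_H0 /ray_H1.
by move/eqP: xy; rewrite mulf_eq0 => /orP[] /eqP ->;
  rewrite Normc.normc0 expr0n /= mul0r ?mul0r ?mulr0.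
Qed.

Lemma ray_pos t : ray_T t ->
  [/\ 0 < ray_f t, 0 < ray_f t + t * ray_g t, 0 <= ray_H0 t & 0 <= ray_H1 t].
Proof.
move=> [t0 Dx]; split; first exact: a11_gt0.
- have -> : ray_f t + t * ray_g t = ray_M t by rewrite /ray_g; field; rewrite lt0r_neq0.
  exact: a00_gt0.
- by rewrite divr_ge0 ?sqr_ge0 // ltW.
- by rewrite divr_ge0 ?sqr_ge0 // ltW.
Qed.

Definition C2 (f : R -> R) := exists f1, forall t, ray_T t -> jet2 f f1 t.

Lemma rd_ray (u : V -> C) x : dir_derivable u (basis_vec R ord0) (ray n.+1 x) ->
  rd (fun x => Re (u (ray n.+1 x))) x (Re (dir_deriv u (basis_vec R ord0) (ray n.+1 x))) /\
  rd (fun x => Im (u (ray n.+1 x))) x (Im (dir_deriv u (basis_vec R ord0) (ray n.+1 x))).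
Proof.
have E y : ray n.+1 x + rc (y - x) *: basis_vec R ord0 = ray n.+1 y.
  by rewrite /ray -scalerDl -rmorphD /= addrC subrK.
have hs : rd (fun y => y - x) x 1.
  by apply: rd_eq (rdB (rd_id x) (rd_cst x x)) _; rewrite subr0.
have shift (c : R -> R) l : rd c 0 l -> rd (fun y => c (y - x)) x l.
  by move=> h; apply: rd_eq (rd_comp (g := fun y => y - x) (x := x) _ hs) (mulr1 l); rewrite subrr.
move=> [h1 h2]; split.
- have := shift _ _ (derivableP h1); rewrite /dir_deriv /= derive1E.
  by apply: rd_near; near=> y; rewrite E.
- have := shift _ _ (derivableP h2); rewrite /dir_deriv /= derive1E.
  by apply: rd_near; near=> y; rewrite E.
Unshelve. all: by end_near. Qed.

Lemma C2_smooth (u : V -> C) : smooth_on D u ->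
  C2 (fun t => Re (u (ray n.+1 (Num.sqrt t)))) /\ C2 (fun t => Im (u (ray n.+1 (Num.sqrt t)))).
Proof.
move=> su; pose e := basis_vec R (@ord0 n.+1).
have d0 x : D (ray n.+1 x) -> dir_derivable u e (ray n.+1 x).
  by have [_ h] := su [::]; exact: h.
have d1 x : D (ray n.+1 x) -> dir_derivable (dir_deriv u e) e (ray n.+1 x).
  by have [_ h] := su [:: e]; exact: h.
split.
- exists (fun t => Re (dir_deriv u e (ray n.+1 (Num.sqrt t))) / (2 * Num.sqrt t)) => t [t0 Dx].
  have s0 : Num.sqrt t != 0 by rewrite gt_eqF // sqrtr_gt0.
  have ds := rd_sqrt t0 (rd_id t).
  split; first by apply: rd_eq (rd_comp (rd_ray (d0 _ Dx)).1 ds) _; rewrite mul1r.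
  eexists; apply: rd_div; last exact: rdM (rd_cst 2 t) ds.
    by rewrite mulf_neq0.
  exact: (rd_comp (rd_ray (d1 _ Dx)).1 ds).
- exists (fun t => Im (dir_deriv u e (ray n.+1 (Num.sqrt t))) / (2 * Num.sqrt t)) => t [t0 Dx].
  have s0 : Num.sqrt t != 0 by rewrite gt_eqF // sqrtr_gt0.
  have ds := rd_sqrt t0 (rd_id t).
  split; first by apply: rd_eq (rd_comp (rd_ray (d0 _ Dx)).2 ds) _; rewrite mul1r.
  eexists; apply: rd_div; last exact: rdM (rd_cst 2 t) ds.
    by rewrite mulf_neq0.
  exact: (rd_comp (rd_ray (d1 _ Dx)).2 ds).
Qed.

Lemma C2_ext f g : (forall t, f t = g t) -> C2 f -> C2 g.
Proof. by move=> /funext ->. Qed.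

Lemma C2_add f g : C2 f -> C2 g -> C2 (fun t => f t + g t).
Proof.
move=> [f1 hf] [g1 hg]; exists (fun t => f1 t + g1 t) => t Tt.
have [k1 [c k2]] := hf t Tt; have [k3 [d k4]] := hg t Tt.
by split; [exact: rdD | eexists; exact: rdD k2 k4].
Qed.

Lemma C2_opp f : C2 f -> C2 (fun t => - f t).
Proof.
move=> [f1 hf]; exists (fun t => - f1 t) => t Tt; have [k1 [c k2]] := hf t Tt.
by split; [exact: rdN | eexists; exact: rdN k2].
Qed.

Lemma C2_mul f g : C2 f -> C2 g -> C2 (fun t => f t * g t).
Proof.
move=> [f1 hf] [g1 hg]; exists (fun t => f1 t * g t + f t * g1 t) => t Tt.
have [k1 [c k2]] := hf t Tt; have [k3 [d k4]] := hg t Tt.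
split; first exact: rdM.
by eexists; exact: rdD (rdM k2 k3) (rdM k1 k4).
Qed.

Lemma C2_inv : C2 (fun t => t^-1).
Proof.
exists (fun t => - 1 / t ^+ 2) => t [t0 _]; have t0' := lt0r_neq0 t0.
split; first exact: rdV t0' (rd_id t).
eexists; apply: (rd_div (g := fun t => t ^+ 2)); last exact: rdX2 (rd_id t).
  by rewrite expf_neq0.
exact: rd_cst.
Qed.

Lemma C2_sq_normc (u : V -> C) : smooth_on D u ->
  C2 (fun t => N (u (ray n.+1 (Num.sqrt t))) ^+ 2 / t).
Proof.
move=> /C2_smooth [h1 h2].
apply: (C2_ext _ (C2_mul (C2_add (C2_mul h1 h1) (C2_mul h2 h2)) C2_inv)) => t /=.
by rewrite normc2E !expr2.
Qed.

Lemma ray_C2 : [/\ C2 ray_f, C2 ray_g, C2 ray_H0 & C2 ray_H1].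
Proof.
have [_ [sa _] sb _] := randersF.
have hf : C2 ray_f by have [] := C2_smooth (sa (i1 n) (i1 n)).
have hM : C2 ray_M by have [] := C2_smooth (sa ord0 ord0).
split=> //; [|exact: C2_sq_normc (sb ord0)|exact: C2_sq_normc (sb (i1 n))].
exact: C2_mul (C2_add hM (C2_opp hf)) C2_inv.
Qed.

Lemma ray_T_open t : ray_T t -> \forall x \near t, ray_T x.
Proof.
move=> [t0 Dx]; have h := along_open oD Dx (basis_vec R ord0).
have hs : rd (fun y => Num.sqrt y - Num.sqrt t) t _ :=
  rdB (rd_sqrt t0 (rd_id t)) (rd_cst (Num.sqrt t) t).
have := rd_cvg hs; rewrite subrr => /(_ _ h) hh.
have hp : \forall x \near t, 0 < x by exact: lt_nbhsr.
apply: filterS2 hp hh => x x0 Dr; split=> //.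
by move: Dr; rewrite /preimage /= /ray -scalerDl -rmorphD /= addrC subrK.
Qed.

End RayMetric.

(** * Local consequences of the two conditions *)

Section LocalNecessity.
Variables (R : realType) (n : nat).
Local Notation C := R[i].
Local Notation V := 'cV[C]_n.+2.
Local Notation N := Normc.normc.
Variables (D : set V) (F : V -> V -> R) (phi : R -> R -> R).
Variables (a : V -> 'M[C]_n.+2) (b : V -> 'rV[C]_n.+2) (k : R).
Hypothesis oD : open D.
Hypothesis randersF : randers D a b F.
Hypothesis unitF : unitary_invariant D F.
Hypothesis F_phi : forall z v, D z -> v != 0 ->
     F z v = Num.sqrt (sqnorm v * phi (sqnorm z) (s_var z v)).
Hypothesis wk : weakly_kahler_on F (randers_slit D b).

Local Notation T := (ray_T D).
Local Notation f := (ray_f a).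
Local Notation g := (ray_g a).
Local Notation H0 := (ray_H0 b).
Local Notation H1 := (ray_H1 b).
Local Notation rt t := (ray n.+1 (Num.sqrt t)).

Let pos t : T t -> [/\ 0 < f t, 0 < f t + t * g t, 0 <= H0 t & 0 <= H1 t].
Proof. exact: (ray_pos randersF). Qed.

Lemma sqnorm_rt (t : R) : 0 < t -> sqnorm (rt t) = t.
Proof. by move=> t0; rewrite sqnorm_ray sqr_sqrtr // ltW. Qed.

(** Every [s] strictly between [0] and [t] is realised in the plane of the first two axes, by a
    vector that is off the zeros of [beta] whenever [beta] does not vanish at the point. *)
Lemma test_vector (t s : R) : T t -> 0 < s < t -> exists v : V,
  [/\ v != 0, s_var (rt t) v = s, herm (rt t) v != 0,
    exists i, (herm (rt t) v)^* * (v i 0)^* - rc (sqnorm v) * (rt t i 0)^* != 0 &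
    0 < H0 t \/ 0 < H1 t -> pairing b (rt t) v != 0].
Proof.
move=> Tt /andP[s0 st]; have [t0 Dx] := Tt; have t0' := lt0r_neq0 t0.
pose p := Num.sqrt (s / t); pose q := Num.sqrt (1 - s / t).
have p0 : 0 < s / t by rewrite divr_gt0.
have q0 : 0 < 1 - s / t by rewrite subr_gt0 ltr_pdivrMr // mul1r.
have pp : rc p != 0 :> C by rewrite fmorph_eq0 gt_eqF // sqrtr_gt0.
have qq : rc q != 0 :> C by rewrite fmorph_eq0 gt_eqF // sqrtr_gt0.
have np : N (rc p) ^+ 2 = s / t by rewrite normc_rc real_normK ?num_real // sqr_sqrtr // ltW.
have nq : N (rc q) ^+ 2 = 1 - s / t by rewrite normc_rc real_normK ?num_real // sqr_sqrtr // ltW.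
have sv : sqnorm (vec2 n (rc p) (rc q)) = 1 by rewrite sqnorm_vec2 np nq; ring.
have hE : herm (rt t) (vec2 n (rc p) (rc q)) = rc (Num.sqrt t) * rc p.
  by rewrite herm_vec2 conj_rc.
have xx : rc (Num.sqrt t) != 0 :> C by rewrite fmorph_eq0 gt_eqF // sqrtr_gt0.
exists (vec2 n (rc p) (rc q)); split.
- by rewrite -sqnorm_gt0 sv.
- rewrite /s_var sv divr1 hE Normc.normcM exprMn np normc_rc real_normK ?num_real //.
  by rewrite sqr_sqrtr 1?mulrC ?divfK // ltW.
- by rewrite hE mulf_neq0.
- exists (i1 n); rewrite hE vec2_1 rayE /= mulr0 rmorph0 mulr0 subr0.
  by rewrite !mulf_neq0 // fmorph_eq0 // mulf_neq0.
- have e x : (0 < N x ^+ 2 / t) = (x != 0).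
    by rewrite pmulr_lgt0 ?invr_gt0 // exprn_even_gt0 //= normc_eq0.
  rewrite pairing_vec2 /ray_H0 /ray_H1 !e.
  have [_ /eqP] := ray_orthogonal randersF F_phi Dx.
  rewrite mulf_eq0 => /orP[] /eqP ->; rewrite eqxx mul0r ?add0r ?addr0 => -[] // x0;
    exact: mulf_neq0.
Qed.

Lemma ray_P1_gt0 (t s : R) : T t -> 0 <= s <= t -> 0 < f t + g t * s.
Proof.
move=> Tt /andP[s0 st]; have [t0 _] := Tt; have [f0 M0 _ _] := pos Tt.
rewrite -(pmulr_rgt0 _ t0).
have -> : t * (f t + g t * s) = (t - s) * f t + s * (f t + t * g t) by ring.
move: s0; rewrite le_eqVlt => /orP[/eqP <-|s0].
  by rewrite mul0r addr0 subr0 mulr_gt0.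
by apply: ltr_wpDl; [rewrite mulr_ge0 ?subr_ge0 // ltW | exact: mulr_gt0].
Qed.

Lemma T_neq0 (z : V) : T (sqnorm z) -> z != 0.
Proof. by move=> [t0 _]; rewrite -sqnorm_gt0. Qed.

(** A nonzero [H1] gives the profile type II near [t], which [typeII_absurd] excludes. *)
Lemma ray_H1_eq0 t : T t -> H1 t = 0.
Proof.
move=> Tt; have [t0 Dx] := Tt; have [f0 M0 h0 h1] := pos Tt.
apply/eqP; apply/negPn/negP => nz; have {nz}h1 : 0 < H1 t by rewrite lt_def nz.
have [[f1 jf] [g1 jg] [H0' _] [H1' jH]] := ray_C2 randersF.
pose O t := T t /\ 0 < H1 t.
have oO t' : O t' -> \forall x \near t', O x.
  move=> [Tt' h]; have [/rd_cvg c _] := jH _ Tt'; have oT := ray_T_open oD Tt'.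
  near=> x; split; near: x; [exact: oT | exact: (cvgr_gt _ c)].
pose aa t := t * H1 t; pose aa1 t := H1 t + t * H1' t.
pose bb t := - H1 t; pose bb1 t := - H1' t.
have jets t' : O t' -> [/\ jet2 f f1 t', jet2 g g1 t', jet2 aa aa1 t' & jet2 bb bb1 t'].
  move=> [Tt' _]; have [d1 [c d2]] := jH _ Tt'; split; [exact: jf|exact: jg| |].
    split; first by apply: rd_eq (rdM (rd_id t') d1) _; rewrite mul1r.
    by eexists; exact: rdD d1 (rdM (rd_id t') d2).
  by split; [exact: rdN | eexists; exact: rdN d2].
have FE z v : D z -> v != 0 -> O (sqnorm z) -> 0 < P1 f g (sqnorm z) (s_var z v) ->
    0 < P2 aa bb (sqnorm z) (s_var z v) ->
    F z v ^+ 2 = sqnorm v * rphi f g aa bb (sqnorm z) (s_var z v).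
  move=> Dz v0 [To h] p1 p2.
  have H00 : H0 (sqnorm z) = 0.
    have /eqP := ray_H0H1 randersF F_phi To.
    by rewrite mulf_eq0 (gt_eqF h) orbF => /eqP.
  rewrite (F2_ray randersF unitF F_phi Dz (T_neq0 To) v0) H00 sub0r.
  by rewrite sqr_sum_sqrt ?ltW.
have Ot : O t by [].
pose h := Num.sqrt (H1 t); pose hd := H1' t / (2 * h).
have hh : 0 < h by rewrite sqrtr_gt0.
have h2 : h ^+ 2 = H1 t by rewrite sqr_sqrtr // ltW.
have hE : 2 * h * hd = H1' t by rewrite /hd; field; exact: lt0r_neq0.
apply: (@typeII_absurd _ t (f t) (f1 t) (g t) (g1 t) h hd) => // w /andP[w0 wt] s.
have w2 : w ^+ 2 = t - s by rewrite /s; ring.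
have w2t : w ^+ 2 < t.
  by rewrite -[X in _ < X](sqr_sqrtr (ltW t0)) ltrXn2r // ?nnegrE ?sqrtr_ge0 ?ltW.
have st : 0 < s < t by rewrite subr_gt0 w2t gtrBl exprn_gt0.
have P1pos : 0 < f t + g t * s by apply: ray_P1_gt0 => //; case/andP: st => *; rewrite !ltW.
have pp : 0 < Num.sqrt (f t + g t * s) by rewrite sqrtr_gt0.
have p2 : Num.sqrt (f t + g t * s) ^+ 2 = f t + g t * s by rewrite sqr_sqrtr // ltW.
have ah : aa t = t * h ^+ 2 by rewrite h2.
have bh : bb t = - h ^+ 2 by rewrite h2.
have [v [v0 sE w_neq0 indep slit]] := test_vector Tt st.
have bv := slit (or_intror h1).
have om : root_dom D O f g aa bb (rt t) v.
  split; rewrite ?sE ?sqnorm_rt //.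
  - split; first exact: P1pos.
    by rewrite (typeII_P2 w2 ah bh) mulr_gt0 // exprn_gt0.
  - exact: (typeII_gam_gt0 p2 w2 ah bh).
  - exact: (typeII_disc_gt0 p2 w2 ah bh).
have := weakly_kahler_scalar oD oO jets FE om indep (wk (conj Dx bv)).
rewrite sE sqnorm_rt // => K0.
have a1E : aa1 t = h ^+ 2 + t * (2 * h * hd) by rewrite h2 hE.
have b1E : bb1 t = - (2 * h * hd) by rewrite hE.
have := kahler_typeII f1 g1 p2 w2 ah bh pp w0 hh a1E b1E.
rewrite K0 mul0r => /esym/eqP; rewrite mulf_eq0 => /orP[|/eqP//].
by rewrite gt_eqF // mulr_gt0 // exprn_gt0 // addr_gt0 // mulr_gt0.
Unshelve. all: by end_near. Qed.

(** The radii at which [beta] does not vanish. *)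
Definition ray_O t := T t /\ 0 < H0 t.

Lemma ray_O_open t : ray_O t -> \forall x \near t, ray_O x.
Proof.
have [_ _ [H0' jH] _] := ray_C2 randersF.
move=> [Tt h]; have [/rd_cvg c _] := jH _ Tt; have oT := ray_T_open oD Tt.
near=> x; split; near: x; [exact: oT | exact: (cvgr_gt _ c)].
Unshelve. all: by end_near. Qed.

Lemma F2_typeI z v : D z -> z != 0 -> v != 0 -> F z v ^+ 2 = sqnorm v *
  (Num.sqrt (f (sqnorm z) + g (sqnorm z) * s_var z v) +
   Num.sqrt (H0 (sqnorm z) * s_var z v)) ^+ 2.
Proof.
move=> Dz z0 v0; rewrite (F2_ray randersF unitF F_phi Dz z0 v0).
by rewrite (ray_H1_eq0 (ray_Tz unitF Dz z0)) mulr0 add0r subr0.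
Qed.

Lemma F2_typeI_rphi z v : D z -> v != 0 -> ray_O (sqnorm z) -> 0 < s_var z v ->
  F z v ^+ 2 = sqnorm v * rphi f g (fun=> 0) H0 (sqnorm z) (s_var z v).
Proof.
move=> Dz v0 [To h] s0; rewrite (F2_typeI Dz (T_neq0 To) v0).
rewrite sqr_sum_sqrt /rphi /rho /P1 /P2 ?add0r //; last by rewrite ltW // mulr_gt0.
by rewrite ltW // ray_P1_gt0 // (ltW s0) s_var_le.
Qed.

Lemma ray_O_pos t : ray_O t -> [/\ 0 < t, 0 < f t, 0 < f t + t * g t & 0 < H0 t].
Proof. by move=> [Tt h]; have [t0 _] := Tt; have [] := pos Tt. Qed.

(** The first two equations are those of [typeI_ode] after elimination of [f1]; the third is
    the derivative of the second one. *)
Lemma ray_ode f1 g1 b1 : (forall t, T t -> jet2 f f1 t) -> (forall t, T t -> jet2 g g1 t) ->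
  (forall t, T t -> jet2 H0 b1 t) -> forall t, ray_O t ->
  [/\ f1 t = g t + H0 t, f t + t * g t = t * H0 t & 2 * g t + t * g1 t = t * b1 t].
Proof.
move=> jf jg jH.
have jets t' : ray_O t' -> [/\ jet2 f f1 t', jet2 g g1 t', jet2 (fun=> 0) (fun=> 0) t' & jet2 H0 b1 t'].
  by move=> [Tt' _]; split; [exact: jf|exact: jg| split; [exact: rd_cst | exists 0; exact: rd_cst] |exact: jH].
have FE z v : D z -> v != 0 -> ray_O (sqnorm z) -> 0 < P1 f g (sqnorm z) (s_var z v) ->
    0 < P2 (fun=> 0) H0 (sqnorm z) (s_var z v) ->
    F z v ^+ 2 = sqnorm v * rphi f g (fun=> 0) H0 (sqnorm z) (s_var z v).
  move=> Dz v0 o p1 p2; apply: F2_typeI_rphi => //.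
  by case: o => _ h; move: p2; rewrite /P2 add0r pmulr_rgt0.
have step t : ray_O t -> t * f1 t = f t + 2 * t * g t /\ f1 t = g t + H0 t.
  move=> Ot; have [Tt h0] := Ot; have [_ Dx] := Tt; have [t0 f0 M0 _] := ray_O_pos Ot.
  pose h := Num.sqrt (H0 t); pose hd := b1 t / (2 * h).
  have hh : 0 < h by rewrite sqrtr_gt0.
  have h2 : h ^+ 2 = H0 t by rewrite sqr_sqrtr // ltW.
  have hE : b1 t = 2 * h * hd by rewrite /hd; field; exact: lt0r_neq0.
  rewrite -h2; apply: (@typeI_ode _ t (f t) (f1 t) (g t) (g1 t) h hd) => // w /andP[w0 wt] s.
  have w2 : w ^+ 2 = s by [].
  have st : 0 < s < t.
    rewrite exprn_gt0 //= -[X in _ < X](sqr_sqrtr (ltW t0)).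
    by rewrite ltrXn2r // ?nnegrE ?sqrtr_ge0 ?ltW.
  have P1pos : 0 < f t + g t * s by apply: ray_P1_gt0 => //; case/andP: st => *; rewrite !ltW.
  have pp : 0 < Num.sqrt (f t + g t * s) by rewrite sqrtr_gt0.
  have p2 : Num.sqrt (f t + g t * s) ^+ 2 = f t + g t * s by rewrite sqr_sqrtr // ltW.
  have [v [v0 sE w_neq0 indep slit]] := test_vector Tt st.
  have bv := slit (or_introl h0).
  have om : root_dom D ray_O f g (fun=> 0) H0 (rt t) v.
    split; rewrite ?sE ?sqnorm_rt //.
    - split; first exact: P1pos.
      by rewrite (typeI_P2 w2 h2) mulr_gt0 // exprn_gt0.
    - exact: (typeI_gam_gt0 p2 w2 h2).
    - exact: (typeI_disc_gt0 p2 w2 h2).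
  have := weakly_kahler_scalar oD ray_O_open jets FE om indep (wk (conj Dx bv)).
  rewrite sE sqnorm_rt // => K0.
  have := kahler_typeI f1 g1 p2 w2 h2 pp w0 hh hE.
  rewrite K0 mul0r => /esym/eqP; rewrite mulf_eq0 => /orP[|/eqP//].
  by rewrite gt_eqF // mulr_gt0 // exprn_gt0 // addr_gt0 // mulr_gt0.
have ode2 t : ray_O t -> f t + t * g t = t * H0 t.
  move=> Ot; have [e1 e2] := step t Ot; rewrite e2 mulrDr in e1.
  by apply: (addrI (t * g t)); rewrite e1; ring.
move=> t Ot; have [e1 e2] := step t Ot; split=> //; first exact: ode2.
have [Tt _] := Ot; have [df _] := jf _ Tt; have [dg _] := jg _ Tt; have [dH _] := jH _ Tt.
have d1 := rdD df (rdM (rd_id t) dg); have d2 := rdM (rd_id t) dH.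
have oO := ray_O_open Ot.
have d3 : rd (fun t => f t + t * g t) t (1 * H0 t + t * b1 t).
  by apply: (rd_near _ d2); near=> x; rewrite ode2 //; near: x; exact: oO.
have := rd_uniq d1 d3; rewrite e2 !mul1r => E.
by apply: (addrI (H0 t)); rewrite -E; ring.
Unshelve. all: by end_near. Qed.

Hypothesis hc : constant_hol_curvature_on F (randers_slit D b) k.

(** The curvature is compared with [k] in the limit where [v] becomes orthogonal to [z]: the
    terms with [typeI_y] and with the derivative of [H0] carry a factor [sqrt s]. *)
Lemma ray_g_eq t : ray_O t -> g t = - (k / 4) * f t ^+ 2.
Proof.
have [[f1 jf] [g1 jg] [b1 jH] _] := ray_C2 randersF.
have odes := ray_ode jf jg jH.
have ode1 x : ray_O x -> f1 x = g x + H0 x by move=> /odes[].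
have ode2 x : ray_O x -> f x + x * g x = x * H0 x by move=> /odes[].
have ode3 x : ray_O x -> 2 * g x + x * g1 x = x * b1 x by move=> /odes[].
have jets t' : ray_O t' -> [/\ jet2 f f1 t', jet2 g g1 t' & jet2 H0 b1 t'].
  by move=> [Tt' _]; split; [exact: jf|exact: jg|exact: jH].
move=> Ot; have [Tt h0] := Ot; have [_ Dx] := Tt; have [t0 f0 M0 _] := ray_O_pos Ot.
have [y1 hy] := rd_typeI_y jets ray_O_pos Ot.
pose h := Num.sqrt (H0 t); pose y := typeI_y f g H0 b1 t.
have hh : 0 < h by rewrite sqrtr_gt0.
have h2 : h ^+ 2 = H0 t by rewrite sqr_sqrtr // ltW.
have st0 : 0 < Num.sqrt t by rewrite sqrtr_gt0.
pose p w := Num.sqrt (f t + g t * w ^+ 2).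
(* [X w = 0] is the curvature equation at [s = w^2], multiplied by [phi]. *)
pose X w := k * (p w + h * w) ^+ 2 +
    2 * (2 * (((f1 t + g1 t * w ^+ 2) / f t + b1 t * w * p w / (h * f t)) -
        (g t * w + h * p w) ^+ 2 / f t ^+ 2) +
     t * h * w / p w * (y + w ^+ 2 * (y1 + y / t))).
have f0' : 0 < f t + g t * 0 ^+ 2 by rewrite expr0n /= mulr0 addr0.
have [c dp] : exists c, rd p 0 c.
  by eexists; apply: (@rd_sqrt _ (fun w => f t + g t * w ^+ 2)) => //; rd_tac.
have p00 : p 0 != 0 by rewrite gt_eqF // sqrtr_gt0.
have [d dX] : exists d, rd X 0 d by rewrite /X; eexists; rd_tac.
have X0 : X 0 = 0.
  apply: (lim_right_eq0 st0 (X := X)); first exact: cvg_at_right_filter (rd_cvg dX).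
  move=> w /andP[w0 wt].
  have st : 0 < w ^+ 2 < t.
    rewrite exprn_gt0 //= -[X in _ < X](sqr_sqrtr (ltW t0)).
    by rewrite ltrXn2r // ?nnegrE ?sqrtr_ge0 ?ltW.
  have [v [v0 sE w_neq0 _ slit]] := test_vector Tt st.
  have bv := slit (or_introl h0).
  have To : ray_O (sqnorm (rt t)) by rewrite sqnorm_rt.
  have hy' : rd (typeI_y f g H0 b1) (sqnorm (rt t)) y1 by rewrite sqnorm_rt.
  have := typeI_hol_curvature oD ray_O_open jets F2_typeI_rphi ray_O_pos ode1 ode2 ode3
    Dx To w_neq0 hy'.
  rewrite (hc (conj Dx bv)) /typeI_p /typeI_w /typeI_h sE sqnorm_rt // => /complexI.
  rewrite sqrtr_sqr gtr0_norm // -/h -/(p w) -/y => kE; rewrite /X kE.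
  have P1pos : 0 < f t + g t * w ^+ 2 by apply: ray_P1_gt0 => //; case/andP: st => *; rewrite !ltW.
  have pp : 0 < p w by rewrite sqrtr_gt0.
  have q0 : p w + h * w != 0 by rewrite lt0r_neq0 // addr_gt0 // mulr_gt0.
  move: (p w) pp q0 => P pp q0; field.
  by rewrite q0 !lt0r_neq0.
have p02 : p 0 ^+ 2 = f t by rewrite sqr_sqrtr ?ltW // expr0n /= mulr0 addr0.
have E : k * f t ^+ 2 + 4 * g t = 0.
  transitivity (X 0 * f t); last by rewrite X0 mul0r.
  rewrite /X -[in LHS](addrK (H0 t) (g t)) -ode1 // -h2.
  have fE : f t = p 0 ^+ 2 by rewrite p02.
  by rewrite fE; field; rewrite p00 !lt0r_neq0.
by apply/eqP; rewrite -subr_eq0; apply/eqP; transitivity ((k * f t ^+ 2 + 4 * g t) / 4);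
  [field | rewrite E mul0r].
Unshelve. all: by end_near. Qed.

End LocalNecessity.

(** * Connectedness *)

Section Continuity.
Variables (R : realType) (n : nat).
Local Notation C := R[i].
Local Notation V := 'cV[C]_n.

Lemma Re_continuous : continuous (fun x : C => Re x).
Proof.
move=> x; apply/(cvgrPdist_lt (FF := nbhs_filter x)) => e e0.
have e0' : 0 < rc e :> C by rewrite ltcR.
have h : nbhs x [set y | `|x - y| < rc e :> C].
  by apply/nbhs_ballP; exists (rc e) => // y; rewrite -ball_normE.
apply: (@filterS _ _ (nbhs_filter x) _ _ _ h) => y {}h; rewrite -ltcR -ReN -ReD.
exact: le_lt_trans (normc_ge_Re (x - y)) h.
Qed.

Lemma conj_continuous : continuous (fun x : C => x^*).
Proof.
move=> x; apply/(cvgrPdist_lt (FF := nbhs_filter x)) => e e0.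
have h : nbhs x [set y | `|x - y| < e :> C].
  by apply/nbhs_ballP; exists e => // y; rewrite -ball_normE.
by apply: (@filterS _ _ (nbhs_filter x) _ _ _ h) => y {}h; rewrite -rmorphB /= norm_conjC.
Qed.

Lemma cvg_coord (z : V) i : (z' i 0 : C) @[z' --> z] --> (z i 0 : C).
Proof. exact: coord_continuous. Qed.

Lemma cvg_coord_conj (z : V) i : (z' i 0)^* @[z' --> z] --> (z i 0)^*.
Proof. exact: (cvg_comp _ _ (@cvg_coord z i) (@conj_continuous (z i 0))). Qed.

Lemma cvg_coord_sq (z : V) i :
  (fun z : V => z i 0 * (z i 0)^*) z' @[z' --> z] --> z i 0 * (z i 0)^*.
Proof. have h := (cvgM (@cvg_coord z i) (@cvg_coord_conj z i)). exact: h. Qed.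

Lemma normsq_continuous (i : 'I_n) : continuous (fun z : V => Normc.normc (z i 0) ^+ 2).
Proof.
have -> : (fun z : V => Normc.normc (z i 0) ^+ 2) = (fun z : V => Re (z i 0 * (z i 0)^*)).
  by apply/funext => y; rewrite -normc2.
by move=> z; exact: (cvg_comp _ _ (@cvg_coord_sq z i) (@Re_continuous _)).
Qed.

Lemma sqnorm_continuous : continuous (@sqnorm R n).
Proof.
have c (s : seq 'I_n) : continuous (fun z : V => \sum_(i <- s) Normc.normc (z i 0) ^+ 2).
  elim: s => [|i s IH].
    rewrite (_ : (fun _ => _) = (fun=> 0)); first exact: cst_continuous.
    by apply/funext => z; rewrite big_nil.
  rewrite (_ : (fun _ => _) = (fun z : V => Normc.normc (z i 0) ^+ 2 +
    \sum_(i <- s) Normc.normc (z i 0) ^+ 2)).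
    by move=> z; exact: (cvgD (@normsq_continuous i z) (IH z)).
  by apply/funext => z; rewrite big_cons.
exact: c.
Qed.

Lemma sqnorm_interval (D : set V) : connected D -> is_interval (@sqnorm R n @` D).
Proof.
move=> cD; apply/connected_intervalP; apply: connected_continuous_connected => //.
by apply: continuous_subspaceT; exact: sqnorm_continuous.
Qed.
End Continuity.

Section LocallyConstant.
Variable R : realType.

Lemma rd0_near_const (u : R -> R) t : (\forall x \near t, rd u x 0) ->
  \forall x \near t, u x = u t.
Proof.
move=> /nbhs_ballP [e e0 h].
have key x y : x <= y -> (forall w, x <= w <= y -> rd u w 0) -> u x = u y.
  move=> xy hw; have [| |c _] := @MVT_segment _ u (fun=> 0) x y xy.
  - by move=> w; rewrite in_itv /= => /andP[xw wy]; apply: hw; rewrite !ltW.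
  - apply: derivable_within_continuous => w; rewrite in_itv /= => /hw [].
    by [].
  - by rewrite mul0r => /eqP; rewrite subr_eq0 => /eqP.
apply/nbhs_ballP; exists e => // x; rewrite /ball /= => xt.
have hb w : `|t - w| < e -> rd u w 0 by move=> tw; exact: h.
case: (leP x t) => [|/ltW] le.
  apply: key => // w /andP[xw wt]; apply: hb; apply: le_lt_trans xt.
  by rewrite !ger0_norm ?subr_ge0 // lerD2l lerN2.
apply/esym/key => // w /andP[tw wx]; apply: hb; apply: le_lt_trans xt.
by rewrite distrC [leRHS]distrC !ger0_norm ?subr_ge0 // lerD2r.
Qed.

(** The set [u = c] and its complement in [T] are both open in [T], and [T] is connected. *)
Lemma interval_value (T : set R) (u : R -> R) c t1 : is_interval T -> T t1 -> u t1 = c ->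
  (forall t, T t -> \forall x \near t, T x) ->
  (forall t, T t -> u x @[x --> t] --> u t) ->
  (forall t, T t -> u t = c -> \forall x \near t, u x = c) -> forall t, T t -> u t = c.
Proof.
move=> /connected_intervalP cT T1 u1 oT cu lc t Tt.
have : T `&` [set x | u x = c] = T.
  apply: cT; first by exists t1.
    exists [set x | \forall y \near x, u y = c]%classic°; first exact: open_interior.
    apply/seteqP; split => x [Tx /= h]; split => //.
      have := lc x Tx h; rewrite /interior /= => k.
      by have := near_join k.
    have := interior_subset h => /= k; exact: nbhs_singleton k.
  exists (~` [set x | u x != c /\ T x]°); first exact/open_closedC/open_interior.
  apply/seteqP; split => x [Tx /= h]; split => //.
    by move=> /interior_subset /= []; rewrite h eqxx.
  apply/eqP; apply/negPn/negP => ux; apply: h.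
  have o1 := oT x Tx; have o2 : \forall y \near x, u y != c.
    have : nbhs (u x) [set y | y != c] by apply: open_nbhs_nbhs; split=> //; exact: open_neq.
    exact: (cu x Tx).
  by near=> y; split; near: y; [exact: o2 | exact: o1].
by move=> E; rewrite -E in Tt; case: Tt.
Unshelve. all: by end_near. Qed.
End LocallyConstant.

(** * Only the model metrics satisfy both conditions *)

Section GlobalNecessity.
Variables (R : realType) (n : nat).
Local Notation C := R[i].
Local Notation V := 'cV[C]_n.+2.
Local Notation N := Normc.normc.
Variables (D : set V) (F : V -> V -> R) (phi : R -> R -> R).
Variables (a : V -> 'M[C]_n.+2) (b : V -> 'rV[C]_n.+2) (k : R).
Hypothesis oD : open D.
Hypothesis cD : connected D.
Hypothesis randersF : randers D a b F.
Hypothesis unitF : unitary_invariant D F.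
Hypothesis F_phi : forall z v, D z -> v != 0 ->
     F z v = Num.sqrt (sqnorm v * phi (sqnorm z) (s_var z v)).
Hypothesis notherm : ~ is_hermitian D F.
Hypothesis wk : weakly_kahler_on F (randers_slit D b).
Hypothesis hc : constant_hol_curvature_on F (randers_slit D b) k.

Local Notation T := (ray_T D).
Local Notation f := (ray_f a).
Local Notation g := (ray_g a).
Local Notation H0 := (ray_H0 b).
Local Notation O := (ray_O D b).

Let FI := F2_typeI oD randersF unitF F_phi wk.

(** The unitary invariant Hermitian forms at [z]. *)
Lemma hform_invariant (x y : R) (z v : V) :
  hform (\matrix_(i, j) (rc x * (i == j)%:R + rc y * ((z i 0)^* * z j 0))) v =
  rc (x * sqnorm v + y * (N (herm z v) ^+ 2)).
Proof.
have E (r q : R) : rc (x * r + y * q) = rc x * rc r + rc y * rc q :> C.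
  by rewrite rmorphD !rmorphM.
rewrite {}E normc2 -sum_zzb.
transitivity (rc x * (\sum_i v i 0 * (v i 0)^*) +
  rc y * ((\sum_i v i 0 * (z i 0)^*) * (\sum_j z j 0 * (v j 0)^*))); last first.
  by rewrite (sum_vzb z v) -/(herm z v) [X in rc y * X]mulrC.
rewrite /hform mulr_suml !mulr_sumr -big_split; apply: eq_bigr => i _ /=.
rewrite !mulr_sumr.
transitivity (\sum_j (rc x * v i 0 * ((i == j)%:R * (v j 0)^*) +
  rc y * (v i 0 * (z i 0)^* * (z j 0 * (v j 0)^*)))).
  by apply: eq_bigr => j _; rewrite mxE; ring.
by rewrite big_split /= -mulr_sumr sum_kron mulrA.
Qed.

(** Where [beta] vanishes identically the metric is Hermitian. *)
Lemma exists_O : exists t, O t.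
Proof.
apply: contrapT => no; apply: notherm.
have H00 t : T t -> H0 t = 0.
  move=> Tt; apply/eqP; apply/negPn/negP => h; apply: no; exists t; split=> //.
  by rewrite lt_def h; have [] := ray_pos randersF Tt.
(* At the origin [s = 0] for every [v], so that [F^2 = phi(0, 0) r] there. *)
pose x (z : V) : R := if z == 0 then phi 0 0 else f (sqnorm z).
pose y (z : V) : R := if z == 0 then 0 else g (sqnorm z).
exists (fun z => \matrix_(i, j) (rc (x z) * (i == j)%:R + rc (y z) * ((z i 0)^* * z j 0))).
move=> z Dz; split=> [i j|v].
  rewrite !mxE rmorphD !rmorphM /= !conj_rc rmorph_nat conjCK eq_sym; ring.
rewrite hform_invariant /sq_metric; congr (rc _).
have [v0|v0] := eqVneq v 0.
  have [[_ _ Fz _] _ _ _] := randersF; rewrite (Fz z v Dz).2 // v0.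
  have -> : sqnorm (0 : V) = 0 by apply/eqP; rewrite sqnorm_eq0.
  have -> : herm z 0 = 0 by rewrite /herm big1 // => i _; rewrite mxE rmorph0 mulr0.
  by rewrite Normc.normc0 expr0n /= !mulr0 addr0.
rewrite /x /y; case: eqVneq => [z0|z0].
  rewrite mul0r addr0 mulrC (F2_phi randersF F_phi Dz v0) z0.
  have -> : sqnorm (0 : V) = 0 by apply/eqP; rewrite sqnorm_eq0.
  have h0 : herm 0 v = 0 by rewrite /herm big1 // => i _; rewrite mxE mul0r.
  by rewrite /s_var h0 Normc.normc0 expr0n /= mul0r mulrC.
have Tt := ray_Tz unitF Dz z0.
rewrite (FI Dz z0 v0) H00 // mul0r sqrtr0 addr0 sqr_sqrtr; last first.
  by rewrite ltW // (ray_P1_gt0 randersF) // s_var_ge0 s_var_le.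
rewrite mulrDr /s_var mulrCA [sqnorm v * (_ / _)]mulrC divfK ?sqnorm_eq0 //.
by rewrite mulrC.
Qed.

Lemma T_interval : is_interval T.
Proof.
move=> x y [x0 Dx] [y0 Dy] t /andP[xt ty].
have t0 : 0 < t := lt_le_trans x0 xt.
have Ix : (@sqnorm R n.+2 @` D) x by exists (ray n.+1 (Num.sqrt x)) => //; rewrite sqnorm_rt.
have Iy : (@sqnorm R n.+2 @` D) y by exists (ray n.+1 (Num.sqrt y)) => //; rewrite sqnorm_rt.
have [|z Dz E] := sqnorm_interval cD Ix Iy (z := t); first by rewrite xt ty.
by split=> //; rewrite -E; exact: (D_ray unitF).
Qed.

(* The first integral of the equations [ray_ode] and [ray_g_eq]. *)
Let u t := t ^+ 2 * H0 t / f t ^+ 2.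

Lemma u_first_integral t : O t -> u t = t / f t - k / 4 * t ^+ 2.
Proof.
have [[f1 jf] [g1 jg] [b1 jH] _] := ray_C2 randersF.
move=> Ot; have [_ e2 _] := ray_ode oD randersF unitF F_phi wk jf jg jH Ot.
have ge := ray_g_eq oD randersF unitF F_phi wk hc Ot.
have [t0 f0 _ _] := ray_O_pos randersF Ot; have f0' := lt0r_neq0 f0.
transitivity (t * (t * H0 t) / f t ^+ 2); first by rewrite /u; ring.
by rewrite -e2 ge; field.
Qed.

Lemma u_locally_const t : O t -> \forall x \near t, u x = u t.
Proof.
have [[f1 jf] [g1 jg] [b1 jH] _] := ray_C2 randersF.
move=> Ot; have oO := ray_O_open oD randersF Ot.
pose U x := x / f x - k / 4 * x ^+ 2.
have dU : \forall x \near t, rd U x 0.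
  near=> x; have Ox : O x by near: x; exact: oO.
  have [Tx _] := Ox; have [df _] := jf _ Tx.
  have [e1 e2 _] := ray_ode oD randersF unitF F_phi wk jf jg jH Ox.
  have ge := ray_g_eq oD randersF unitF F_phi wk hc Ox.
  have [x0 f0 _ _] := ray_O_pos randersF Ox; have f0' := lt0r_neq0 f0.
  apply: rd_eq (rdB (rd_div f0' (rd_id x) df) (rdM (rd_cst (k / 4) x) (rdX2 (rd_id x)))) _.
  have -> : 1 * f x - x * f1 x = - 2 * x * g x.
    by rewrite e1 mulrDr -e2; ring.
  by rewrite ge /=; field.
have cU := rd0_near_const dU.
near=> x; have Ox : O x by near: x; exact: oO.
by rewrite !u_first_integral //; near: x; exact: cU.
Unshelve. all: by end_near. Qed.

(** The first integral [u] is constant on the whole interval of radii, so [beta] never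
    vanishes there. *)
Lemma u_const : exists2 C0, 0 < C0 & forall t, T t -> u t = C0.
Proof.
have [[f1 jf] _ [b1 jH] _] := ray_C2 randersF.
have [t1 O1] := exists_O; have [T1 h1] := O1.
have [t10 f10 _ _] := ray_O_pos randersF O1.
have u1 : 0 < u t1 by rewrite /u; pos_tac.
exists (u t1) => // t Tt.
apply: (interval_value T_interval T1 (erefl (u t1)) _ _ _ Tt) => x Tx.
- exact: ray_T_open.
- have [df _] := jf _ Tx; have [dH _] := jH _ Tx; have [f0 _ _ _] := ray_pos randersF Tx.
  have f2 : f x ^+ 2 != 0 by rewrite expf_neq0 // lt0r_neq0.
  exact: (rd_cvg (rd_div (g := fun x => f x ^+ 2) f2 (rdM (rdX2 (rd_id x)) dH) (rdX2 df))).
- move=> ux; have Ox : O x.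
    split=> //; have [_ _ h0 _] := ray_pos randersF Tx.
    rewrite lt_def h0 andbT; apply: contraTneq u1 => h.
    by rewrite -ux /u h mulr0 mul0r ltxx.
  by rewrite -ux; exact: u_locally_const.
Qed.

(** The constancy of [u] determines [f], hence [g] and [H0]. The origin is excluded because
    the coefficient [f] of [alpha^2] tends to [0] there, while [alpha] is positive definite and
    smooth on all of [D]. *)
Lemma model_necessary : exists2 C0, 0 < C0 & model_metric C0 k D F.
Proof.
have [C0 c0 uE] := u_const; exists C0 => //.
have TO t : T t -> O t.
  move=> Tt; split=> //; have [_ _ h0 _] := ray_pos randersF Tt.
  rewrite lt_def h0 andbT; apply: contraTneq c0 => h.
  by rewrite -(uE t Tt) /u h mulr0 mul0r ltxx.
have fE t : T t -> f t * model_E C0 k t = t.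
  move=> Tt; have [t0 f0 _ _] := ray_O_pos randersF (TO _ Tt); have f0' := lt0r_neq0 f0.
  have := u_first_integral (TO _ Tt); rewrite uE // /model_E => ->.
  by field.
have E0 t : T t -> 0 < model_E C0 k t.
  move=> Tt; have [t0 f0 _ _] := ray_O_pos randersF (TO _ Tt).
  by rewrite -(pmulr_rgt0 _ f0) fE.
have fM t : T t -> f t = model_f C0 k t.
  move=> Tt; apply: (mulIf (lt0r_neq0 (E0 _ Tt))).
  by rewrite fE // /model_f divfK // lt0r_neq0 // E0.
have D0 : ~ D 0.
  move=> D0; have r0 : ray n.+1 (0 : R) = 0 by rewrite /ray scale0r.
  have [_ [sa _] _ _] := randersF; have [_ d] := sa (i1 n) (i1 n) [::].
  have da : dir_derivable (fun z => a z (i1 n) (i1 n)) (basis_vec R ord0) (ray n.+1 0).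
    by rewrite r0; exact: d.
  have [ra _] := rd_ray da.
  have := along_open oD D0 (basis_vec R ord0) => /nbhs_ballP [e e0 he].
  pose X x := Re (a (ray n.+1 x) (i1 n) (i1 n)) * (C0 + k / 4 * (x ^+ 2) ^+ 2) - x ^+ 2.
  have dX : rd X 0 _ := rdB (rdM ra (rdD (rd_cst C0 0) (rdM (rd_cst (k / 4) 0)
     (rdX2 (rdX2 (rd_id 0)))))) (rdX2 (rd_id 0)).
  have X0 : X 0 = 0.
    apply: (lim_right_eq0 e0 (X := X)); first exact: cvg_at_right_filter (rd_cvg dX).
    move=> x /andP[x0 xe]; have Dx : D (ray n.+1 x).
      have := he x; rewrite /ball /= sub0r normrN gtr0_norm // => /(_ xe).
      by rewrite add0r.
    have sx : Num.sqrt (x ^+ 2) = x by rewrite sqrtr_sqr gtr0_norm.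
    have Tx : T (x ^+ 2) by split; rewrite ?exprn_gt0 // sx.
    have := fE _ Tx; rewrite /model_E /ray_f sx /X => ->.
    by rewrite subrr.
  have : 0 < Re (a (ray n.+1 0) (i1 n) (i1 n)) by apply: (a11_gt0 randersF); rewrite r0.
  move: X0; rewrite /X expr0n /= expr0n /= mulr0 addr0 subr0 => /eqP.
  by rewrite mulf_eq0 (gt_eqF c0) orbF => /eqP ->; rewrite ltxx.
move=> z Dz; have z0 : z != 0 by apply: contraPneq Dz => ->.
have Tt := ray_Tz unitF Dz z0; split=> //; first exact: E0.
move=> v v0; rewrite (FI Dz z0 v0).
have [t0 f0 _ _] := ray_O_pos randersF (TO _ Tt); have f0' := lt0r_neq0 f0.
rewrite (ray_g_eq oD randersF unitF F_phi wk hc (TO _ Tt)).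
suff -> : H0 (sqnorm z) = model_b C0 k (sqnorm z) by rewrite /model_g -fM.
have E0' := lt0r_neq0 (E0 _ Tt).
have fE' : f (sqnorm z) = sqnorm z / model_E C0 k (sqnorm z) by rewrite fM.
have t0' := lt0r_neq0 t0.
have := uE _ Tt; rewrite /u fE' /model_b.
by move: (model_E C0 k _) E0' => E E0' <-; field; rewrite t0' E0'.
Unshelve. all: by end_near. Qed.

End GlobalNecessity.

(** * The three cases *)

Section Trichotomy.
Variables (R : realType) (n : nat).
Local Notation C := R[i].
Local Notation V := 'cV[C]_n.
Variables (D : set V) (F : V -> V -> R) (phi : R -> R -> R).
Variables (a : V -> 'M[C]_n) (b : V -> 'rV[C]_n) (k : R).
Hypothesis randersF : randers D a b F.
Hypothesis F_phi : forall z v, D z -> v != 0 ->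
     F z v = Num.sqrt (sqnorm v * phi (sqnorm z) (s_var z v)).

Definition psi_pos (c t s : R) : R := (Num.sqrt (t / (c ^+ 2 + t ^+ 2)
  - t ^+ 2 / (c ^+ 2 + t ^+ 2) ^+ 2 * s) + Num.sqrt (c ^+ 2 / (c ^+ 2 + t ^+ 2) ^+ 2 * s)) ^+ 2.
Definition psi_zero (c t s : R) : R := c * (Num.sqrt t + Num.sqrt s) ^+ 2.
Definition psi_neg (c t s : R) : R := (Num.sqrt (t / (c ^+ 2 - t ^+ 2)
  + t ^+ 2 / (c ^+ 2 - t ^+ 2) ^+ 2 * s) + Num.sqrt (c ^+ 2 / (c ^+ 2 - t ^+ 2) ^+ 2 * s)) ^+ 2.

Definition psi_model (C0 t s : R) : R := (Num.sqrt (model_f C0 k t + model_g C0 k t * s) +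
  Num.sqrt (model_b C0 k t * s)) ^+ 2.

Lemma sqrt_scale (l x y : R) : 0 <= l ->
  (Num.sqrt (l * x) + Num.sqrt (l * y)) ^+ 2 = l * (Num.sqrt x + Num.sqrt y) ^+ 2.
Proof. by move=> l0; rewrite !sqrtrM // -mulrDr exprMn sqr_sqrtr. Qed.

(** A constant factor [l] on [F^2] divides the curvature by [l]; it accounts for
    [l * k = 4] and for [C0 = c^2 / l]. *)
Lemma psi_model_pos (l c t s : R) : 0 < l -> 0 < c -> l * k = 4 ->
  psi_model (c ^+ 2 / l) t s = l * psi_pos c t s.
Proof.
move=> l0 c0 lk; have ln := lt0r_neq0 l0.
have dn : c ^+ 2 + t ^+ 2 != 0 by rewrite lt0r_neq0 // ltr_wpDr ?sqr_ge0 // exprn_gt0.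
have kE : k = 4 / l by rewrite -lk [l * k]mulrC mulfK.
have EE : model_E (c ^+ 2 / l) k t = (c ^+ 2 + t ^+ 2) / l by rewrite /model_E kE; field.
rewrite /psi_model /psi_pos -sqrt_scale ?ltW // /model_g /model_b /model_f EE kE.
by congr ((Num.sqrt _ + Num.sqrt _) ^+ 2); field; rewrite dn ln.
Qed.

Lemma psi_model_zero (l c t s : R) : 0 < l -> 0 < c -> l * k = 0 ->
  psi_model ((l * c)^-1) t s = l * psi_zero c t s.
Proof.
move=> l0 c0 lk; have ln := lt0r_neq0 l0; have cn := lt0r_neq0 c0.
have k0 : k = 0 by move/eqP: lk; rewrite mulf_eq0 (negbTE ln) => /eqP.
have EE : model_E ((l * c)^-1) k t = (l * c)^-1 by rewrite /model_E k0; ring.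
rewrite /psi_model /psi_zero mulrA -sqrt_scale ?mulr_ge0 ?ltW //.
rewrite /model_g /model_b /model_f EE k0.
by congr ((Num.sqrt _ + Num.sqrt _) ^+ 2); field; rewrite cn ln.
Qed.

Lemma psi_model_neg (l c t s : R) : 0 < l -> c ^+ 2 - t ^+ 2 != 0 -> l * k = -4 ->
  psi_model (c ^+ 2 / l) t s = l * psi_neg c t s.
Proof.
move=> l0 dn lk; have ln := lt0r_neq0 l0.
have kE : k = - 4 / l by rewrite -lk [l * k]mulrC mulfK.
have EE : model_E (c ^+ 2 / l) k t = (c ^+ 2 - t ^+ 2) / l by rewrite /model_E kE; field.
rewrite /psi_model /psi_neg -sqrt_scale ?ltW // /model_g /model_b /model_f EE kE.
by congr ((Num.sqrt _ + Num.sqrt _) ^+ 2); field; rewrite dn ln.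
Qed.

Definition trichotomy : Prop := exists l c : R, [/\ 0 < l, 0 < c &
  [\/ [/\ l * k = 4, phi_is D phi (fun t s => l * psi_pos c t s) & D `<=` [set z | z != 0]],
      [/\ l * k = 0, phi_is D phi (fun t s => l * psi_zero c t s) & D `<=` setT] |
      [/\ l * k = - 4, phi_is D phi (fun t s => l * psi_neg c t s) &
          D `<=` [set z | Num.sqrt (sqnorm z) < Num.sqrt c]]]].

Lemma model_phi (C0 : R) z v : model_metric C0 k D F -> D z -> v != 0 ->
  phi (sqnorm z) (s_var z v) = psi_model C0 (sqnorm z) (s_var z v).
Proof.
move=> mF Dz v0; have [_ _ E] := mF _ Dz.
have r0 : sqnorm v != 0 by rewrite sqnorm_eq0.
by apply: (mulfI r0); rewrite -(F2_phi randersF F_phi Dz v0) E.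
Qed.

Lemma trichotomy_of_model (C0 : R) : 0 < C0 -> model_metric C0 k D F -> trichotomy.
Proof.
move=> c0 mF; have mp := model_phi mF.
case: (ltrgtP k 0) => [kn|kp|kz].
- have l0 : 0 < - 4 / k by rewrite mulNr -mulrN -invrN divr_gt0 // oppr_gt0.
  pose l := - 4 / k; have kn' : k != 0 by rewrite ltr0_neq0.
  have lk : l * k = - 4 by rewrite divfK.
  pose c := Num.sqrt (l * C0).
  have c2 : c ^+ 2 = l * C0 by rewrite sqr_sqrtr // ltW // mulr_gt0.
  have cp : 0 < c by rewrite sqrtr_gt0 mulr_gt0.
  have cE : C0 = c ^+ 2 / l by rewrite c2 mulrC mulKf // lt0r_neq0.
  have dE z : D z -> 0 < c ^+ 2 - sqnorm z ^+ 2.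
    move=> /mF [_ E0 _]; have -> : c ^+ 2 - sqnorm z ^+ 2 = l * model_E C0 k (sqnorm z).
      by rewrite c2 /model_E mulrDr mulrA (mulrA l) lk; field.
    exact: mulr_gt0.
  exists l, c; split=> //; apply: Or33; split=> // [z v Dz v0|z Dz /=].
    by rewrite mp // {1}cE psi_model_neg // lt0r_neq0 // dE.
  rewrite ltr_sqrt // -ltr_sqr ?nnegrE ?sqnorm_ge0 ?(ltW cp) // -subr_gt0.
  exact: dE.
- have l0 : 0 < 4 / k by rewrite divr_gt0.
  pose l := 4 / k; have kn' : k != 0 by rewrite lt0r_neq0.
  have lk : l * k = 4 by rewrite divfK.
  pose c := Num.sqrt (l * C0).
  have c2 : c ^+ 2 = l * C0 by rewrite sqr_sqrtr // ltW // mulr_gt0.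
  have cp : 0 < c by rewrite sqrtr_gt0 mulr_gt0.
  have cE : C0 = c ^+ 2 / l by rewrite c2 mulrC mulKf // lt0r_neq0.
  exists l, c; split=> //; apply: Or31; split=> // [z v Dz v0|z Dz /=].
    by rewrite mp // {1}cE psi_model_pos.
  by have [] := mF _ Dz.
- exists 1, C0^-1; split; rewrite ?ltr01 ?invr_gt0 //; apply: Or32.
  split=> // [|z v Dz v0]; first by rewrite kz mulr0.
  rewrite mp // -psi_model_zero ?ltr01 ?invr_gt0 ?kz ?mulr0 //.
  by rewrite mul1r invrK.
Qed.

(** The degenerate value of [phi] at [z = 0] is incompatible with a metric. *)
Lemma origin_notin (psi : R -> R -> R) : (exists v : V, v != 0) -> phi_is D phi psi ->
  psi 0 0 = 0 -> forall z, D z -> z != 0.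
Proof.
move=> [v v0] ph p0 z Dz; apply/eqP => z0.
have := exprn_gt0 2 (F_gt0 randersF Dz v0).
rewrite lt_def (F2_phi randersF F_phi Dz v0) ph // z0.
have -> : sqnorm (0 : V) = 0 by apply/eqP; rewrite sqnorm_eq0.
have h0 : herm 0 v = 0 by rewrite /herm big1 // => i _; rewrite mxE mul0r.
by rewrite /s_var h0 Normc.normc0 expr0n /= mul0r p0 mulr0 eqxx.
Qed.

Lemma model_of_trichotomy : (exists v : V, v != 0) -> trichotomy ->
  exists2 C0, 0 < C0 & model_metric C0 k D F.
Proof.
move=> nz [l [c [l0 c0 [[lk ph sub]|[lk ph sub]|[lk ph sub]]]]];
  have ln := lt0r_neq0 l0; have cn := lt0r_neq0 c0.
- exists (c ^+ 2 / l) => [|z Dz]; first by rewrite divr_gt0 // exprn_gt0.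
  split; first exact: sub.
    have kE : k = 4 / l by rewrite -lk [l * k]mulrC mulfK.
    rewrite (_ : model_E _ _ _ = (c ^+ 2 + sqnorm z ^+ 2) / l).
      by rewrite divr_gt0 // ltr_wpDr ?sqr_ge0 // exprn_gt0.
    by rewrite /model_E kE; field.
  by move=> v v0; rewrite (F2_phi randersF F_phi Dz v0) ph // -psi_model_pos.
- exists (l * c)^-1 => [|z Dz]; first by rewrite invr_gt0 mulr_gt0.
  split.
  + apply: (origin_notin nz ph) Dz.
    by rewrite /psi_zero sqrtr0 addr0 expr0n /= !mulr0.
  + have k0 : k = 0 by move/eqP: lk; rewrite mulf_eq0 (negbTE ln) => /eqP.
    by rewrite /model_E k0 !mul0r addr0 invr_gt0 mulr_gt0.
  + by move=> v v0; rewrite (F2_phi randersF F_phi Dz v0) ph // -psi_model_zero.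
- exists (c ^+ 2 / l) => [|z Dz]; first by rewrite divr_gt0 // exprn_gt0.
  have d0 : 0 < c ^+ 2 - sqnorm z ^+ 2.
    have := sub _ Dz; rewrite /= ltr_sqrt // => h.
    by rewrite subr_gt0 ltrXn2r // ?nnegrE ?sqnorm_ge0 ?(ltW c0).
  split.
  + apply: (origin_notin nz ph) Dz.
    by rewrite /psi_neg !mul0r mulr0 addr0 sqrtr0 mulr0 sqrtr0 addr0 expr0n /= mulr0.
  + have kE : k = - 4 / l by rewrite -lk [l * k]mulrC mulfK.
    rewrite (_ : model_E _ _ _ = (c ^+ 2 - sqnorm z ^+ 2) / l); first by rewrite divr_gt0.
    by rewrite /model_E kE; field.
  + move=> v v0; rewrite (F2_phi randersF F_phi Dz v0) ph // -psi_model_neg //.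
    exact: lt0r_neq0.
Qed.
End Trichotomy.

Section LowDimension.
Variable R : realType.
Local Notation C := R[i].

Lemma hermitian_dim0 (D : set 'cV[C]_0) (F : 'cV[C]_0 -> 'cV[C]_0 -> R) :
  complex_finsler D F -> is_hermitian D F.
Proof.
move=> [_ _ Fz _]; exists (fun=> 0) => z Dz; split=> [[]//|v].
have -> : v = 0 by apply/matrixP => -[].
by rewrite /sq_metric (Fz z 0 Dz).2 // /hform big_ord0.
Qed.

(** In dimension one homogeneity alone makes [F^2] a Hermitian form. *)
Lemma hermitian_dim1 (D : set 'cV[C]_1) (F : 'cV[C]_1 -> 'cV[C]_1 -> R) :
  complex_finsler D F -> is_hermitian D F.
Proof.
move=> [_ _ _ Fh]; exists (fun z => const_mx (rc (F z (const_mx 1) ^+ 2))) => z Dz.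
split=> [i j|v]; first by rewrite !mxE conj_rc.
have vE : v = v 0 0 *: const_mx 1 by apply/matrixP => i j; rewrite !ord1 !mxE mulr1.
rewrite /sq_metric {1}vE Fh // /hform !big_ord1 mxE mulrC -mulrA -normc2.
by rewrite rmorphM.
Qed.
End LowDimension.

Theorem theorem1p2 (R : realType) (n : nat) (D : set 'cV[R[i]]_n)
  (F : 'cV[R[i]]_n -> 'cV[R[i]]_n -> R) (phi : R -> R -> R)
  (a : 'cV[R[i]]_n -> 'M[R[i]]_n) (b : 'cV[R[i]]_n -> 'rV[R[i]]_n) (k : R)
  (domD : is_domain D)
  (randersF : randers D a b F)
  (unitF : unitary_invariant D F)
  (F_phi : forall z v, D z -> v != 0 ->
     F z v = Num.sqrt (sqnorm v * phi (sqnorm z) (s_var z v)))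
  (notherm : ~ is_hermitian D F) :
  (weakly_kahler_on F (randers_slit D b) /\
   constant_hol_curvature_on F (randers_slit D b) k)
  <->
  exists l c : R, [/\ 0 < l, 0 < c &
    [\/ [/\ l * k = 4,
           phi_is D phi (fun t s => l *
             (Num.sqrt (t / (c ^+ 2 + t ^+ 2)
                        - t ^+ 2 / (c ^+ 2 + t ^+ 2) ^+ 2 * s)
              + Num.sqrt (c ^+ 2 / (c ^+ 2 + t ^+ 2) ^+ 2 * s)) ^+ 2) &
           D `<=` [set z | z != 0]],
        [/\ l * k = 0,
           phi_is D phi (fun t s => l *
             (c * (Num.sqrt t + Num.sqrt s) ^+ 2)) &
           D `<=` setT] |
        [/\ l * k = - 4,
           phi_is D phi (fun t s => l *
             (Num.sqrt (t / (c ^+ 2 - t ^+ 2)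
                        + t ^+ 2 / (c ^+ 2 - t ^+ 2) ^+ 2 * s)
              + Num.sqrt (c ^+ 2 / (c ^+ 2 - t ^+ 2) ^+ 2 * s)) ^+ 2) &
           D `<=` [set z | Num.sqrt (sqnorm z) < Num.sqrt c]]]].
Proof.
have fin : complex_finsler D F by have [] := randersF.
have [oD cD _] := domD.
move: n D F phi a b {domD} randersF unitF F_phi notherm fin oD cD.
case=> [|[|m]] D' F' phi' a' b' rF uF Fphi nh fin oD cD.
- by case: nh; exact: hermitian_dim0.
- by case: nh; exact: hermitian_dim1.
have nz : exists v : 'cV[R[i]]_m.+2, v != 0.
  by exists (vec2 m 1 0); rewrite vec2_neq0 // oner_eq0.
split=> [[wk hc]|h].
  have [C0 c0 mF] := model_necessary oD cD rF uF Fphi nh wk hc.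
  exact: (trichotomy_of_model rF Fphi c0 mF).
have [C0 c0 mF] := model_of_trichotomy rF Fphi nz h.
exact: (model_sufficient oD rF c0 mF).
Qed.
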